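(* Let $\Omega\subseteq\mathbb{C}$ be open, and let $P(z)$, $z\in\Omega$, and $Q(z)$, $z\in\Omega$, be holomorphic families in $\Psi^\bullet(\mathbb{T}^n_\theta)$ of respective orders $w(z)$ and $u(z)$. Then $P(z)Q(z)$, $z\in\Omega$, is a holomorphic family in $\Psi^\bullet(\mathbb{T}^n_\theta)$ of order $w(z)+u(z)$.
   Context: Noncommutative torus. Let $n\ge 2$ and let $\theta=(\theta_{jk})$ be a real antisymmetric $n\times n$ matrix. $C(\mathbb{T}^n_\theta)$ is the universal $C^*$-algebra (norm $\|\cdot\|$) generated by unitaries $U_1,\dots,U_n$ with $U_kU_j=e^{2i\pi\theta_{jk}}U_jU_k$. Put $U^k=U_1^{k_1}\cdots U_n^{k_n}$, $k\in\mathbb{Z}^n$. $C^\infty(\mathbb{T}^n_\theta)=\{\sum_k u_kU^k:\ (u_k)_{k\in\mathbb{Z}^n}\text{ rapidly decaying}\}$ is a Fréchet $*$-algebra with semi-norms $\|\delta^\beta u\|$, where $\delta_1,\dots,\delta_n$ are the derivations with $\delta_j(U^k)=k_jU^k$ and $\delta^\beta=\delta_1^{\beta_1}\cdots\delta_n^{\beta_n}$. Symbols and operators. $C^\infty(\mathbb{T}^n_\theta\times V)$ is the Fréchet space $C^\infty(V;C^\infty(\mathbb{T}^n_\theta))$ for $V\subseteq\mathbb{R}^n$ open. $S_q(\mathbb{T}^n_\theta\times\mathbb{R}^n)$, $q\in\mathbb{C}$: $\rho\in C^\infty(\mathbb{T}^n_\theta\times(\mathbb{R}^n\setminus0))$ with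 $\rho(t\xi)=t^q\rho(\xi)$, $t>0$. $S^q(\mathbb{T}^n_\theta\times\mathbb{R}^n)$: $\rho\in C^\infty(\mathbb{T}^n_\theta\times\mathbb{R}^n)$ for which there are $\rho_{q-j}\in S_{q-j}$, $j\ge0$, such that for all $N,\alpha,\beta$ there is $C$ with $\|\delta^\alpha\partial_\xi^\beta(\rho-\sum_{j<N}\rho_{q-j})(\xi)\|\le C|\xi|^{\Re q-N-|\beta|}$ for $|\xi|\ge1$. $P_\rho(\sum_ku_kU^k)=\sum_ku_k\rho(k)U^k$ is a continuous operator on $C^\infty(\mathbb{T}^n_\theta)$; $\Psi^q(\mathbb{T}^n_\theta)=\{P_\rho:\rho\in S^q\}$, $\Psi^\bullet(\mathbb{T}^n_\theta)=\bigcup_{q\in\mathbb{C}}\Psi^q(\mathbb{T}^n_\theta)$. Holomorphic families. A map into a topological vector space is holomorphic if its complex difference quotients converge at each point. $P(z)$, $z\in\Omega$, is a holomorphic family in $\Psi^\bullet(\mathbb{T}^n_\theta)$ of order $w(z)$ if $P(z)=P_{\rho(z)}$ for all $z\in\Omega$, where: (i) $w(z)$ is holomorphic on $\Omega$ and $\rho(z)\in S^{w(z)}(\mathbb{T}^n_\theta\times\mathbb{R}^n)$ for all $z$; (ii) $\rho(z)$, $z\in\Omega$, is a holomorphic family in $C^\infty(\mathbb{T}^n_\theta\times\mathbb{R}^n)$; (iii) there are $\rho_j(z)\in S_{w(z)-j}(\mathbb{T}^n_\theta\times\mathbb{R}^n)$, $j\ge0$, such that for all $N\ge0$, compact $K\subseteq\Omega$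 and multi-orders $\alpha,\beta$ there is $C$ with $\|\delta^\alpha\partial_\xi^\beta(\rho(z)-\sum_{j<N}\rho_j(z))(\xi)\|\le C|\xi|^{\Re w(z)-N-|\beta|}$ for all $z\in K$, $|\xi|\ge1$. *)

(* Defs.v *)
From HB Require Import structures.
From mathcomp Require Import all_boot all_order all_algebra.
From mathcomp Require Import finmap complex.
From mathcomp Require Import boolp classical_sets functions filter reals topology.
From mathcomp Require Import normedtype derive exp trigo.

Set Implicit Arguments.
Unset Strict Implicit.
Unset Printing Implicit Defensive.

Import Order.TTheory GRing.Theory Num.Theory.
Import numFieldNormedType.Exports Normc.

Local Open Scope classical_set_scope.
Local Open Scope ring_scope.
Local Open Scope complex_scope.

HB.instance Definition _ (R : realType) := PseudoPointedMetric.copy R[i] (R[i]^o).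

Definition expi (R : realType) (x : R) : R[i] := cos x +i* sin x.

(* t ^ q = exp (q * ln t) for t > 0 and q complex. *)
Definition cpowR (R : realType) (t : R) (q : R[i]) : R[i] :=
  (t `^ complex.Re q)%:C * expi (complex.Im q * ln t).

Definition enorm (R : realType) (n : nat) (x : 'rV[R]_n) : R :=
  Num.sqrt (\sum_(j < n) x ord0 j ^+ 2).

Definition int_vec (R : realType) (n : nat) (k : 'rV[int]_n) : 'rV[R]_n :=
  map_mx intr k.

Definition mord_size (n : nat) (b : 'I_n -> nat) : nat := (\sum_(j < n) b j)%N.

(* D_1 ^ b_1 (D_2 ^ b_2 (... (D_n ^ b_n x))) *)
Definition miter (n : nat) (T : Type) (D : 'I_n -> T -> T) (b : 'I_n -> nat)
  (x : T) : T := foldr (fun j => iter (b j) (D j)) x (enum 'I_n).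

Fact normc_ge0 (R : realType) (x : R[i]) : 0 <= normc x.
Proof. by case: x => a b; exact: sqrtr_ge0. Qed.

Fact ler_normcD (R : realType) (x y : R[i]) : normc (x + y) <= normc x + normc y.
Proof.
have := ler_normD x y; rewrite !normc_def -rmorphD lecR.
by case: x y => [a b] [c d].
Qed.

(** Convergence and holomorphy for the topology of a family of semi-norms. *)

Definition sn_cvg (R : realType) (E : lmodType R[i]) (I X : Type)
    (p : I -> E -> R) (F : set_system X) (f : X -> E) (l : E) : Prop :=
  forall i, (fun x => p i (f x - l)) @ F --> (0 : R).

(* Holomorphy on Om of a map into the subspace D of E. *)
Definition sn_holomorphic (R : realType) (E : lmodType R[i]) (I : Type)
    (p : I -> E -> R) (D : set E) (Om : set R[i]) (f : R[i] -> E) : Prop :=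
  forall z, Om z -> D (f z) /\
    exists2 l, D l & sn_cvg p (0 : R[i])^' (fun h => h^-1 *: (f (z + h) - f z)) l.

Definition holomorphic (R : realType) (Om : set R[i]) (w : R[i] -> R[i]) : Prop :=
  forall z, Om z -> derivable (w : R[i]^o -> R[i]^o) z 1.

(** Unital C*-algebras. *)

(* The norm is a field of the structure: the structures of algebras and of
   normed modules have no common extension, since numDomainType would have to
   inherit from it. *)
HB.mixin Record isCStarAlgebra (R : realType) A
    of GRing.NzRing A & GRing.Algebra R[i] A := {
  cnorm : A -> R;
  cnorm_eq0 : forall a, cnorm a = 0 -> a = 0;
  ler_cnormD : forall a b, cnorm (a + b) <= cnorm a + cnorm b;
  cnormZ : forall (c : R[i]) a, cnorm (c *: a) = normc c * cnorm a;
  ler_cnormM : forall a b, cnorm (a * b) <= cnorm a * cnorm b;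
  cnorm_complete : forall a : nat -> A,
    (forall e : R, 0 < e -> exists N, forall i j, (N <= i)%N -> (N <= j)%N ->
       cnorm (a i - a j) < e) ->
    exists l, (fun i => cnorm (a i - l)) @ \oo --> (0 : R);
  star : A -> A;
  starD : {morph star : a b / a + b};
  starZ : forall (c : R[i]) a, star (c *: a) = c^* *: star a;
  starM : forall a b, star (a * b) = star b * star a;
  starK : involutive star;
  cstar_identity : forall a, cnorm (star a * a) = cnorm a ^+ 2
}.

#[short(type="cstarAlgType")]
HB.structure Definition CStarAlgebra (R : realType) :=
  {A of GRing.NzRing A & GRing.Algebra R[i] A & isCStarAlgebra R A}.

Definition cvg_norm (R : realType) (A : cstarAlgType R) (X : Type)
    (F : set_system X) (f : X -> A) (a : A) : Prop :=
  sn_cvg (fun _ : unit => @cnorm R A) F f a.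

(* Unconditional sums, as limits of the net of finite partial sums. *)
Definition fset_filter (I : choiceType) : set_system {fset I} :=
  filter_from setT (fun F0 : {fset I} => [set F : {fset I} | (F0 `<=` F)%fset]).

Definition has_sum (R : realType) (A : cstarAlgType R) (I : choiceType)
    (f : I -> A) (s : A) : Prop :=
  cvg_norm (@fset_filter I) (fun F : {fset I} => \sum_(k <- F) f k) s.

Section HasSum.
Context {R : realType} {A : cstarAlgType R} {I : choiceType}.

Global Instance fset_filter_filter : Filter (@fset_filter I).
Proof.
apply: filter_from_filter; first by exists fset0.
move=> F G _ _; exists (F `|` G)%fset => // H /= FGH.
by split; apply: fsubset_trans FGH; rewrite (fsubsetUl, fsubsetUr).
Qed.

Fact cnorm0 : cnorm (0 : A) = 0.
Proof. by rewrite -(scale0r 0) cnormZ normc0 mul0r. Qed.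

Fact cnorm_ge0 (a : A) : 0 <= cnorm a.
Proof.
have := ler_cnormD a (- a); rewrite subrr cnorm0 -scaleN1r cnormZ.
have -> : normc (-1 : R[i]) = 1.
  by rewrite /normc /= oppr0 expr0n addr0 sqrrN expr1n sqrtr1.
by rewrite mul1r -mulr2n pmulrn_lge0.
Qed.

Fact has_sum0 : has_sum (fun _ : I => 0 : A) 0.
Proof.
move=> t; under eq_fun do rewrite big1 // subr0 cnorm0.
exact: cvg_cst.
Qed.

Fact has_sumZD (c : R[i]) (f g : I -> A) (a b : A) :
  has_sum f a -> has_sum g b -> has_sum (fun k => c *: f k + g k) (c *: a + b).
Proof.
move=> fa gb t.
apply: (@squeeze_cvgr _ _ _ _ (fun=> 0)
  (fun F : {fset I} => normc c * cnorm (\sum_(k <- F) f k - a) +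
            cnorm (\sum_(k <- F) g k - b))); last 2 first.
- exact: cvg_cst.
- rewrite -[X in _ --> X]addr0 -[X in _ --> X + _](mulr0 (normc c)).
  apply: cvgD; last exact: (gb tt).
  by apply: cvgM; [exact: cvg_cst | exact: (fa tt)].
apply: nearW => F; rewrite cnorm_ge0 big_split /= -scaler_sumr.
by rewrite opprD addrACA -scalerBr -cnormZ ler_cnormD.
Qed.

End HasSum.

(* The last clause is automatic for *-homomorphisms of C*-algebras (which are
   even contractive). *)
Definition cstar_hom (R : realType) (A B : cstarAlgType R) (phi : A -> B) : Prop :=
  [/\ linear phi, monoid_morphism phi, {morph phi : a / star a}
    & exists C : R, forall a, cnorm (phi a) <= C * cnorm a].

Definition unitary (R : realType) (A : cstarAlgType R) (a : A) : Prop :=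
  star a * a = 1 /\ a * star a = 1.

Definition nct_relations (R : realType) (n : nat) (theta : 'M[R]_n)
    (A : cstarAlgType R) (U : 'I_n -> A) : Prop :=
  (forall j, unitary (U j)) /\
  (forall j k, U k * U j = expi (2 * pi * theta j k) *: (U j * U k)).

(* C(T^n_theta) is given, up to isomorphism, by its universal property. *)
Record nctorus (R : realType) (n : nat) (theta : 'M[R]_n) := NCTorus {
  nct_alg :> cstarAlgType R;
  nct_gen : 'I_n -> nct_alg;
  nct_genP : nct_relations theta nct_gen;
  nct_universal : forall (B : cstarAlgType R) (V : 'I_n -> B),
    nct_relations theta V ->
    exists! phi : nct_alg -> B,
      cstar_hom phi /\ (forall j, phi (nct_gen j) = V j)
}.

(* Integral powers of a unitary, whose inverse is its adjoint. *)
Definition upow (R : realType) (A : cstarAlgType R) (a : A) (m : int) : A :=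
  match m with Posz p => a ^+ p | Negz p => star a ^+ p.+1 end.

Definition rapid_decay (R : realType) (n : nat) (c : 'rV[int]_n -> R[i]) : Prop :=
  forall m : nat, exists C : R, forall k,
    normc (c k) * (1 + enorm (int_vec R k)) ^+ m <= C.

Section NCTorus.
Context {R : realType} {n : nat} {theta : 'M[R]_n} (T : nctorus theta).
Implicit Types (k : 'rV[int]_n) (q : R[i]).

(* U^k = U_1^k_1 ... U_n^k_n, in this order *)
Definition gen_pow k : T := \prod_(j < n) upow (nct_gen T j) (k ord0 j).

(** The smooth algebra. *)

Definition fourier_series (c : 'rV[int]_n -> R[i]) (a : T) : Prop :=
  rapid_decay c /\ has_sum (fun k => c k *: gen_pow k) a.

Definition is_smooth : {pred T} := fun a => `[< exists c, fourier_series c a >].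

Fact is_smooth_submod : submod_closed is_smooth.
Proof.
split=> [|c a b].
  apply/asboolP; exists (fun=> 0); split.
    by move=> m; exists 0 => k; rewrite normc0 mul0r.
  by under eq_fun do rewrite scale0r; exact: has_sum0.
move=> /asboolP[u [du su]] /asboolP[v [dv sv]]; apply/asboolP.
exists (fun k => c * u k + v k); split; last first.
  under eq_fun do rewrite scalerDl -scalerA; exact: has_sumZD.
move=> m; have [C1 h1] := du m; have [C2 h2] := dv m.
exists (normc c * C1 + C2) => k.
set w := _ ^+ m in h1 h2 *.
have w0 : 0 <= w by rewrite exprn_ge0// addr_ge0// sqrtr_ge0.
apply: (le_trans (ler_wpM2r w0 (ler_normcD _ _))).
by rewrite mulrDl normcM lerD// -mulrA ler_wpM2l// normc_ge0.
Qed.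

HB.instance Definition _ := GRing.isSubmodClosed.Build R[i] T is_smooth is_smooth_submod.

Record Cinf := MkCinf { cval : T; _ : cval \in is_smooth }.

HB.instance Definition _ := [isSub for cval].
HB.instance Definition _ := [Choice of Cinf by <:].
HB.instance Definition _ := [SubChoice_isSubLmodule of Cinf by <:].

(* The coefficients of u are unique, since they depend continuously on u. *)
Definition fourier (u : Cinf) : 'rV[int]_n -> R[i] :=
  xget (fun=> 0) [set c | fourier_series c (cval u)].

Definition delta (j : 'I_n) (u : Cinf) : Cinf :=
  xget 0 [set v : Cinf |
    has_sum (fun k => ((k ord0 j)%:~R * fourier u k) *: gen_pow k) (cval v)].

(* The semi-norms of the Frechet topology of Cinf. *)
Definition Cinf_snorm (a : 'I_n -> nat) (u : Cinf) : R :=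
  cnorm (cval (miter delta a u)).

(** Smooth maps from open subsets of R^n to the smooth algebra. *)

Definition has_pderiv (j : 'I_n) (f : 'rV[R]_n -> Cinf) (xi : 'rV[R]_n) (l : Cinf) :=
  sn_cvg Cinf_snorm (0 : R)^'
    (fun h => (h^-1)%:C *: (f (xi + h *: delta_mx ord0 j) - f xi)) l.

(* 0 where the partial derivative does not exist *)
Definition pderiv (j : 'I_n) (f : 'rV[R]_n -> Cinf) : 'rV[R]_n -> Cinf :=
  fun xi => xget 0 [set l | has_pderiv j f xi l].

(* V is meant to be open: all iterated partial derivatives, in any order, exist
   and are continuous at the points of V. *)
Definition smooth_on (V : set 'rV[R]_n) (f : 'rV[R]_n -> Cinf) : Prop :=
  forall (s : seq 'I_n) xi, V xi ->
    let g := foldr pderiv f s in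
    sn_cvg Cinf_snorm (nbhs xi) g (g xi) /\
    forall j, exists l, has_pderiv j g xi l.

(* The semi-norms of C^oo(T^n_theta x R^n). *)
Definition CinfRn_snorm
    (i : {K : set 'rV[R]_n | compact K} * ('I_n -> nat) * ('I_n -> nat))
    (rho : 'rV[R]_n -> Cinf) : R :=
  let: (K, a, b) := i in
  sup [set Cinf_snorm a (miter pderiv b rho xi) | xi in sval K].

(** Symbols. *)

Definition homogeneous_symbol q (rho : 'rV[R]_n -> Cinf) : Prop :=
  smooth_on [set xi | xi != 0] rho /\
  forall (t : R) xi, 0 < t -> xi != 0 -> rho (t *: xi) = cpowR t q *: rho xi.

Definition remainder (rho : 'rV[R]_n -> Cinf) (rj : nat -> 'rV[R]_n -> Cinf)
    (N : nat) : 'rV[R]_n -> Cinf :=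
  fun xi => rho xi - \sum_(j < N) rj j xi.

Definition remainder_bound q (rho : 'rV[R]_n -> Cinf)
    (rj : nat -> 'rV[R]_n -> Cinf) (N : nat) (a b : 'I_n -> nat) (C : R) : Prop :=
  forall xi, 1 <= enorm xi ->
    Cinf_snorm a (miter pderiv b (remainder rho rj N) xi)
      <= C * enorm xi `^ (complex.Re q - N%:R - (mord_size b)%:R).

Definition symbol q (rho : 'rV[R]_n -> Cinf) : Prop :=
  smooth_on setT rho /\
  exists rj : nat -> 'rV[R]_n -> Cinf,
    (forall j, homogeneous_symbol (q - j%:R) (rj j)) /\
    forall N a b, exists C, remainder_bound q rho rj N a b C.

(* P = P_rho *)
Definition is_quantization (rho : 'rV[R]_n -> Cinf) (P : Cinf -> Cinf) : Prop :=
  forall u, has_sum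
    (fun k => fourier u k *: (cval (rho (int_vec R k)) * gen_pow k)) (cval (P u)).

(** Holomorphic families of operators. *)

Definition holomorphic_family (Om : set R[i]) (w : R[i] -> R[i])
    (P : R[i] -> Cinf -> Cinf) : Prop :=
  holomorphic Om w /\
  exists rho : R[i] -> 'rV[R]_n -> Cinf,
    [/\ forall z, Om z -> is_quantization (rho z) (P z),
        forall z, Om z -> symbol (w z) (rho z),
        sn_holomorphic CinfRn_snorm (smooth_on setT) Om rho
      & exists rj : nat -> R[i] -> 'rV[R]_n -> Cinf,
          (forall j z, Om z -> homogeneous_symbol (w z - j%:R) (rj j z)) /\
          forall N (K : set R[i]) a b, compact K -> K `<=` Om ->
            exists C, forall z, K z ->
              remainder_bound (w z) (rho z) (fun j => rj j z) N a b C].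

End NCTorus.

(* Main.v *)
Require Import Defs.
From HB Require Import structures.
From mathcomp Require Import all_boot all_order all_algebra.
From mathcomp Require Import finmap complex.
From mathcomp Require Import boolp classical_sets functions filter reals topology.
From mathcomp Require Import interval_inference constructive_ereal normedtype sequences derive exp trigo.
From mathcomp Require Import measure lebesgue_measure lebesgue_integral ftc.
From mathcomp Require Import ring lra.

(** Composition of operators corresponds to the product of symbols
      (rho # sigma)(xi) = sum_k sigma_k(xi) rho(xi + k) U^k,
    where sigma_k(xi) are the Fourier coefficients of sigma(xi): the series converges because
    these coefficients decay rapidly whereas rho(xi + k) grows polynomially in k. Replacing
    rho(xi + k) by its Taylor expansion at xi gives the asymptotic expansion of rho # sigma, of
    order w + u; Peetre's inequality <xi + k>^a <= <xi>^a <k>^|a| turns the Taylor remainder into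
    a symbol of the expected order, with constants that are uniform in the parameter z as long as
    the symbol estimates of rho and sigma are.

    Holomorphy of z |-> rho(z) # sigma(z) does not follow from holomorphy in C^oo alone, since the
    product involves values of rho at arbitrarily large xi. But symbol estimates that are locally
    uniform in z, applied to each (scalar) Fourier coefficient, give by Cauchy's estimate a
    second-order Taylor bound at z0 that is uniform in xi and k: the second difference quotients
    of rho and sigma are bounded in a symbol class of constant order, and the product rule follows.
    The Fourier coefficients are controlled by the norm thanks to the gauge automorphisms
    U_j |-> e^{it} U_j given by the universal property. *)

Set Implicit Arguments.
Unset Strict Implicit.
Unset Printing Implicit Defensive.

Import Order.TTheory GRing.Theory Num.Theory.
Import numFieldNormedType.Exports Normc.

Local Open Scope classical_set_scope.
Local Open Scope ring_scope.
Local Open Scope complex_scope.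

(** * Cauchy estimates *)

(** Holomorphy is the mere existence of limits of complex difference quotients, with no continuity
    of the derivative, so Cauchy's estimate has to rest on Goursat's bisection. Estimates in the
    algebra are made on the semi-norms [pn], weighted suprema of Fourier coefficients: they reduce a
    statement about the algebra to scalar functions, coefficient by coefficient, and they see the
    noncommutative product only through phases of modulus 1. The passage back to the C*-norm costs
    [2 * n] powers of the weight, because the weight to the power -2n is summable over the lattice;
    this is the origin of every [2 * n] below. A family whose order w(z) varies has a z-derivative
    that is in general not of order w(z): differentiating |xi|^w(z) produces a logarithm. On a disc
    the order is therefore replaced by a constant integer above Re w. The loss is harmless, as
    holomorphy in C^oo only tests compact sets of xi. Many estimates treat real and imaginary parts
    separately, which explains the recurring factors 2. *)

Section SegmentIntegral.
Variable R : realType.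
Implicit Types (f g : R -> R) (a b c : R).

Definition rint a b f : R := \int[lebesgue_measure]_(x in `[a, b]) f x.

Definition cont_seg a b f := forall x, a <= x <= b -> {for x, continuous f}.

Lemma cont_seg_integrable a b f : cont_seg a b f ->
  (@lebesgue_measure R).-integrable `[a, b] (EFin \o f).
Proof.
move=> cf; apply: continuous_compact_integrable; first exact: segment_compact.
apply: continuous_in_subspaceT => x /set_mem/=; rewrite in_itv/= => xab.
exact: cf.
Qed.

Lemma rint_split a b c f : a <= c <= b -> cont_seg a b f ->
  rint a b f = rint a c f + rint c b f.
Proof.
move=> /andP[ac cb] cf; rewrite /rint.
have := @Rintegral_itvB R f (BLeft a) (BRight b) c (cont_seg_integrable cf).
rewrite !bnd_simp => /(_ ac cb) H.
rewrite -(@Rintegral_itv_obnd_cbnd _ c); last first.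
  by apply: integrableS (cont_seg_integrable cf) => //; apply: subset_itv; rewrite bnd_simp.
by rewrite -H addrC subrK.
Qed.

Lemma rintB a b f g : cont_seg a b f -> cont_seg a b g ->
  rint a b (fun x => f x - g x) = rint a b f - rint a b g.
Proof. by move=> cf cg; apply: RintegralB => //; exact: cont_seg_integrable. Qed.

Lemma eq_rint a b f g : (forall x, a <= x <= b -> f x = g x) -> rint a b f = rint a b g.
Proof.
by move=> fg; apply: eq_Rintegral => x /set_mem/=; rewrite in_itv/= => /fg.
Qed.

Lemma rint_cst a b c : a <= b -> rint a b (fun=> c) = c * (b - a).
Proof.
move=> ab; rewrite /rint Rintegral_cst//= lebesgue_measure_itv/= lte_fin.
by move: ab; case: ltgtP => //= -> _; rewrite subrr.
Qed.

Lemma rint_bound a b f M : a <= b -> cont_seg a b f ->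
  (forall x, a <= x <= b -> `|f x| <= M) -> `|rint a b f| <= M * (b - a).
Proof.
move=> ab cf fM; rewrite /rint.
apply: (le_trans (le_normr_Rintegral _ _)) => //; first exact: cont_seg_integrable.
rewrite -(rint_cst M ab) /rint; apply: le_Rintegral => //.
- by have := integrable_abse (cont_seg_integrable cf).
- by apply: (@cont_seg_integrable a b) => x _; exact: cst_continuous.
Qed.

(** Affine integrands are the ones whose integral must be known exactly: Goursat's argument compares
    a function with its first-order expansion. *)
Lemma rint_affine a b c d : a <= b ->
  rint a b (fun x => c + d * x) = c * (b - a) + d * (b ^+ 2 - a ^+ 2) / 2.
Proof.
rewrite le_eqVlt => /predU1P[->|ab].
  by rewrite /rint set_itv1 Rintegral_set1 !subrr !(mulr0, mul0r) addr0.
pose F (x : R) := c * x + d * x ^+ 2 / 2.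
have dF (x : R) : is_derive x 1 F (c + d * x).
  have -> : F = (fun x => c *: x + (d / 2) *: (x ^+ 2)).
    by apply/funext => y; rewrite /F /GRing.scale/= mulrAC.
  apply: is_derive_eq; rewrite /GRing.scale/=; lra.
have FTC : (\int[lebesgue_measure]_(x in `[a, b]) (c + d * x)%:E = (F b)%:E - (F a)%:E)%E.
  apply: continuous_FTC2 => //.
  - apply: continuous_subspaceT => t; apply: cvgD; first exact: cvg_cst.
    by apply: cvgM; [exact: cvg_cst|exact: cvg_id].
  - have cF t : {for t, continuous F}.
      by apply: differentiable_continuous; apply/derivable1_diffP; case: (dF t).
    split; first by move=> t _; case: (dF t).
      by apply: cvg_at_right_filter; exact: cF.
    by apply: cvg_at_left_filter; exact: cF.
  - by move=> t _; rewrite derive1E; case: (dF t).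
rewrite /rint /Rintegral FTC /= /F; lra.
Qed.

End SegmentIntegral.

Section ComplexNorm.
Variable R : realType.
Implicit Types (z w : R[i]).

Lemma normc_opp z : normc (- z) = normc z.
Proof. exact: normcN. Qed.

Lemma normc_sub z w : normc (z - w) = normc (w - z).
Proof. by rewrite -normc_opp opprB. Qed.

Lemma ler_normcB z w : normc (z - w) <= normc z + normc w.
Proof. by rewrite -(normc_opp w) ler_normcD. Qed.

Lemma ler_normc_Re z : `|complex.Re z| <= normc z.
Proof.
by case: z => a b /=; rewrite -sqrtr_sqr ler_sqrt ?addr_ge0 ?sqr_ge0// lerDl sqr_ge0.
Qed.

Lemma ler_normc_Im z : `|complex.Im z| <= normc z.
Proof.
by case: z => a b /=; rewrite -sqrtr_sqr ler_sqrt ?addr_ge0 ?sqr_ge0// lerDr sqr_ge0.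
Qed.

Lemma normc_real (x : R) : normc x%:C = `|x|.
Proof. by rewrite /normc/= expr0n addr0 sqrtr_sqr. Qed.

Lemma normc_i : normc ('i : R[i]) = 1.
Proof. by rewrite /normc/= expr0n add0r expr1n sqrtr1. Qed.

Lemma normc_le_ReIm z : normc z <= `|complex.Re z| + `|complex.Im z|.
Proof.
have -> : z = (complex.Re z)%:C + 'i * (complex.Im z)%:C by exact: complexE.
apply: (le_trans (ler_normcD _ _)).
rewrite normcM normc_i mul1r !normc_real lerD//.
  by rewrite /= !(mul0r, mulr0, subr0, addr0, mul1r, add0r, oppr0) /=.
by rewrite /= !(mul0r, mulr0, subr0, addr0, mul1r, add0r, oppr0) /=.
Qed.

Lemma normc_expi (x : R) : normc (expi x) = 1.
Proof. by rewrite /normc /expi cos2Dsin2 sqrtr1. Qed.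

Lemma expiD (x y : R) : expi (x + y) = expi x * expi y.
Proof.
rewrite /expi cosD sinD; apply/eqP; rewrite eq_complex/=; apply/andP; split; apply/eqP => //.
by rewrite addrC (mulrC (sin x)).
Qed.

Lemma expi0 : expi (0 : R) = 1.
Proof. by rewrite /expi cos0 sin0. Qed.

Lemma expi2pi : expi (pi *+ 2 : R) = 1.
Proof. by rewrite /expi cos2pi sin2pi. Qed.

End ComplexNorm.

Lemma is_derive_small (R : realType) (f : R -> R) (x d : R) : is_derive x 1 f d ->
  forall e : R, 0 < e -> exists2 r : R, 0 < r &
  forall h : R, `|h| < r -> `|f (x + h) - f x - d * h| <= e * `|h|.
Proof.
move=> [df dE] e e0.
have /cvgrPdist_le/(_ e e0) : (fun h => h^-1 *: (f (h *: 1 + x) - f x)) @ 0^' --> d.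
  by rewrite -dE; exact: df.
rewrite near_withinE => /nbhs_ballP[r /= r0 H]; exists r => // h hr.
have [->|h0] := eqVneq h 0; first by rewrite addr0 subrr mulr0 subr0 !normr0 mulr0.
have := H h; rewrite /ball/= sub0r normrN => /(_ hr h0).
rewrite /GRing.scale/= mulr1 (addrC h) => K.
have -> : f (x + h) - f x - d * h = - ((d - h^-1 * (f (x + h) - f x)) * h).
  by rewrite mulrBl mulrAC mulVf// mul1r opprB.
by rewrite normrN normrM ler_wpM2r.
Qed.

#[global] Arguments normc : simpl never.

(** * Complex differentiability and the complex exponential *)

Section ComplexDerivative.
Variable R : realType.
Local Notation C := R[i].
Implicit Types (f g : C -> C) (z h d : C).

(** The first-order expansion is stated without a quotient, so that h = 0 is allowed and the chain
    rule needs no case distinction on the inner increment. *)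
Definition cdiff f z d := forall e : R, 0 < e -> exists2 r : R, 0 < r &
  forall h, normc h < r -> normc (f (z + h) - f z - d * h) <= e * normc h.

Lemma cdiff_cst (c : C) z : cdiff (fun=> c) z 0.
Proof.
move=> e e0; exists 1 => // h _; rewrite subrr sub0r mul0r oppr0 normc0.
by rewrite mulr_ge0 ?normc_ge0// ltW.
Qed.

Lemma cdiff_lip f z d : cdiff f z d ->
  exists2 r : R, 0 < r & forall h, normc h < r -> normc (f (z + h) - f z) <= (1 + normc d) * normc h.
Proof.
move=> /(_ 1 ltr01)[r r0 H]; exists r => // h hr.
rewrite -[X in normc X](subrK (d * h)) mulrDl.
by apply: (le_trans (ler_normcD _ _)); rewrite normcM lerD// H.
Qed.

Lemma cdiffB f g z d e : cdiff f z d -> cdiff g z e -> cdiff (fun x => f x - g x) z (d - e).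
Proof.
move=> df dg eps e0.
have e20 : 0 < eps / 2 by rewrite divr_gt0.
have [r1 r10 H1] := df _ e20; have [r2 r20 H2] := dg _ e20.
exists (Num.min r1 r2); first by rewrite lt_min r10 r20.
move=> h; rewrite lt_min => /andP[h1 h2].
have -> : f (z + h) - g (z + h) - (f z - g z) - (d - e) * h =
  (f (z + h) - f z - d * h) - (g (z + h) - g z - e * h) by ring.
apply: (le_trans (ler_normcB _ _)).
by rewrite [eps in leRHS]splitr mulrDl lerD ?H1 ?H2.
Qed.

Lemma cdiffM f g z d e : cdiff f z d -> cdiff g z e ->
  cdiff (fun x => f x * g x) z (d * g z + f z * e).
Proof.
move=> df dg eps e0.
(* The three error terms below are at most t |h| times |g z|, |f z| and (1 + |d|)(1 + |e|); the last
   because one increment is bounded by a multiple of |h| and the other by a multiple of t. The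
   remaining summands make A positive. *)
pose A := normc (f z) + (1 + normc d) + (1 + normc e) * (1 + normc d) + normc (g z) + 1.
have A0 : 0 < A.
  by rewrite /A ltr_wpDl// !addr_ge0 ?mulr_ge0 ?addr_ge0 ?normc_ge0.
pose t := eps / A.
have t0 : 0 < t by rewrite divr_gt0.
have [r1 r10 H1] := df _ t0; have [r2 r20 H2] := dg _ t0.
have [r3 r30 H3] := cdiff_lip df; have [r4 r40 H4] := cdiff_lip dg.
exists (Num.min (Num.min r1 r2) (Num.min (Num.min r3 r4) t)).
  by rewrite !lt_min r10 r20 r30 r40 t0.
move=> h; rewrite !lt_min => /andP[/andP[h1 h2] /andP[/andP[h3 h4] h5]].
have -> : f (z + h) * g (z + h) - f z * g z - (d * g z + f z * e) * h =
  (f (z + h) - f z - d * h) * g z + f z * (g (z + h) - g z - e * h)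
  + (f (z + h) - f z) * (g (z + h) - g z) by ring.
have n0 := normc_ge0 h.
apply: (le_trans (ler_normcD _ _)); apply: (le_trans (lerD (ler_normcD _ _) (lexx _))).
rewrite !normcM.
have B1 : normc (f (z + h) - f z - d * h) * normc (g z) <= t * normc h * normc (g z).
  by rewrite ler_wpM2r ?normc_ge0// H1.
have B2 : normc (f z) * normc (g (z + h) - g z - e * h) <= normc (f z) * (t * normc h).
  by rewrite ler_wpM2l ?normc_ge0// H2.
have B3 : normc (f (z + h) - f z) * normc (g (z + h) - g z) <=
    ((1 + normc d) * normc h) * ((1 + normc e) * t).
  rewrite ler_pM ?normc_ge0 ?H3//; apply: (le_trans (H4 _ h4)).
  by rewrite ler_wpM2l ?addr_ge0 ?normc_ge0// ltW.
apply: (le_trans (lerD (lerD B1 B2) B3)).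
have -> : eps = t * A by rewrite /t divfK// gt_eqF.
have K : 0 <= t * normc h by rewrite mulr_ge0// ltW.
have -> : t * normc h * normc (g z) + normc (f z) * (t * normc h) +
  (1 + normc d) * normc h * ((1 + normc e) * t) =
  (t * normc h) * (normc (g z) + normc (f z) + (1 + normc e) * (1 + normc d)) by ring.
rewrite [leRHS]mulrAC ler_wpM2l// /A.
by have := normc_ge0 d; lra.
Qed.

Lemma cdiff_comp f g z d e : cdiff f (g z) d -> cdiff g z e -> cdiff (f \o g) z (d * e).
Proof.
move=> df dg eps e0.
have A0 : 0 < normc d + (1 + normc e) by rewrite ltr_wpDl ?normc_ge0// ltr_pwDl ?normc_ge0.
pose t := eps / (normc d + (1 + normc e)).
have t0 : 0 < t by rewrite divr_gt0.
have [r1 r10 H1] := df _ t0; have [r2 r20 H2] := dg _ t0.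
have [r4 r40 H4] := cdiff_lip dg.
have E0 : 0 < 1 + normc e by rewrite ltr_pwDl ?normc_ge0.
exists (Num.min (Num.min r2 r4) (r1 / (1 + normc e))).
  by rewrite !lt_min r20 r40 divr_gt0.
move=> h; rewrite !lt_min ltr_pdivlMr// => /andP[/andP[h2 h4] h5].
rewrite /=; set k := g (z + h) - g z.
have kr : normc k < r1 by apply: le_lt_trans (H4 _ h4) _; rewrite mulrC.
have -> : f (g (z + h)) - f (g z) - d * e * h =
  (f (g z + k) - f (g z) - d * k) + d * (k - e * h).
  have -> : g z + k = g (z + h) by rewrite /k; ring.
  by rewrite /k; ring.
apply: (le_trans (ler_normcD _ _)); rewrite normcM.
have n0 := normc_ge0 h.
have B1 : normc (f (g z + k) - f (g z) - d * k) <= t * ((1 + normc e) * normc h).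
  by apply: (le_trans (H1 _ kr)); rewrite ler_wpM2l ?(ltW t0)// H4.
have B2 : normc d * normc (k - e * h) <= normc d * (t * normc h).
  by rewrite ler_wpM2l ?normc_ge0// H2.
apply: (le_trans (lerD B1 B2)).
have -> : eps = t * (normc d + (1 + normc e)) by rewrite /t divfK// gt_eqF.
by rewrite le_eqVlt; apply/orP; left; apply/eqP; ring.
Qed.

Lemma cdiffN z : cdiff -%R z (-1).
Proof.
move=> e e0; exists 1 => // h _.
have -> : - (z + h) - - z - -1 * h = 0 by ring.
by rewrite normc0 mulr_ge0 ?normc_ge0// ltW.
Qed.

Definition cexp z : C := (expR (complex.Re z))%:C * expi (complex.Im z).

Lemma cexpD z w : cexp (z + w) = cexp z * cexp w.
Proof.
case: z => a b; case: w => c d; rewrite /cexp/= expRD expiD.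
by rewrite rmorphM/= !mulrA; congr (_ * _); rewrite mulrAC.
Qed.

Lemma cexp0 : cexp 0 = 1.
Proof. by rewrite /cexp/= expR0 expi0 mul1r. Qed.

Lemma normc_cexp z : normc (cexp z) = expR (complex.Re z).
Proof. by rewrite /cexp normcM normc_expi mulr1 normc_real ger0_norm ?expR_ge0. Qed.

Lemma cdiff_cexp z : cdiff cexp z (cexp z).
Proof.
(* By the functional equation only the point 0 matters; there the expansion follows from the real
   derivatives of exp, cos and sin at 0. *)
suff H0 : cdiff cexp 0 1.
  move=> e e0; have N0 : 0 < normc (cexp z) by rewrite normc_cexp expR_gt0.
  have [r r0 H] := H0 _ (divr_gt0 e0 N0); exists r => // h hr.
  rewrite cexpD; have -> : cexp z * cexp h - cexp z - cexp z * h = cexp z * (cexp h - 1 - 1 * h).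
    by ring.
  have := H h hr; rewrite add0r cexp0 => K.
  rewrite [normc (_ * _)]normcM mulrC -ler_pdivlMr//; apply: (le_trans K).
  by rewrite mulrAC.
move=> e e0.
(* The four error terms add up to at most 6 t N. The bound t <= 1 keeps [expR a] and |1 + a| below
   2. *)
pose t := Num.min (e / 8) 1.
have t0 : 0 < t by rewrite lt_min ltr01 divr_gt0.
have te : t <= e / 8 by rewrite ge_min lexx.
have t1 : t <= 1 by rewrite ge_min lexx orbT.
have [r1 r10 H1] := is_derive_small (is_derive_expR (0 : R)) t0.
have [r2 r20 H2] := is_derive_small (is_derive_cos (0 : R)) t0.
have [r3 r30 H3] := is_derive_small (is_derive_sin (0 : R)) t0.
exists (Num.min (Num.min r1 r2) (Num.min r3 (t / 2))).
  by rewrite !lt_min r10 r20 r30 divr_gt0.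
case=> a b; rewrite !lt_min => /andP[/andP[h1 h2] /andP[h3 h4]].
set N := normc (a +i* b) in h1 h2 h3 h4 *.
have aN : `|a| <= N by have := ler_normc_Re (a +i* b).
have bN : `|b| <= N by have := ler_normc_Im (a +i* b).
rewrite add0r cexp0 mul1r /cexp/expi; apply: (le_trans (normc_le_ReIm _)) => /=.
rewrite !(mul0r, subr0, addr0, oppr0).
have := H1 a (le_lt_trans aN h1); rewrite add0r expR0 mul1r => E1.
have := H2 b (le_lt_trans bN h2); rewrite add0r cos0 sin0 oppr0 mul0r subr0 => E2.
have := H3 b (le_lt_trans bN h3); rewrite add0r sin0 cos0 mul1r subr0 => E3.
have N0 : 0 <= N by exact: normc_ge0.
have E4 : `|expR a - 1| <= t.
  rewrite -(subrK a (expR a - 1)); apply: (le_trans (ler_normD _ _)).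
  by move: h4 (normr_ge0 a); nra.
have -> : expR a * cos b - 1 - a = (expR a - 1 - a) * cos b + (1 + a) * (cos b - 1) by ring.
have -> : expR a * sin b - b = (sin b - b) * expR a + b * (expR a - 1) by ring.
have C1 : `|cos b| <= 1.
  by rewrite -(ler_pXn2r (n := 2)) ?nnegrE// expr1n real_normK ?num_real// -(cos2Dsin2 b) lerDl sqr_ge0.
have B1 : `|(expR a - 1 - a) * cos b| <= t * N.
  rewrite normrM -[leRHS]mulr1 ler_pM//; apply: (le_trans E1).
  by rewrite ler_wpM2l// ltW.
have B2 : `|(1 + a) * (cos b - 1)| <= 2 * (t * N).
  rewrite normrM ler_pM//.
    apply: (le_trans (ler_normD _ _)); rewrite normr1; lra.
  by apply: (le_trans E2); rewrite ler_wpM2l// ltW.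
have B3 : `|(sin b - b) * expR a| <= (t * N) * 2.
  rewrite normrM ler_pM//.
    by apply: (le_trans E3); rewrite ler_wpM2l// ltW.
  rewrite -(subrK 1 (expR a)); apply: (le_trans (ler_normD _ _)); rewrite normr1; lra.
have B4 : `|b * (expR a - 1)| <= N * t by rewrite normrM ler_pM.
have := ler_normD ((expR a - 1 - a) * cos b) ((1 + a) * (cos b - 1)).
have := ler_normD ((sin b - b) * expR a) (b * (expR a - 1)).
have : t * N <= e / 8 * N by rewrite ler_wpM2r.
have : 0 <= e * N by rewrite mulr_ge0// ltW.
by lra.
Qed.

End ComplexDerivative.

Section ComplexSegmentIntegral.
Variable R : realType.
Local Notation C := R[i].
Implicit Types (p q : R -> C) (a b : R).

Definition ccont_seg a b p :=
  cont_seg a b (@complex.Re R \o p) /\ cont_seg a b (@complex.Im R \o p).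

Definition cint a b p : C :=
  rint a b (@complex.Re R \o p) +i* rint a b (@complex.Im R \o p).

Lemma eq_cint a b p q : (forall x, a <= x <= b -> p x = q x) -> cint a b p = cint a b q.
Proof.
by move=> pq; congr (_ +i* _); apply: eq_rint => x xab /=; rewrite pq.
Qed.

Lemma cint_split a b c p : a <= c <= b -> ccont_seg a b p ->
  cint a b p = cint a c p + cint c b p.
Proof. by move=> acb [c1 c2]; rewrite /cint (rint_split acb c1) (rint_split acb c2). Qed.

Lemma cintB a b p q : ccont_seg a b p -> ccont_seg a b q ->
  cint a b (fun x => p x - q x) = cint a b p - cint a b q.
Proof.
move=> [p1 p2] [q1 q2]; rewrite /cint -[_ - _]/(_ +i* _) -!rintB//.
by congr (_ +i* _); apply: eq_rint => x _ /=; case: (p x) => ? ?; case: (q x).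
Qed.

Lemma ccont_segB a b p q : ccont_seg a b p -> ccont_seg a b q ->
  ccont_seg a b (fun x => p x - q x).
Proof.
move=> [p1 p2] [q1 q2]; split=> x xab.
  have -> : @complex.Re R \o (fun x => p x - q x) =
     (fun x => (@complex.Re R \o p) x - (@complex.Re R \o q) x).
    by apply/funext => y /=; case: (p y) => ? ?; case: (q y).
  by apply: cvgB; [exact: p1|exact: q1].
have -> : @complex.Im R \o (fun x => p x - q x) =
   (fun x => (@complex.Im R \o p) x - (@complex.Im R \o q) x).
  by apply/funext => y /=; case: (p y) => ? ?; case: (q y).
by apply: cvgB; [exact: p2|exact: q2].
Qed.

Lemma cint_cst a b (c : C) : a <= b -> cint a b (fun=> c) = c * (b - a)%:C.
Proof.
move=> ab; rewrite /cint !rint_cst//; case: c => x y /=.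
by rewrite /GRing.mul/= !mulr0 subr0 add0r.
Qed.

Lemma ccont_seg_cst a b (c : C) : ccont_seg a b (fun=> c).
Proof. by split=> x _; exact: cst_continuous. Qed.

Lemma cint_affine a b (c d : C) : a <= b ->
  cint a b (fun x => c + d * x%:C) = c * (b - a)%:C + d * ((b ^+ 2 - a ^+ 2) / 2)%:C.
Proof.
move=> ab; case: c => c1 c2; case: d => d1 d2; rewrite /cint.
rewrite (@eq_rint _ _ _ _ (fun x => c1 + d1 * x)); last first.
  by move=> x _ /=; rewrite mulr0 subr0.
rewrite (@eq_rint _ _ _ (@complex.Im R \o _) (fun x => c2 + d2 * x)); last first.
  by move=> x _ /=; rewrite mulr0 add0r.
rewrite !rint_affine//; apply/eqP; rewrite eq_complex /=.
by apply/andP; split; apply/eqP; ring.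
Qed.

(** Bounding the two components separately costs a factor 2, which the later constants absorb. *)
Lemma cint_bound a b p (M : R) : a <= b -> ccont_seg a b p ->
  (forall x, a <= x <= b -> normc (p x) <= M) -> normc (cint a b p) <= 2 * M * (b - a).
Proof.
move=> ab [c1 c2] pM; apply: (le_trans (normc_le_ReIm _)) => /=.
have -> : 2 * M * (b - a) = M * (b - a) + M * (b - a) by ring.
apply: lerD; apply: rint_bound => // x xab /=.
  by apply: le_trans (pM _ xab); exact: ler_normc_Re.
by apply: le_trans (pM _ xab); exact: ler_normc_Im.
Qed.

End ComplexSegmentIntegral.

(** * Goursat's theorem on rectangles *)

Section Goursat.
Variable R : realType.
Local Notation C := R[i].
Implicit Types (g : C -> C).

Definition holo_rect (g : C -> C) (x1 x2 y1 y2 : R) := forall x y,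
  x1 <= x <= x2 -> y1 <= y <= y2 -> exists d, cdiff g (x +i* y) d.

(** The contour integral along the boundary, counterclockwise; dz = i dy on the vertical sides. *)
Definition rect_int (g : C -> C) (x1 x2 y1 y2 : R) : C :=
  cint x1 x2 (fun x => g (x +i* y1)) - cint x1 x2 (fun x => g (x +i* y2)) +
  'i * (cint y1 y2 (fun y => g (x2 +i* y)) - cint y1 y2 (fun y => g (x1 +i* y))).

#[global] Arguments rect_int : simpl never.

Lemma cdiff_continuous_line g (z v d : C) : cdiff g z d -> forall e : R, 0 < e ->
  exists2 r : R, 0 < r & forall t : R, `|t| < r -> normc (g (z + v * t%:C) - g z) <= e.
Proof.
move=> /cdiff_lip[r r0 H] e e0.
have A0 : 0 < (1 + normc d) * (1 + normc v).
  by rewrite mulr_gt0// ltr_pwDl// normc_ge0.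
have B0 : 0 < 1 + normc v by rewrite ltr_pwDl// normc_ge0.
exists (Num.min (r / (1 + normc v)) (e / ((1 + normc d) * (1 + normc v)))).
  by rewrite /= lt_min !divr_gt0.
move=> t; rewrite lt_min !ltr_pdivlMr// => /andP[t1 t2].
have vt : normc (v * t%:C) <= `|t| * (1 + normc v).
  rewrite normcM normc_real mulrC ler_wpM2l//; lra.
apply: (le_trans (H _ (le_lt_trans vt t1))).
have := normc_ge0 d; move: vt t2; set N := normc (v * _) => *.
by nra.
Qed.

(** The directions v = 1 and v = i give the horizontal and the vertical edges. *)
Lemma ccont_line g a b (z v : C) :
  (forall t : R, a <= t <= b -> exists d, cdiff g (z + v * t%:C) d) ->
  ccont_seg a b (fun t => g (z + v * t%:C)).
Proof.
move=> H.
have K t : a <= t <= b -> forall e : R, 0 < e ->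
    \forall s \near t, normc (g (z + v * s%:C) - g (z + v * t%:C)) <= e.
  move=> /H[d dg] e e0; have [r r0 Hr] := @cdiff_continuous_line _ _ v _ dg e e0.
  apply/nbhs_ballP; exists r => // s; rewrite /ball/= distrC => /Hr.
  by have -> : z + v * t%:C + v * (s - t)%:C = z + v * s%:C by rewrite rmorphB/=; ring.
split=> t /K{}K; apply/cvgrPdist_le => e /K; apply: filterS => s /=.
  apply: le_trans; rewrite distrC; apply: le_trans (ler_normc_Re _).
  by case: (g _) => ? ?; case: (g _).
apply: le_trans; rewrite distrC; apply: le_trans (ler_normc_Im _).
by case: (g _) => ? ?; case: (g _).
Qed.

Lemma ccont_edge_h g x1 x2 y1 y2 y : holo_rect g x1 x2 y1 y2 -> y1 <= y <= y2 ->
  ccont_seg x1 x2 (fun x => g (x +i* y)).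
Proof.
move=> hg yy; have E (x : R) : x +i* y = (0 +i* y) + 1 * x%:C.
  by rewrite mul1r; congr (_ +i* _); rewrite ?add0r ?addr0.
rewrite (_ : (fun x => _) = (fun x => g ((0 +i* y) + 1 * x%:C))).
  by apply: ccont_line => x xx; rewrite -E; exact: hg.
by apply/funext => x; rewrite E.
Qed.

Lemma complex_point (x y : R) : x +i* y = x%:C + 'i * y%:C.
Proof. by rewrite {1}[_ +i* _]complexE. Qed.

Lemma ccont_edge_v g x1 x2 y1 y2 x : holo_rect g x1 x2 y1 y2 -> x1 <= x <= x2 ->
  ccont_seg y1 y2 (fun y => g (x +i* y)).
Proof.
move=> hg xx; have E (y : R) : x +i* y = (x +i* 0) + 'i * y%:C by exact: complex_point.
rewrite (_ : (fun y => _) = (fun y => g ((x +i* 0) + 'i * y%:C))).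
  by apply: ccont_line => y yy; rewrite -E; exact: hg.
by apply/funext => y; rewrite E.
Qed.

Lemma holo_rectS g x1 x2 y1 y2 x1' x2' y1' y2' :
  x1 <= x1' -> x2' <= x2 -> y1 <= y1' -> y2' <= y2 ->
  holo_rect g x1 x2 y1 y2 -> holo_rect g x1' x2' y1' y2'.
Proof.
move=> a b c d hg x y /andP[x1x xx2] /andP[y1y yy2]; apply: hg; apply/andP; split;
  [exact: le_trans x1x|exact: le_trans b|exact: le_trans y1y|exact: le_trans d].
Qed.

Lemma rect_int_splitx g x1 c x2 y1 y2 : x1 <= c <= x2 -> y1 <= y2 ->
  holo_rect g x1 x2 y1 y2 ->
  rect_int g x1 x2 y1 y2 = rect_int g x1 c y1 y2 + rect_int g c x2 y1 y2.
Proof.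
move=> xcx yy hg; rewrite /rect_int.
rewrite (cint_split xcx (ccont_edge_h hg _)) ?lexx ?yy//.
rewrite (cint_split xcx (ccont_edge_h hg _)) ?lexx ?yy//.
by ring.
Qed.

Lemma rect_int_splity g x1 x2 y1 c y2 : x1 <= x2 -> y1 <= c <= y2 ->
  holo_rect g x1 x2 y1 y2 ->
  rect_int g x1 x2 y1 y2 = rect_int g x1 x2 y1 c + rect_int g x1 x2 c y2.
Proof.
move=> xx ycy hg; rewrite /rect_int.
rewrite (cint_split ycy (ccont_edge_v hg _)) ?lexx ?xx//.
rewrite (cint_split ycy (ccont_edge_v hg _)) ?lexx ?xx//.
by ring.
Qed.

(** The horizontal edges contribute - i d (x2 - x1)(y2 - y1), the vertical ones the opposite. *)
Lemma rect_int_affine (c d : C) x1 x2 y1 y2 : x1 <= x2 -> y1 <= y2 ->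
  rect_int (fun z => c + d * z) x1 x2 y1 y2 = 0.
Proof.
move=> xx yy; rewrite /rect_int.
have H y : cint x1 x2 (fun x => c + d * (x +i* y)) =
  cint x1 x2 (fun x => (c + d * 'i * y%:C) + d * x%:C).
  by apply: eq_cint => x _; rewrite complex_point; ring.
have V x : cint y1 y2 (fun y => c + d * (x +i* y)) =
  cint y1 y2 (fun y => (c + d * x%:C) + (d * 'i) * y%:C).
  by apply: eq_cint => y _; rewrite complex_point; ring.
rewrite !H !V !cint_affine// !rmorphB/=.
move: ('i : C) (@sqr_i R) => i i2.
by ring.
Qed.

Lemma rect_intB g1 g2 x1 x2 y1 y2 : x1 <= x2 -> y1 <= y2 ->
  holo_rect g1 x1 x2 y1 y2 -> holo_rect g2 x1 x2 y1 y2 ->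
  rect_int (fun z => g1 z - g2 z) x1 x2 y1 y2 =
  rect_int g1 x1 x2 y1 y2 - rect_int g2 x1 x2 y1 y2.
Proof.
move=> xx yy h1 h2; rewrite /rect_int.
rewrite !cintB; try by (apply: ccont_edge_h; eauto; rewrite ?lexx ?xx ?yy).
all: try by (apply: ccont_edge_v; eauto; rewrite ?lexx ?xx ?yy).
by ring.
Qed.

Lemma rect_int_bound g x1 x2 y1 y2 (M : R) : x1 <= x2 -> y1 <= y2 ->
  holo_rect g x1 x2 y1 y2 ->
  (forall x y, x1 <= x <= x2 -> y1 <= y <= y2 -> normc (g (x +i* y)) <= M) ->
  normc (rect_int g x1 x2 y1 y2) <= 4 * M * ((x2 - x1) + (y2 - y1)).
Proof.
move=> xx yy hg gM; rewrite /rect_int.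
apply: (le_trans (ler_normcD _ _)); rewrite normcM normc_i mul1r.
have -> : 4 * M * (x2 - x1 + (y2 - y1)) =
  (2 * M * (x2 - x1) + 2 * M * (x2 - x1)) + (2 * M * (y2 - y1) + 2 * M * (y2 - y1)) by ring.
apply: lerD; apply: (le_trans (ler_normcB _ _)); apply: lerD.
- by apply: cint_bound => // [|x xx']; [apply: ccont_edge_h hg _|apply: gM => //]; rewrite lexx yy.
- by apply: cint_bound => // [|x xx']; [apply: ccont_edge_h hg _|apply: gM => //]; rewrite lexx yy.
- by apply: cint_bound => // [|y yy']; [apply: ccont_edge_v hg _|apply: gM => //]; rewrite lexx xx.
- by apply: cint_bound => // [|y yy']; [apply: ccont_edge_v hg _|apply: gM => //]; rewrite lexx xx.
Qed.

End Goursat.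

Lemma not_all_quarters_lt (R : realType) (a b c d e : R) : a <= b + c + (d + e) ->
  4 * b < a -> 4 * c < a -> 4 * d < a -> 4 * e < a -> False.
Proof. by lra. Qed.

Lemma ler_dist_interval (R : realType) (a p x l : R) :
  x <= a <= x + l -> x <= p <= x + l -> `|a - p| <= l.
Proof. by move=> /andP[? ?] /andP[? ?]; rewrite ler_norml; apply/andP; split; lra. Qed.

Section GoursatTheorem.
Variable R : realType.
Local Notation C := R[i].
Implicit Types (g : C -> C).

Lemma nested_intervals (x l : nat -> R) :
  (forall n, x n <= x n.+1) -> (forall n, x n.+1 + l n.+1 <= x n + l n) ->
  (forall n, 0 <= l n) -> exists p, forall n, x n <= p <= x n + l n.
Proof.
move=> x1 x2 l0.
have mono n k : x n <= x (n + k)%N.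
  by elim: k => [|k IH]; rewrite ?addn0 ?addnS ?(le_trans IH).
have anti n k : x (n + k)%N + l (n + k)%N <= x n + l n.
  by elim: k => [|k IH]; rewrite ?addn0 ?addnS ?(le_trans _ IH).
have xl n m : x m <= x n + l n.
  have [nm|/ltnW mn] := leqP n m.
    by rewrite -(subnKC nm) (le_trans _ (anti n (m - n)%N))// lerDl.
  by rewrite -(subnKC mn) (le_trans (mono m (n - m)%N))// lerDl.
have ub : has_sup (range x).
  by split; [exists (x 0%N), 0%N|exists (x 0%N + l 0%N) => _ [m _ <-]].
exists (sup (range x)) => n; apply/andP; split.
  by apply: ub_le_sup; [exact: ub.2|exists n].
by apply: ge_sup; [exact: ub.1|move=> _ [m _ <-]].
Qed.

(** The integrals over the four quarters add up to the whole one, so one of them carries at least a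
    quarter of its modulus. *)
Lemma rect_int_quarter g (x y w v : R) : 0 <= w -> 0 <= v ->
  holo_rect g x (x + w) y (y + v) ->
  exists x' y', [/\ x <= x', x' + w / 2 <= x + w, y <= y', y' + v / 2 <= y + v &
    normc (rect_int g x (x + w) y (y + v)) <=
    4 * normc (rect_int g x' (x' + w / 2) y' (y' + v / 2))].
Proof.
move=> w0 v0 hg.
have [w20 v20] : 0 <= w / 2 /\ 0 <= v / 2 by split; rewrite divr_ge0.
have xm : x <= x + w / 2 <= x + w by rewrite lerDl w20/=; lra.
have ym : y <= y + v / 2 <= y + v by rewrite lerDl v20/=; lra.
have /andP[xm1 xm2] := xm; have /andP[ym1 ym2] := ym.
have xe : x + w / 2 + w / 2 = x + w by lra.
have ye : y + v / 2 + v / 2 = y + v by lra.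
have E : rect_int g x (x + w) y (y + v) =
  (rect_int g x (x + w / 2) y (y + v / 2) + rect_int g x (x + w / 2) (y + v / 2) (y + v)) +
  (rect_int g (x + w / 2) (x + w) y (y + v / 2) + rect_int g (x + w / 2) (x + w) (y + v / 2) (y + v)).
  rewrite (rect_int_splitx xm _ hg) ?lerDl//; congr (_ + _).
    by apply: rect_int_splity => //; apply: holo_rectS hg.
  by apply: rect_int_splity => //; apply: holo_rectS hg.
set A := rect_int g x (x + w) y (y + v).
set i1 := rect_int g x (x + w / 2) y (y + v / 2) in E.
set i2 := rect_int g x (x + w / 2) (y + v / 2) (y + v) in E.
set i3 := rect_int g (x + w / 2) (x + w) y (y + v / 2) in E.
set i4 := rect_int g (x + w / 2) (x + w) (y + v / 2) (y + v) in E.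
have B : normc A <= normc i1 + normc i2 + (normc i3 + normc i4).
  rewrite /A E; apply: (le_trans (ler_normcD _ _)).
  by rewrite lerD// ler_normcD.
have [H1|H1] := leP (normc A) (4 * normc i1); first by exists x, y; split.
have [H2|H2] := leP (normc A) (4 * normc i2).
  by exists x, (y + v / 2); rewrite ye; split.
have [H3|H3] := leP (normc A) (4 * normc i3).
  by exists (x + w / 2), y; rewrite xe; split.
have [H4|H4] := leP (normc A) (4 * normc i4).
  by exists (x + w / 2), (y + v / 2); rewrite xe ye; split.
by case: (not_all_quarters_lt B H1 H2 H3 H4).
Qed.

(** Repeated quartering yields rectangles of size 2^-n that shrink to a point p and carry at least
    4^-n of the integral. Near p the function differs from an affine map, of integral zero, by
    o(2^-n), and the perimeter is of order 2^-n: the integral is 4^n o(4^-n). *)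
Theorem goursat g (x0 y0 w v : R) : 0 <= w -> 0 <= v ->
  holo_rect g x0 (x0 + w) y0 (y0 + v) ->
  rect_int g x0 (x0 + w) y0 (y0 + v) = 0.
Proof.
move=> w0 v0 hg.
pose A := normc (rect_int g x0 (x0 + w) y0 (y0 + v)).
have e4 (n : nat) : 0 < 2 ^+ n :> R by rewrite exprn_gt0.
pose wn n := w / 2 ^+ n; pose vn n := v / 2 ^+ n.
have wn0 n : 0 <= wn n by rewrite divr_ge0// ltW.
have vn0 n : 0 <= vn n by rewrite divr_ge0// ltW.
have half n : (wn n / 2 = wn n.+1) * (vn n / 2 = vn n.+1).
  by rewrite /wn /vn exprS -!mulrA !invfM (mulrC 2^-1).
pose good n (q : R * R) := [/\ x0 <= q.1, q.1 + wn n <= x0 + w, y0 <= q.2,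
  q.2 + vn n <= y0 + v & A <= 4 ^+ n * normc (rect_int g q.1 (q.1 + wn n) q.2 (q.2 + vn n))].
(* The rank n is part of the state, so that dependent choice can iterate on a single type of good
   rectangles. *)
have step (s : {s : nat * (R * R) | good s.1 s.2}) : {s' : {s : nat * (R * R) | good s.1 s.2} |
    [/\ (sval s').1 = (sval s).1.+1, (sval s).2.1 <= (sval s').2.1,
        (sval s').2.1 + wn (sval s).1.+1 <= (sval s).2.1 + wn (sval s).1,
        (sval s).2.2 <= (sval s').2.2 &
        (sval s').2.2 + vn (sval s).1.+1 <= (sval s).2.2 + vn (sval s).1]}.
  apply: cid; case: s => -[n [x y]] /= G; have [/= g1 g2 g3 g4 g5] := G.
  have [x' [y' [h1 h2 h3 h4 h5]]] := rect_int_quarter (wn0 n) (vn0 n) (holo_rectS g1 g2 g3 g4 hg).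
  rewrite !half in h2 h4 h5.
  have G' : good n.+1 (x', y').
    split=> /=; [exact: le_trans h1|exact: le_trans g2|exact: le_trans h3|exact: le_trans g4|].
    apply: (le_trans g5).
    rewrite exprSr -mulrA ler_wpM2l//.
  by exists (exist _ (n.+1, (x', y')) G').
have s0 : good 0%N (x0, y0).
  by rewrite /good /wn /vn /= !expr0 !divr1 mul1r !lexx; split.
have [S [S0 SS]] := dependent_choice step (exist _ (0%N, (x0, y0)) s0).
have S1 n : (sval (S n)).1 = n.
  by elim: n => [|n IH]; [rewrite S0|case: (SS n) => -> _ _ _ _; rewrite IH].
have [px Hx] : exists p, forall n, (sval (S n)).2.1 <= p <= (sval (S n)).2.1 + wn n.
  by apply: (@nested_intervals (fun n => (sval (S n)).2.1) wn) => // n; case: (SS n); rewrite !S1.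
have [py Hy] : exists p, forall n, (sval (S n)).2.2 <= p <= (sval (S n)).2.2 + vn n.
  by apply: (@nested_intervals (fun n => (sval (S n)).2.2) vn) => // n; case: (SS n); rewrite !S1.
have GS n : good n (sval (S n)).2 by have := svalP (S n); rewrite S1.
have [d dg] : exists d, cdiff g (px +i* py) d.
  have [/= h1 h2 h3 h4 _] := GS 0%N.
  have /andP[p1 p2] := Hx 0%N; have /andP[p3 p4] := Hy 0%N.
  apply: hg; apply/andP; split.
  - exact: le_trans h1 p1.
  - exact: le_trans p2 h2.
  - exact: le_trans h3 p3.
  - exact: le_trans p4 h4.
suff : A <= 0.
  by move=> A0; apply/eq0_normc/le_anti; rewrite A0 normc_ge0.
apply/ler_addgt0Pr => e e0; rewrite add0r.
pose L := w + v.
have L0 : 0 <= L by rewrite addr_ge0.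
(* The final estimate is 4 t L^2 / 4^n, which must not exceed e / 4^n; the added 1 covers L = 0. *)
pose t := e / (4 * (L ^+ 2 + 1)).
have t0 : 0 < t by rewrite divr_gt0// mulr_gt0// ltr_wpDl// sqr_ge0.
have [r r0 Hr] := dg t t0.
have [n Ln] : exists n : nat, L / 2 ^+ n < r.
  have z1 : `|2^-1 : R| < 1 by rewrite ger0_norm//; lra.
  have /cvgrPdist_lt/(_ r r0)[n _ H] := @cvg_geometric R L _ z1.
  exists n; have := H n (leqnn n); rewrite /geometric/= sub0r normrN exprVn.
  by rewrite ger0_norm// divr_ge0// ltW.
have [/= g1 g2 g3 g4 g5] := GS n; have := Hx n; have := Hy n.
move: (sval (S n)).2 g1 g2 g3 g4 g5 => [x y] /= g1 g2 g3 g4 g5 py_ px_.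
have xw : x <= x + wn n by rewrite lerDl.
have yv : y <= y + vn n by rewrite lerDl.
pose p := px +i* py.
pose c := g p - d * p.
have hg' : holo_rect g x (x + wn n) y (y + vn n) by apply: holo_rectS hg.
have ha : holo_rect (fun z => c + d * z) x (x + wn n) y (y + vn n).
  move=> a b _ _; exists d => eps eps0; exists 1 => // h _.
  have -> : c + d * ((a +i* b) + h) - (c + d * (a +i* b)) - d * h = 0 by ring.
  by rewrite normc0 mulr_ge0 ?normc_ge0// ltW.
have -> : e = 4 ^+ n * (e / 4 ^+ n).
  by rewrite mulrC divfK// gt_eqF// exprn_gt0.
apply: (le_trans g5); rewrite ler_wpM2l ?exprn_ge0//.
rewrite -[X in normc X]subr0 -(rect_int_affine c d xw yv) -rect_intB//.
apply: le_trans (@rect_int_bound _ _ _ _ _ _ (t * (wn n + vn n)) _ _ _ _) _ => //.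
- move=> a b ha' hb'; have [d1 D1] := hg' _ _ ha' hb'; have [d2 D2] := ha _ _ ha' hb'.
  by exists (d1 - d2); exact: cdiffB.
- move=> a b ax by_.
  set h := (a +i* b) - p.
  have hn : normc h <= wn n + vn n.
    apply: (le_trans (normc_le_ReIm _)) => /=.
    by apply: lerD; [exact: ler_dist_interval ax px_|exact: ler_dist_interval by_ py_].
  have := Hr h; rewrite -/p.
  have -> : p + h = a +i* b by rewrite /h addrC subrK.
  have -> : g (a +i* b) - g p - d * h = g (a +i* b) - (c + d * (a +i* b)) by rewrite /c /h; ring.
  move=> H; apply: (le_trans (H _)); last by rewrite ler_wpM2l// ltW.
  by apply: (le_lt_trans hn); rewrite /wn /vn -mulrDl.
have -> : x + wn n - x + (y + vn n - y) = wn n + vn n by ring.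
have -> : wn n + vn n = L / 2 ^+ n by rewrite /wn /vn -mulrDl.
rewrite (_ : 4 ^+ n = 2 ^+ n * 2 ^+ n :> R); last by rewrite -exprMn; congr (_ ^+ _); lra.
rewrite invfM; set u := (2 ^+ n)^-1.
have -> : 4 * (t * (L * u)) * (L * u) = (4 * t * L ^+ 2) * (u * u) by ring.
rewrite ler_wpM2r ?mulr_ge0 ?invr_ge0 ?(ltW (e4 n))//.
rewrite -[leRHS](@divfK _ (4 * (L ^+ 2 + 1))); last first.
  by rewrite mulf_neq0// gt_eqF// ltr_wpDl// sqr_ge0.
by rewrite -/t; move: (sqr_ge0 L) (ltW t0); nra.
Qed.

End GoursatTheorem.

Section RealMeanValue.
Variable R : realType.
Implicit Types (f df : R -> R).

Lemma small_is_derive f (x d : R) :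
  (forall e : R, 0 < e -> exists2 r : R, 0 < r &
    forall h, `|h| < r -> `|f (x + h) - f x - d * h| <= e * `|h|) ->
  is_derive x 1 f d.
Proof.
move=> H.
have K : (fun h => h^-1 *: (f (h *: 1 + x) - f x)) @ 0^' --> d.
  apply/cvgrPdist_le => e e0; have [r r0 Hr] := H e e0.
  rewrite near_withinE; apply/nbhs_ballP; exists r => // h.
  rewrite /ball/= sub0r normrN => /Hr{}Hr h0; rewrite /GRing.scale/= mulr1 (addrC _ x).
  have -> : d - h^-1 * (f (x + h) - f x) = - (h^-1 * (f (x + h) - f x - d * h)).
    by rewrite [in RHS]mulrBr mulrCA mulVf// mulr1 opprB.
  by rewrite normrN normrM normfV mulrC ler_pdivrMr ?normr_gt0.
by apply: DeriveDef; [apply/cvg_ex; exists d|apply: cvg_lim].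
Qed.

Lemma mvt_bound f df (B : R) :
  (forall t : R, 0 <= t <= 1 -> is_derive t 1 f (df t)) ->
  (forall t : R, 0 <= t <= 1 -> `|df t| <= B) -> `|f 1 - f 0| <= B.
Proof.
move=> fd dB.
have [| |c + ->] := @MVT_segment R f df 0 1 ler01.
- by move=> x; rewrite in_itv/= => /andP[/ltW x0 /ltW x1]; apply: fd; rewrite x0.
- apply: continuous_in_subspaceT => x /set_mem/=; rewrite in_itv/= => /fd[dx _].
  by apply: differentiable_continuous; apply/derivable1_diffP.
- by rewrite in_itv/= subr0 mulr1 => /dB.
Qed.

End RealMeanValue.

(** * Cauchy's estimate from means over circles *)

Section CauchyEstimates.
Variable R : realType.
Local Notation C := R[i].
Implicit Types (f df : C -> C).

(** The mean value inequality for f minus the linear map of slope c, along the segment from a to a +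
    h; real and imaginary parts are treated apart, whence the factor 2. *)
Lemma cdiff_segment_bound f (df : R -> C) (a h c : C) (B : R) :
  (forall t, 0 <= t <= 1 -> cdiff f (a + h * t%:C) (df t)) ->
  (forall t, 0 <= t <= 1 -> normc (df t - c) <= B) ->
  normc (f (a + h) - f a - c * h) <= 2 * (B * normc h).
Proof.
move=> fd dB.
pose g (t : R) := f (a + h * t%:C) - c * h * t%:C.
have gd (t : R) : 0 <= t <= 1 -> forall e : R, 0 < e -> exists2 r : R, 0 < r &
    forall s : R, `|s| < r -> normc (g (t + s) - g t - (df t - c) * h * s%:C) <= e * `|s|.
  move=> /fd H e e0.
  have N0 : 0 < 1 + normc h by rewrite ltr_pwDl// normc_ge0.
  have [r r0 Hr] := H _ (divr_gt0 e0 N0).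
  exists (r / (1 + normc h)); first by rewrite divr_gt0.
  move=> s; rewrite ltr_pdivlMr// => sr.
  have hs : normc (h * s%:C) <= `|s| * (1 + normc h).
    by rewrite normcM normc_real mulrC ler_wpM2l// lerDr.
  have := Hr _ (le_lt_trans hs sr).
  have -> : f (a + h * t%:C + h * s%:C) - f (a + h * t%:C) - df t * (h * s%:C) =
    g (t + s) - g t - (df t - c) * h * s%:C.
    by rewrite /g rmorphD/= mulrDr -!addrA; ring.
  move=> K; apply: (le_trans K).
  rewrite mulrAC ler_pdivrMr// -mulrA ler_wpM2l// ltW//.
have B' (t : R) : 0 <= t <= 1 -> normc ((df t - c) * h) <= B * normc h.
  by move=> /dB H; rewrite normcM ler_wpM2r ?normc_ge0.
have <- : g 1 - g 0 = f (a + h) - f a - c * h.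
  by rewrite /g !rmorph1 !rmorph0 !mulr0 !mulr1 addr0; ring.
apply: (le_trans (normc_le_ReIm _)).
have -> : 2 * (B * normc h) = B * normc h + B * normc h by ring.
have ReD (x y : C) : complex.Re (x - y) = complex.Re x - complex.Re y by case: x; case: y.
have ImD (x y : C) : complex.Im (x - y) = complex.Im x - complex.Im y by case: x; case: y.
have ReM (x : C) (y : R) : complex.Re (x * y%:C) = complex.Re x * y.
  by case: x => ? ? /=; rewrite mulr0 subr0.
have ImM (x : C) (y : R) : complex.Im (x * y%:C) = complex.Im x * y.
  by case: x => ? ? /=; rewrite mulr0 add0r.
apply: lerD.
  rewrite ReD; apply: (@mvt_bound _ (fun t => complex.Re (g t)) (fun t => complex.Re ((df t - c) * h))) => t t01.
    apply: small_is_derive => e /(gd _ t01)[r r0 Hr]; exists r => // s /Hr.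
    by apply: le_trans; rewrite -ReM -!ReD ler_normc_Re.
  exact: (le_trans (ler_normc_Re _) (B' _ t01)).
rewrite ImD; apply: (@mvt_bound _ (fun t => complex.Im (g t)) (fun t => complex.Im ((df t - c) * h))) => t t01.
  apply: small_is_derive => e /(gd _ t01)[r r0 Hr]; exists r => // s /Hr.
  by apply: le_trans; rewrite -ImM -!ImD ler_normc_Im.
exact: (le_trans (ler_normc_Im _) (B' _ t01)).
Qed.

(* In polar coordinates, the mean of this function over a vertical segment of length 2 pi is, by
   Goursat on rectangles, independent of the radius exp (Re z). *)
Definition polar_quotient f (a : C) (z : C) : C := (f (a + cexp z) - f a) * cexp (- z).

Definition polar_mean f (a : C) (s : R) : C :=
  cint 0 (pi *+ 2) (fun y => polar_quotient f a (s +i* y)).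

Lemma cexpN (z : C) : cexp z * cexp (- z) = 1.
Proof. by rewrite -cexpD subrr cexp0. Qed.

Lemma cdiff_polar_quotient f df (a z : C) :
  cdiff f (a + cexp z) (df (a + cexp z)) -> exists d, cdiff (polar_quotient f a) z d.
Proof.
move=> fd; eexists; apply: cdiffM.
  apply: cdiffB; last exact: cdiff_cst.
  apply: (@cdiff_comp _ f (fun z => a + cexp z) _ _ _ fd).
  have -> : (fun z => a + cexp z) = (fun z : C => cexp z - (- a)).
    by apply/funext => w; rewrite opprK addrC.
  by apply: cdiffB; [exact: cdiff_cexp|exact: cdiff_cst].
exact: (@cdiff_comp _ (@cexp R) -%R _ _ _ (cdiff_cexp _) (cdiffN z)).
Qed.

Variables (f df : C -> C) (a : C) (rho : R).
Hypothesis (fd : forall z, normc (z - a) < rho -> cdiff f z (df z)).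

Let fdexp (s y : R) : expR s < rho -> exists d, cdiff (polar_quotient f a) (s +i* y) d.
Proof.
move=> sr; apply: (@cdiff_polar_quotient _ df); apply: fd.
by rewrite addrAC subrr add0r normc_cexp.
Qed.

(** The rectangle lies between the abscissas s1 and s2 and has height 2 pi. The exponential has
    period 2 i pi, so the horizontal edges cancel and the vertical ones agree. *)
Lemma polar_mean_cst (s1 s2 : R) : s1 <= s2 -> expR s2 < rho ->
  polar_mean f a s1 = polar_mean f a s2.
Proof.
move=> s12 s2r.
have pi2 : 0 <= pi *+ 2 :> R by rewrite mulrn_wge0// pi_ge0.
have hh : holo_rect (polar_quotient f a) s1 s2 0 (pi *+ 2).
  move=> x y /andP[_ x2] _.
  by apply: fdexp; apply: le_lt_trans s2r; rewrite ler_expR.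
have s21 : 0 <= s2 - s1 by rewrite subr_ge0.
have E2 : s1 + (s2 - s1) = s2 by rewrite addrC subrK.
have := @goursat R (polar_quotient f a) s1 0 (s2 - s1) (pi *+ 2) s21 pi2.
rewrite add0r E2 => /(_ hh); rewrite /rect_int.
have -> : cint s1 s2 (fun x => polar_quotient f a (x +i* (pi *+ 2))) =
          cint s1 s2 (fun x => polar_quotient f a (x +i* 0)).
  apply: eq_cint => x _.
  have E : cexp (x +i* (pi *+ 2)) = cexp (x +i* 0).
    by rewrite /cexp/= expi2pi expi0.
  have E' : cexp (- (x +i* (pi *+ 2))) = cexp (- (x +i* 0)).
    have := cexpN (x +i* (pi *+ 2)); rewrite E -(cexpN (x +i* 0)) => /mulfI; apply.
    by apply/eqP => /(congr1 (@normc R)); rewrite normc_cexp normc0 => /eqP; rewrite gt_eqF// expR_gt0.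
  by rewrite /polar_quotient E E'.
rewrite /polar_mean subrr add0r; move: (cint 0 _ _) (cint 0 _ _) => u v.
have i0 : ('i : R[i]) != 0.
  apply: contra_eq_neq (normc_i R) => ->; rewrite normc0 eq_sym; exact: oner_neq0.
by move/eqP; rewrite mulf_eq0 (negbTE i0) => /eqP/subr0_eq/esym.
Qed.

(** The mean is independent of the radius, and as the radius tends to 0 the quotient tends to [df a]
    uniformly in the angle. *)
Lemma polar_meanE (s : R) : expR s < rho -> polar_mean f a s = df a * (pi *+ 2)%:C.
Proof.
move=> sr.
have pi2 : 0 < pi *+ 2 :> R by rewrite mulrn_wgt0// pi_gt0.
have rho0 : 0 < rho by apply: lt_trans sr; rewrite expR_gt0.
have pc s' : expR s' < rho -> ccont_seg 0 (pi *+ 2) (fun y => polar_quotient f a (s' +i* y)).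
  move=> s'r; apply: (@ccont_edge_v _ _ s' s' 0 _ s'); rewrite ?lexx//.
  move=> x y /andP[_ xs] _; apply: fdexp; apply: le_lt_trans s'r; rewrite ler_expR//.
apply/eqP; rewrite -subr_eq0; apply/eqP/eq0_normc/le_anti; rewrite normc_ge0 andbT.
apply/ler_addgt0Pr => e e0; rewrite add0r.
have t0 : 0 < e / (2 * (pi *+ 2)) by rewrite divr_gt0// mulr_gt0.
have [r r0 Hr] : exists2 r : R, 0 < r & forall h, normc h < r ->
    normc (f (a + h) - f a - df a * h) <= e / (2 * (pi *+ 2)) * normc h.
  by have := fd; move=> /(_ a); rewrite subrr normc0 => /(_ rho0 _ t0).
(* A smaller radius exp s' < r, at which the first-order expansion of f at a applies. *)
pose s' := Num.min s (ln (r / 2)).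
have r20 : 0 < r / 2 by rewrite divr_gt0.
have s's : s' <= s by rewrite ge_min lexx.
have s'r : expR s' < r.
  apply: (@le_lt_trans _ _ (r / 2)); last by rewrite ltr_pdivrMr//; lra.
  by rewrite -[leRHS]lnK ?posrE// ler_expR ge_min lexx orbT.
have s'rho : expR s' < rho by apply: le_lt_trans sr; rewrite ler_expR.
rewrite -(polar_mean_cst s's sr) -[pi *+ 2]subr0 -cint_cst ?(ltW pi2)// /polar_mean.
rewrite -cintB; [|exact: pc|exact: ccont_seg_cst].
have -> : e = 2 * (e / (2 * (pi *+ 2))) * (pi *+ 2 - 0).
  rewrite subr0; move: (pi *+ 2) pi2 => p p0; field; lra.
apply: cint_bound; rewrite ?(ltW pi2)//.
  by apply: ccont_segB; [exact: pc|exact: ccont_seg_cst].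
move=> y _; set z := s' +i* y.
have zr : normc (cexp z) = expR s' by rewrite normc_cexp.
have -> : polar_quotient f a z - df a = (f (a + cexp z) - f a - df a * cexp z) * cexp (- z).
  by rewrite mulrBl -[df a * _ * _]mulrA cexpN mulr1.
rewrite normcM.
have /Hr H : normc (cexp z) < r by rewrite zr.
apply: (le_trans (ler_wpM2r (normc_ge0 _) H)).
have cz : normc (cexp z) * normc (cexp (- z)) = 1 by rewrite -normcM cexpN normc1.
by rewrite -[X in X <= _]mulrA cz mulr1.
Qed.

(** On the circle of radius r the quotient is at most 2 M / r; the other factor 2 comes from
    [cint_bound]. *)
Lemma cauchy_estimate (M r : R) : 0 < r -> r < rho ->
  (forall z, normc (z - a) < rho -> normc (f z) <= M) -> normc (df a) <= 4 * M / r.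
Proof.
move=> r0 rr fM.
have pi2 : 0 < pi *+ 2 :> R by rewrite mulrn_wgt0// pi_gt0.
have sr : expR (ln r) < rho by rewrite lnK ?posrE.
have pc : ccont_seg 0 (pi *+ 2) (fun y => polar_quotient f a (ln r +i* y)).
  apply: (@ccont_edge_v _ _ (ln r) (ln r) 0 _ (ln r)); rewrite ?lexx//.
  move=> x y /andP[_ xs] _; apply: fdexp; apply: le_lt_trans sr; rewrite ler_expR//.
have := polar_meanE sr => /(congr1 (@normc R)); rewrite normcM normc_real (gtr0_norm pi2) => E.
rewrite -(ler_pM2r pi2) -E.
have -> : 4 * M / r * (pi *+ 2) = 2 * (2 * M * r^-1) * (pi *+ 2 - 0) by rewrite subr0; lra.
apply: cint_bound; rewrite ?(ltW pi2)// => y _.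
rewrite /polar_quotient normcM normc_cexp /= expRN lnK ?posrE//.
rewrite ler_wpM2r ?invr_ge0 ?(ltW r0)//.
apply: (le_trans (ler_normcB _ _)); rewrite mulr_natl mulr2n lerD// fM//.
  by rewrite addrAC subrr add0r normc_cexp.
by rewrite subrr normc0 (lt_trans r0).
Qed.

End CauchyEstimates.

Section QuadraticEstimate.
Variable R : realType.
Local Notation C := R[i].

(** No second derivative is introduced. Cauchy's estimate bounds [df] by 8 M / r on the disc of
    radius 2r, so f is Lipschitz there with constant 16 M / r. Cauchy's estimate for w -> f (x + w)
    - f (a + w) then gives |df x - df a| <= 128 M / r^2 |x - a|, and the mean value inequality
    doubles the constant once more. *)
Lemma holo_quadratic (f df : C -> C) (a : C) (r M : R) : 0 < r ->
  (forall z, normc (z - a) < 3 * r -> cdiff f z (df z)) ->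
  (forall z, normc (z - a) < 3 * r -> normc (f z) <= M) ->
  forall h, normc h < r ->
  normc (f (a + h) - f a - df a * h) <= 256 * M / r ^+ 2 * normc h ^+ 2.
Proof.
move=> r0 fd fM.
have M0 : 0 <= M by apply: le_trans (normc_ge0 _) (fM a _); rewrite subrr normc0; lra.
have tri (x y z : C) : normc (x - z) <= normc (x - y) + normc (y - z).
  by rewrite -(subrK y x) -addrA addrK ler_normcD.
have r2 : 0 < r / 2 by lra.
have r2r : r / 2 < r by lra.
have B1 z : normc (z - a) < 2 * r -> normc (df z) <= 8 * M / r.
  move=> za; have -> : 8 * M / r = 4 * M / (r / 2) by field; lra.
  have sub w : normc (w - z) < r -> normc (w - a) < 3 * r.
    by have := tri w z a; lra.
  by apply: (@cauchy_estimate _ f df z r) => // w /sub; [exact: fd|exact: fM].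
have L1 x y : normc (x - a) < 2 * r -> normc (y - a) < 2 * r ->
    normc (f x - f y) <= 16 * M / r * normc (x - y).
  move=> xa ya.
  have conv t : 0 <= t <= 1 -> normc (y + (x - y) * t%:C - a) < 2 * r.
    move=> /andP[t0 t1].
    have -> : y + (x - y) * t%:C - a = t%:C * (x - a) + (1 - t)%:C * (y - a).
      by rewrite rmorphB rmorph1/=; ring.
    apply: (le_lt_trans (ler_normcD _ _)); rewrite !normcM !normc_real !ger0_norm ?subr_ge0//.
    move: (normc (x - a)) (normc (y - a)) xa ya => u v ur vr.
    have mr : Num.max u v < 2 * r by rewrite gt_max ur vr.
    apply: le_lt_trans mr.
    have um : u <= Num.max u v by rewrite le_max lexx.
    have vm : v <= Num.max u v by rewrite le_max lexx orbT.
    move: (Num.max u v) um vm => m um vm; nra.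
  have := @cdiff_segment_bound R f (fun t => df (y + (x - y) * t%:C)) y (x - y) 0 (8 * M / r).
  rewrite mul0r subr0 [y + _]addrC subrK => H.
  have -> : 16 * M / r * normc (x - y) = 2 * (8 * M / r * normc (x - y)) by lra.
  apply: H => t /conv t2; rewrite ?subr0; last exact: B1.
  by apply: fd; lra.
have D1 x : normc (x - a) < r -> normc (df x - df a) <= 128 * M / r ^+ 2 * normc (x - a).
  move=> xa; pose g (w : C) := f (x + w) - f (a + w).
  have -> : 128 * M / r ^+ 2 * normc (x - a) = 4 * (16 * M / r * normc (x - a)) / (r / 2).
    by field; lra.
  have -> : df x - df a = (fun w => df (x + w) - df (a + w)) 0 by rewrite !addr0.
  have shift (y : C) w d : cdiff f (y + w) d -> cdiff (fun w => f (y + w)) w d.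
    by move=> H e /H[q q0 Hq]; exists q => // h /Hq; rewrite addrA.
  have xw w : normc (w - 0) < r -> normc (x + w - a) < 2 * r.
    rewrite subr0 addrAC => wr; apply: (le_lt_trans (ler_normcD _ _)); lra.
  have aw w : normc (w - 0) < r -> normc (a + w - a) < 2 * r.
    by rewrite subr0 addrAC subrr add0r; lra.
  apply: (@cauchy_estimate R g (fun w => df (x + w) - df (a + w)) 0 r _ _ (r / 2)) => // w wr.
    by apply: cdiffB; apply: shift; apply: fd; [have := xw w wr|have := aw w wr]; lra.
  apply: le_trans (L1 _ _ (xw _ wr) (aw _ wr)) _.
  by rewrite opprD addrACA subrr addr0.
move=> h hr.
have -> : 256 * M / r ^+ 2 * normc h ^+ 2 = 2 * (128 * M / r ^+ 2 * normc h * normc h) by lra.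
have th t : 0 <= t <= 1 -> normc (a + h * t%:C - a) <= normc h.
  move=> /andP[t0 t1]; rewrite addrAC subrr add0r normcM normc_real ger0_norm//.
  by rewrite ler_piMr// normc_ge0.
apply: (@cdiff_segment_bound R f (fun t => df (a + h * t%:C))) => t /th H.
  by apply: fd; lra.
apply: (le_trans (D1 _ (le_lt_trans H hr))).
by rewrite ler_wpM2l// divr_ge0 ?sqr_ge0// mulr_ge0.
Qed.

End QuadraticEstimate.

(** * Unconditional sums *)

Section ScalarCStarAlgebra.
Variable R : realType.
Local Notation C := (R[i]^o).

Fact scalar_complete (a : nat -> C) :
  (forall e : R, 0 < e -> exists N, forall i j, (N <= i)%N -> (N <= j)%N ->
     normc (a i - a j) < e) ->
  exists l : C, (fun i => normc (a i - l)) @ \oo --> (0 : R).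
Proof.
move=> ca.
have ReD (x y : R[i]) : complex.Re (x - y) = complex.Re x - complex.Re y by case: x; case: y.
have ImD (x y : R[i]) : complex.Im (x - y) = complex.Im x - complex.Im y by case: x; case: y.
have cvgR (u : nat -> R) : (forall i j, `|u i - u j| <= normc (a i - a j)) ->
    exists l : R, u @ \oo --> l.
  move=> ua; suff : cvg (u @ \oo) by move/cvg_ex.
  apply: cauchy_cvg; apply/cauchy_exP => e e0.
  have [N H] := ca e e0; exists (u N), N => // n /= Nn.
  by apply: le_lt_trans (ua _ _) _; exact: H.
have [l1 H1] : exists l : R, (fun i => complex.Re (a i)) @ \oo --> l.
  by apply: cvgR => i j; rewrite -ReD ler_normc_Re.
have [l2 H2] : exists l : R, (fun i => complex.Im (a i)) @ \oo --> l.
  by apply: cvgR => i j; rewrite -ImD ler_normc_Im.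
exists (l1 +i* l2); apply/cvgrPdist_le => e e0.
have e2 : 0 < e / 2 by rewrite divr_gt0.
near=> n; rewrite sub0r normrN ger0_norm ?normc_ge0//.
apply: (le_trans (normc_le_ReIm _)); rewrite ReD ImD /= (splitr e).
apply: lerD; rewrite distrC; near: n.
  by move/cvgrPdist_le : H1; apply.
by move/cvgrPdist_le : H2; apply.
Unshelve. all: by end_near. Qed.

Fact normc_conj_id (a : C) : normc (a^*%C * a) = normc a ^+ 2.
Proof.
rewrite normcM expr2; congr (_ * _).
by case: a => x y; rewrite /normc/= sqrrN.
Qed.

Fact normc_submul (a b : C) : normc (a * b) <= normc a * normc b.
Proof. by rewrite normcM. Qed.

(* Makes has_sum applicable to series of Fourier coefficients. *)
HB.instance Definition _ := isCStarAlgebra.Build R C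
  (fun a => @eq0_normc R a) (@ler_normcD R)
  (fun c a => normcM c a) normc_submul scalar_complete
  (fun a b => rmorphD conjc a b) (fun c a => rmorphM conjc c a)
  (fun a b => etrans (rmorphM conjc a b) (mulrC _ _)) (@conjcK R) normc_conj_id.

End ScalarCStarAlgebra.

Section FsetSums.
Local Open Scope fset_scope.
Local Open Scope ring_scope.

Section FiniteSums.
Variables (R : realType) (I : choiceType).

Lemma big_fset_subset (V : zmodType) (F G : {fset I}) (f : I -> V) : F `<=` G ->
  \sum_(k <- G) f k = \sum_(k <- F) f k + \sum_(k <- G `\` F) f k.
Proof.
move=> FG; rewrite -big_cat; apply: perm_big; apply: uniq_perm.
- exact: fset_uniq.
- rewrite cat_uniq !fset_uniq andbT /=; apply/hasPn => x.
  by rewrite !inE => /andP[].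
- move=> x; rewrite mem_cat !inE; case: (boolP (x \in F)) => [xF|//=].
  exact: (fsubsetP FG).
Qed.

Lemma ler_sum_uniq (s t : seq I) (f : I -> R) : uniq s -> uniq t ->
  {subset s <= t} -> (forall k, 0 <= f k) -> \sum_(k <- s) f k <= \sum_(k <- t) f k.
Proof.
move=> us ut st f0.
have pe : perm_eq t (s ++ [seq k <- t | k \notin s]).
  apply: uniq_perm => //.
    rewrite cat_uniq us filter_uniq// andbT /=; apply/hasPn => x.
    by rewrite mem_filter => /andP[].
  move=> x; rewrite mem_cat mem_filter; case: (boolP (x \in s)) => [xs|//=].
  exact: st.
by rewrite (perm_big _ pe) big_cat/= lerDl sumr_ge0.
Qed.

End FiniteSums.

(** A finite set of pairs is contained in the product of its two projections, over which the sum
    factors. *)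
Lemma ler_sum_prod (R : realType) (I J : choiceType) (u : I -> R) (v : J -> R) (U V : R) :
  (forall i, 0 <= u i) -> (forall j, 0 <= v j) ->
  (forall F : {fset I}, \sum_(i <- F) u i <= U) ->
  (forall F : {fset J}, \sum_(j <- F) v j <= V) ->
  forall F : {fset I * J}, \sum_(p <- F) u p.1 * v p.2 <= U * V.
Proof.
move=> u0 v0 hU hV F.
pose F1 := [fset p.1 | p in F]; pose F2 := [fset p.2 | p in F].
apply: (@le_trans _ _ (\sum_(p <- [seq (i, j) | i <- F1, j <- F2]) u p.1 * v p.2)).
  apply: ler_sum_uniq => //.
  - by apply: allpairs_uniq => // -[a b] [c d].
  - move=> -[i j] ijF; apply/allpairsP; exists (i, j); split => //=.
      by apply/imfsetP; exists (i, j).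
    by apply/imfsetP; exists (i, j).
  - by move=> p; rewrite mulr_ge0.
rewrite big_allpairs_dep /=.
under eq_bigr do rewrite -mulr_sumr.
rewrite -mulr_suml ler_pM// ?sumr_ge0//.
Qed.

Section HasSumTheory.
Variables (R : realType) (A : cstarAlgType R) (I : choiceType).
Implicit Types (f g : I -> A) (a b : A) (F : {fset I}).

Lemma cnormN a : cnorm (- a) = cnorm a.
Proof. by rewrite -scaleN1r cnormZ normc_opp normc1 mul1r. Qed.

Lemma cnorm_sub a b : cnorm (a - b) = cnorm (b - a).
Proof. by rewrite -cnormN opprB. Qed.

Lemma ler_cnormB a b : cnorm (a - b) <= cnorm a + cnorm b.
Proof. by rewrite -(cnormN b) ler_cnormD. Qed.

Lemma ler_cnorm_dist (a b c : A) : cnorm (a - c) <= cnorm (a - b) + cnorm (b - c).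
Proof. by rewrite -(subrK b a) -[X in cnorm X]addrA addrK ler_cnormD. Qed.

Lemma ler_cnorm_sum (J : Type) (s : seq J) (P : pred J) (h : J -> A) :
  cnorm (\sum_(i <- s | P i) h i) <= \sum_(i <- s | P i) cnorm (h i).
Proof.
elim/big_rec2 : _ => [|i x y _ xy]; first by rewrite cnorm0.
by apply: (le_trans (ler_cnormD _ _)); rewrite lerD2l.
Qed.

Lemma has_sumP f a : has_sum f a <-> forall e : R, 0 < e -> exists F0 : {fset I},
  forall F, F0 `<=` F -> cnorm (\sum_(k <- F) f k - a) <= e.
Proof.
split=> [/(_ tt)/cvgrPdist_le H e e0|H _].
  have [F0 _ HF] := H e e0; exists F0 => F F0F.
  by have := HF F F0F; rewrite sub0r normrN ger0_norm ?cnorm_ge0.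
apply/cvgrPdist_le => e /H[F0 HF]; exists F0 => // F /= /HF.
by rewrite sub0r normrN ger0_norm ?cnorm_ge0.
Qed.

Lemma cnorm_le0P a : (forall e : R, 0 < e -> cnorm a <= e) -> a = 0.
Proof.
move=> H; apply: cnorm_eq0; apply/le_anti; rewrite cnorm_ge0 andbT.
by apply/ler_addgt0Pr => e /H; rewrite add0r.
Qed.

Lemma has_sum_unique f a b : has_sum f a -> has_sum f b -> a = b.
Proof.
move=> /has_sumP fa /has_sumP fb; apply/eqP; rewrite -subr_eq0; apply/eqP.
apply: cnorm_le0P => e e0.
have e2 : 0 < e / 2 by rewrite divr_gt0.
have [F1 H1] := fa _ e2; have [F2 H2] := fb _ e2.
apply: (le_trans (ler_cnorm_dist _ (\sum_(k <- F1 `|` F2) f k) _)).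
by rewrite (splitr e) lerD// ?H2 ?fsubsetUr// cnorm_sub H1 ?fsubsetUl.
Qed.

Lemma has_sumD f g a b : has_sum f a -> has_sum g b -> has_sum (fun k => f k + g k) (a + b).
Proof.
move=> fa gb; have := has_sumZD 1 fa gb; rewrite scale1r.
by under eq_fun do rewrite scale1r.
Qed.

Lemma has_sumZ (c : R[i]) f a : has_sum f a -> has_sum (fun k => c *: f k) (c *: a).
Proof.
move=> fa; have := has_sumZD c fa (@has_sum0 _ A I); rewrite addr0.
by under eq_fun do rewrite addr0.
Qed.

Lemma has_sum_le f a (B : R) : (forall F, \sum_(k <- F) cnorm (f k) <= B) ->
  has_sum f a -> cnorm a <= B.
Proof.
move=> fB /has_sumP fa; apply/ler_addgt0Pr => e /fa[F HF].
rewrite -[a](subKr (\sum_(k <- F) f k)).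
apply: (le_trans (ler_cnormB _ _)); apply: lerD; last exact: HF.
exact: le_trans (ler_cnorm_sum _ _ _) (fB F).
Qed.

(** Completeness is about sequences, whereas sums are limits of nets. The sets [Fn n], whose norm
    sums come within 1/(n+1) of the supremum, replace the net: any finite set disjoint from [Fn n]
    has norm sum at most 1/(n+1). *)
Lemma abs_has_sum f (B : R) : (forall F, \sum_(k <- F) cnorm (f k) <= B) ->
  exists a, has_sum f a.
Proof.
move=> fB.
pose N F := \sum_(k <- F) cnorm (f k).
have hs : has_sup (range N).
  by split; [exists (N fset0), fset0|exists B => _ [F _ <-]; exact: fB].
have ex n : exists F, sup (range N) - n.+1%:R^-1 < N F.
  have n0 : 0 < n.+1%:R^-1 :> R by rewrite invr_gt0 ltr0n.
  have [_ [F _ <-] H] := sup_adherent n0 hs.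
  by exists F.
have [Fn HFn] := choice ex.
have tail n H : [disjoint Fn n & H] -> N H <= n.+1%:R^-1.
  move=> dis; have : N (Fn n `|` H) <= sup (range N).
    by apply: ub_le_sup; [exact: hs.2|exists (Fn n `|` H)].
  rewrite {1}/N (@big_fset_subset _ _ (Fn n)) ?fsubsetUl// -/(N _).
  have -> : (Fn n `|` H) `\` Fn n = H.
    apply/fsetP => x; rewrite !inE; case: (boolP (x \in Fn n)) => //= xF.
    by apply/esym/negbTE; apply: contraL dis => xH; apply/fdisjointP => /(_ x xF); rewrite xH.
  rewrite -/(N H) => K; have K' := HFn n.
  move: (sup _) (N H) (N (Fn n)) (_^-1) K K' => a b c d; lra.
have tailD n F : Fn n `<=` F -> cnorm (\sum_(k <- F) f k - \sum_(k <- Fn n) f k) <= n.+1%:R^-1.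
  move=> FF; rewrite (big_fset_subset _ FF) addrAC subrr add0r.
  apply: (le_trans (ler_cnorm_sum _ _ _)); apply: tail.
  by apply/fdisjointP => x xF; rewrite !inE xF.
have invS (e : R) : 0 < e -> exists n : nat, n.+1%:R^-1 < e.
  move=> e0; have [n _ /(_ n (leqnn n))] := near_infty_natSinv_lt (PosNum e0).
  by exists n.
pose x n := \sum_(k <- Fn n) f k.
have dist n m F : Fn n `<=` F -> Fn m `<=` F -> cnorm (x n - x m) <= n.+1%:R^-1 + m.+1%:R^-1.
  move=> nF mF; apply: (le_trans (ler_cnorm_dist _ (\sum_(k <- F) f k) _)).
  by rewrite lerD ?tailD// cnorm_sub tailD.
have [l Hl] : exists l, (fun n => cnorm (x n - l)) @ \oo --> (0 : R).
  apply: cnorm_complete => e e0.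
  have e20 : 0 < e / 2 by rewrite divr_gt0.
  have [n Hn] := invS _ e20; exists n => i j ni nj.
  apply: (le_lt_trans (@dist i j (Fn i `|` Fn j) (fsubsetUl _ _) (fsubsetUr _ _))).
  rewrite (splitr e) ltrD//; apply: le_lt_trans Hn; rewrite lef_pV2 ?posrE ?ltr0n// ler_nat//.
exists l; apply/has_sumP => e e0.
have e30 : 0 < e / 3 by rewrite divr_gt0.
have [n Hn] := invS _ e30.
have /cvgrPdist_le/(_ _ e30)[m _ Hm] := Hl.
pose p := maxn n m.
have pe : p.+1%:R^-1 <= e / 3.
  by apply: le_trans (ltW Hn); rewrite lef_pV2 ?posrE ?ltr0n// ler_nat ltnS leq_maxl.
exists (Fn p) => F pF.
apply: (le_trans (ler_cnorm_dist _ (x p) _)).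
have := Hm p (leq_maxr _ _); rewrite sub0r normrN ger0_norm ?cnorm_ge0// => H1.
apply: (le_trans (lerD (tailD _ _ pF) H1)); move: (_^-1) pe => d; lra.
Qed.

End HasSumTheory.

(** Additivity with a bound is a form that suits both multiplication by a monomial and the maps c ->
    c y from the scalars into the algebra. *)
Lemma has_sum_additive (R : realType) (A B : cstarAlgType R) (I : choiceType)
  (phi : A -> B) (c : R) (f : I -> A) a :
  {morph phi : x y / x - y} -> (forall x, cnorm (phi x) <= c * cnorm x) ->
  has_sum f a -> has_sum (phi \o f) (phi a).
Proof.
move=> phiB phic /has_sumP fa; apply/has_sumP => e e0.
have phi0 : phi 0 = 0 by rewrite -(subrr 0) phiB subrr.
have phiD x y : phi (x + y) = phi x + phi y.
  by rewrite -[y in LHS]opprK phiB -(sub0r y) phiB phi0 sub0r opprK.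
have c0 : 0 < `|c| + 1 by rewrite ltr_wpDl.
have [F0 HF] := fa _ (divr_gt0 e0 c0); exists F0 => F /HF H.
have -> : \sum_(k <- F) (phi \o f) k - phi a = phi (\sum_(k <- F) f k - a).
  by rewrite phiB (big_morph phi phiD phi0).
apply: (le_trans (phic _)); move: H; rewrite ler_pdivlMr// mulrC; apply: le_trans.
by rewrite ler_wpM2r ?cnorm_ge0// (le_trans (ler_norm c))// lerDl.
Qed.

Section HasSumReindex.
Variables (R : realType) (A : cstarAlgType R) (I J : choiceType).

Lemma has_sum_bij (f : I -> A) a (h : J -> I) (h' : I -> J) :
  cancel h h' -> cancel h' h -> has_sum f a -> has_sum (f \o h) a.
Proof.
move=> hK h'K /has_sumP fa; apply/has_sumP => e /fa[F0 HF].
exists [fset h' i | i in F0] => F F0F.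
have -> : \sum_(k <- F) (f \o h) k = \sum_(i <- [fset h k | k in F]) f i.
  by rewrite big_imfset//= => x y _ _ /(can_inj hK).
apply: HF; apply/fsubsetP => i iF; apply/imfsetP; exists (h' i); rewrite ?h'K//.
by apply: (fsubsetP F0F); apply/imfsetP; exists i.
Qed.

(** The sum over a rectangle G x K is compared with S, as the rectangle contains F0, and row by row
    with the y i, as K is chosen after G and large enough for each of its rows. *)
Lemma has_sum_fubini (f : I * J -> A) (y : I -> A) S :
  has_sum f S -> (forall i, has_sum (fun j => f (i, j)) (y i)) -> has_sum y S.
Proof.
move=> /has_sumP fS fy; apply/has_sumP => e e0.
have e20 : 0 < e / 2 by rewrite divr_gt0.
have [F0 HF0] := fS _ e20.
exists [fset p.1 | p in F0] => G F0G.
(* The error allowed in each row of G; the successor avoids dividing by 0. *)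
pose t := e / 2 / (size G).+1%:R.
have t0 : 0 < t by rewrite divr_gt0.
have /choice[H HH] i : exists F, forall F', F `<=` F' -> cnorm (\sum_(j <- F') f (i, j) - y i) <= t.
  by have /has_sumP/(_ _ t0) := fy i.
pose K := [fset p.2 | p in F0] `|` \bigcup_(i <- G) H i.
have HK i : i \in G -> H i `<=` K.
  by move=> iG; apply: fsubset_trans (fsubsetUr _ _); exact: bigfcup_sup.
pose E := \sum_(i <- G) \sum_(j <- K) f (i, j).
pose P := [seq (i, j) | i <- enum_fset G, j <- enum_fset K].
have uP : uniq P by apply: allpairs_uniq => // -[a b] [c d].
have EE : E = \sum_(p <- seq_fset tt P) f p.
  rewrite (perm_big _ (seq_fset_perm tt P)) undup_id//.
  by rewrite /P big_allpairs_dep.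
apply: (le_trans (ler_cnorm_dist _ E _)); rewrite (splitr e); apply: lerD.
  rewrite /E -sumrB; apply: (le_trans (ler_cnorm_sum _ _ _)).
  apply: (@le_trans _ _ (\sum_(i <- G) t)).
    rewrite big_seq [leRHS]big_seq; apply: ler_sum => i iG.
    by rewrite cnorm_sub; apply: HH; exact: HK.
  have -> : \sum_(i <- G) t = t * (size G)%:R.
    by rewrite big_const_seq count_predT iter_addr_0 mulr_natr.
  rewrite /t; set q := size G; rewrite -[leLHS]mulrA -[leRHS]mulr1.
  rewrite ler_wpM2l ?(ltW e20)// mulrC ler_pdivrMr ?ltr0n//.
  by rewrite mul1r ler_nat.
rewrite EE; apply: HF0; apply/fsubsetP => -[i j] ijF; rewrite seq_fsetE.
apply/allpairsP; exists (i, j); split => //=.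
  by apply: (fsubsetP F0G); apply/imfsetP; exists (i, j).
by rewrite inE; apply/orP; left; apply/imfsetP; exists (i, j).
Qed.

End HasSumReindex.

End FsetSums.

(** * Fourier coefficients *)

Section CStarBasics.
Variables (R : realType) (A : cstarAlgType R).
Implicit Types (a b u v : A) (c : R[i]).

Lemma star1 : star (1 : A) = 1.
Proof. by have := starM (star 1) (1 : A); rewrite mulr1 starK mulr1. Qed.

Lemma cnorm1 : cnorm (1 : A) = 1.
Proof.
have := cstar_identity (1 : A); rewrite star1 mulr1 => /eqP.
rewrite expr2 -[X in X == _]mulr1 => /eqP /mulfI -> //.
by apply/eqP => /cnorm_eq0/eqP; rewrite oner_eq0.
Qed.

Lemma cnorm_unitary u : unitary u -> cnorm u = 1.
Proof.
move=> [u1 _]; have := cstar_identity u; rewrite u1 cnorm1 => /esym/eqP.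
by rewrite sqrp_eq1 ?cnorm_ge0// => /eqP.
Qed.

Lemma unitary1 : unitary (1 : A).
Proof. by rewrite /unitary star1 mulr1. Qed.

Lemma unitary_star u : unitary u -> unitary (star u).
Proof. by move=> [u1 u2]; rewrite /unitary starK. Qed.

Lemma unitaryM u v : unitary u -> unitary v -> unitary (u * v).
Proof.
move=> [u1 u2] [v1 v2]; split; rewrite starM.
  by rewrite mulrA -(mulrA (star v)) u1 mulr1.
by rewrite mulrA -(mulrA u) v2 mulr1.
Qed.

Lemma unitaryX u p : unitary u -> unitary (u ^+ p).
Proof.
move=> uu; elim: p => [|p IH]; first by rewrite expr0; exact: unitary1.
by rewrite exprS; apply: unitaryM.
Qed.

Lemma unitaryZ c u : normc c = 1 -> unitary u -> unitary (c *: u).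
Proof.
move=> c1 [u1 u2]; have cc : c^*%C * c = 1.
  have : `|c| = 1 by rewrite normc_def; move: c1; case: c => x y; rewrite /normc => ->.
  by move=> /(congr1 (fun x => x ^+ 2)); rewrite sqr_normc expr1n mulrC.
by split; rewrite starZ -scalerAr -scalerAl scalerA ?(mulrC c) ?(u1, u2) ?cc scale1r.
Qed.

Lemma unitary_upow u m : unitary u -> unitary (upow u m).
Proof. by case: m => p uu; apply: unitaryX => //; exact: unitary_star. Qed.

Lemma upowS u m : unitary u -> upow u (m + 1) = upow u m * u.
Proof.
move=> [u1 u2]; case: m => p; first by rewrite -PoszD addn1 /= exprSr.
have -> : Negz p + 1 = - Posz p by rewrite NegzE -addn1 PoszD opprD subrK.
case: p => [|p]; first by rewrite oppr0 /= expr0 expr1 u1.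
by rewrite -NegzE /= [in RHS]exprSr -[RHS]mulrA u1 mulr1.
Qed.

Lemma upowP u m : unitary u -> upow u (m - 1) = upow u m * star u.
Proof.
move=> uu; have := upowS (m - 1) uu; rewrite subrK => ->.
by case: uu => _ u2; rewrite -mulrA u2 mulr1.
Qed.

Lemma upowD u m l : unitary u -> upow u (m + l) = upow u m * upow u l.
Proof.
move=> uu; elim/int_rec: l => [|p IH|p IH].
- by rewrite addr0 /= expr0 mulr1.
- by rewrite -addn1 PoszD addrA !upowS// IH mulrA.
- by rewrite -addn1 PoszD opprD addrA !upowP// IH mulrA.
Qed.

Lemma upow_expi u (s : R) m : upow (expi s *: u) m = expi (s * m%:~R) *: upow u m.
Proof.
have ex p : (expi s) ^+ p = expi (s * p%:R).
  elim: p => [|p IH]; first by rewrite mulr0 expi0.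
  by rewrite exprS IH -expiD -[in RHS]natr1 mulrDr mulr1 addrC.
have exN p : ((expi s)^*%C) ^+ p = expi (- (s * p%:R)).
  rewrite -rmorphXn/= ex /expi cosN sinN //.
case: m => p; rewrite /upow /= ?starZ exprZn ?ex ?exN//.
by rewrite NegzE mulrNz mulrN.
Qed.

End CStarBasics.

(** * Contractivity of star-homomorphisms *)

Section Contractive.
Variables (R : realType) (A B : cstarAlgType R).

(** The powers of h are self-adjoint, so the C*-identity doubles the exponent at each step. *)
Lemma cnorm_pow2 (C : cstarAlgType R) (h : C) m : star h = h ->
  cnorm (h ^+ (2 ^ m)) = cnorm h ^+ (2 ^ m).
Proof.
move=> hh; elim: m => [|m IH]; first by rewrite expn0 !expr1.
have sh p : star (h ^+ p) = h ^+ p.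
  elim: p => [|p IHp]; first by rewrite expr0 star1.
  by rewrite {1}exprS starM IHp hh -exprSr.
by rewrite expnSr muln2 -addnn !exprD -{1}(sh (2 ^ m)%N) cstar_identity IH expr2.
Qed.

(** If y = x (1 + t) with t > 0, Bernoulli's inequality makes (1 + t)^(2^m) exceed any constant
    c. *)
Lemma pow2_le_root (x y c : R) : 0 <= x -> 0 <= y ->
  (forall m, y ^+ (2 ^ m) <= c * x ^+ (2 ^ m)) -> y <= x.
Proof.
move=> x0 y0 H; rewrite leNgt; apply/negP => xy.
have [x00|xn0] := eqVneq x 0.
  have := H 0%N; rewrite x00 expn0 !expr1 mulr0 => /(lt_le_trans xy).
  by rewrite x00 ltxx.
have xp : 0 < x by rewrite lt_neqAle eq_sym xn0.
pose t := y / x - 1.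
have t0 : 0 < t by rewrite subr_gt0 ltr_pdivlMr// mul1r.
have yx : y = x * (1 + t) by rewrite /t addrC subrK mulrC divfK.
have bern p : 1 + p%:R * t <= (1 + t) ^+ p.
  elim: p => [|p IH]; first by rewrite mul0r addr0 expr0.
  rewrite exprS -natr1.
  have : 0 <= p%:R :> R by [].
  by move: (p%:R) ((1 + t) ^+ p) IH => q z; nra.
pose M := Num.bound `|c / t|.
have := H M; rewrite yx exprMn mulrC ler_pM2r ?exprn_gt0// => H1.
have := le_trans (bern _) H1; apply/negP; rewrite -ltNge.
have cM : c / t < M%:R by apply: le_lt_trans (ler_norm _) _; exact: archi_boundP (normr_ge0 _).
have M2 : (M%:R : R) <= (2 ^ M)%:R by rewrite ler_nat ltnW// ltn_expl.
rewrite ltr_pdivrMr// in cM.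
have : M%:R * t <= (2 ^ M)%:R * t by rewrite ler_wpM2r// ltW.
by lra.
Qed.

(* The constant of cstar_hom disappears on applying the bound to the powers of order 2 ^ m
   of the self-adjoint element a^* a and letting m tend to infinity. *)
Lemma cstar_hom_contractive (phi : A -> B) : cstar_hom phi ->
  forall a, cnorm (phi a) <= cnorm a.
Proof.
move=> [lphi [phi1 phiM] phis [c phic]] a.
rewrite -(ler_pXn2r (n := 2)) ?nnegrE ?cnorm_ge0// -!cstar_identity -phis -phiM.
set h := star a * a.
have hh : star h = h by rewrite /h starM starK.
have phX p : phi (h ^+ p) = phi h ^+ p.
  by elim: p => [|p IH]; rewrite ?expr0// !exprS phiM IH.
apply: (@pow2_le_root _ _ c) => [||m]; rewrite ?cnorm_ge0//.
rewrite -!cnorm_pow2//; last by rewrite -phis hh.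
by rewrite -phX.
Qed.

End Contractive.

Section PhaseEquivalence.
Variables (R : realType) (A : cstarAlgType R).
Implicit Types (a b u v : A).

(* Equality up to a scalar of modulus 1: the commutation phases of the generators play no role. *)
Definition phase_eq a b := exists c : R[i], normc c = 1 /\ a = c *: b.

Lemma phase_eq_refl a : phase_eq a a.
Proof. by exists 1; rewrite normc1 scale1r. Qed.

Lemma phase_eq_trans b a c : phase_eq a b -> phase_eq b c -> phase_eq a c.
Proof.
by move=> [x [x1 ->]] [y [y1 ->]]; exists (x * y); rewrite normcM x1 y1 mulr1 scalerA.
Qed.

Lemma phase_eq_sym a b : phase_eq a b -> phase_eq b a.
Proof.
move=> [x [x1 ->]]; exists x^-1; rewrite normcV x1 invr1 scalerA mulVf ?scale1r//.
by apply/eqP => x0; move: x1; rewrite x0 normc0 => /esym/eqP; rewrite oner_eq0.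
Qed.

Lemma phase_eqM a b u v : phase_eq a b -> phase_eq u v -> phase_eq (a * u) (b * v).
Proof.
move=> [x [x1 ->]] [y [y1 ->]]; exists (x * y); rewrite normcM x1 y1 mulr1.
by rewrite -scalerAl -scalerAr scalerA.
Qed.

Definition phase_comm a b := phase_eq (a * b) (b * a).

Lemma phase_comm_sym a b : phase_comm a b -> phase_comm b a.
Proof. exact: phase_eq_sym. Qed.

Lemma phase_commM a b c : phase_comm a b -> phase_comm a c -> phase_comm a (b * c).
Proof.
move=> ab ac; rewrite /phase_comm mulrA -(mulrA b c).
apply: phase_eq_trans (phase_eqM ab (phase_eq_refl c)) _; rewrite -!mulrA.
by apply: phase_eqM (phase_eq_refl b) _.
Qed.

Lemma phase_comm1 a : phase_comm a 1.
Proof. by rewrite /phase_comm mulr1 mul1r; exact: phase_eq_refl. Qed.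

Lemma phase_commX a b p : phase_comm a b -> phase_comm a (b ^+ p).
Proof.
move=> ab; elim: p => [|p IH]; first by rewrite expr0; exact: phase_comm1.
by rewrite exprS; apply: phase_commM.
Qed.

Lemma phase_comm_star a b : unitary b -> phase_comm a b -> phase_comm a (star b).
Proof.
move=> [b1 b2] [c [c1 ab]]; apply: phase_eq_sym; exists c; split => //.
have := congr1 (fun x => star b * x * star b) ab.
rewrite -scalerAr -scalerAl !mulrA b1 mul1r.
by rewrite -!mulrA b2 mulr1.
Qed.

Lemma phase_comm_upow a b m : unitary b -> phase_comm a b -> phase_comm a (upow b m).
Proof.
by move=> ub ab; case: m => p; apply: phase_commX => //; exact: phase_comm_star.
Qed.

(** Each y i is moved to the left across the later x j, at the price of a phase. *)
Lemma phase_eq_prod (I : eqType) (s : seq I) (x y : I -> A) :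
  (forall i j, phase_comm (x i) (y j)) ->
  phase_eq ((\prod_(i <- s) x i) * \prod_(i <- s) y i) (\prod_(i <- s) (x i * y i)).
Proof.
move=> xy; elim: s => [|i s IH]; first by rewrite !big_nil mulr1; exact: phase_eq_refl.
rewrite !big_cons.
have pc : phase_comm (\prod_(j <- s) x j) (y i).
  apply: phase_comm_sym; elim: {IH} s => [|j s IHs]; first by rewrite big_nil; exact: phase_comm1.
  by rewrite big_cons; apply: phase_commM => //; apply: phase_comm_sym.
apply: phase_eq_trans (_ : phase_eq _ (x i * (y i * \prod_(j <- s) x j) * \prod_(j <- s) y j)) _.
  rewrite mulrA -[x i * _ * y i]mulrA.
  by apply: phase_eqM (phase_eq_refl _); apply: phase_eqM (phase_eq_refl _) pc.
rewrite -!mulrA; do 2!apply: phase_eqM (phase_eq_refl _) _; exact: IH.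
Qed.

End PhaseEquivalence.

(** * Monomials, gauge automorphisms and bounds on coefficients *)

Section Monomials.
Variables (R : realType) (n : nat) (theta : 'M[R]_n) (T : nctorus theta).
Implicit Types (k l m : 'rV[int]_n).

Lemma gen_unitary j : unitary (nct_gen T j).
Proof. by have [] := nct_genP T. Qed.

Lemma gen_phase_comm i j : phase_comm (nct_gen T i) (nct_gen T j).
Proof.
have [_ H] := nct_genP T; rewrite /phase_comm H.
by exists (expi (2 * pi * theta j i)); rewrite normc_expi.
Qed.

Lemma unitary_gen_pow k : unitary (gen_pow T k).
Proof.
rewrite /gen_pow; elim/big_ind : _ => [|a b ua ub|j _]; first exact: unitary1.
  exact: unitaryM.
by apply: unitary_upow; exact: gen_unitary.
Qed.

Lemma cnorm_gen_pow k : cnorm (gen_pow T k) = 1.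
Proof. by apply: cnorm_unitary; exact: unitary_gen_pow. Qed.

Lemma gen_powD k l : exists c : R[i], normc c = 1 /\
  gen_pow T k * gen_pow T l = c *: gen_pow T (k + l).
Proof.
rewrite -/(phase_eq _ _) {3}/gen_pow.
under [X in phase_eq _ X]eq_bigr do rewrite mxE (upowD _ _ (gen_unitary _)).
apply: phase_eq_prod => i j; apply: phase_comm_upow; first exact: gen_unitary.
by apply/phase_comm_sym/phase_comm_upow; [exact: gen_unitary|exact: gen_phase_comm].
Qed.

(** An explicit exponential in theta, of which only the modulus matters; it is therefore chosen
    rather than computed. *)
Definition cocycle k l : R[i] := sval (cid (gen_powD k l)).

Lemma normc_cocycle k l : normc (cocycle k l) = 1.
Proof. by rewrite /cocycle; case: cid => c []. Qed.

Lemma gen_powM k l : gen_pow T k * gen_pow T l = cocycle k l *: gen_pow T (k + l).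
Proof. by rewrite /cocycle; case: cid => c []. Qed.

Definition gauge_gen (j : 'I_n) (t : R) (i : 'I_n) : T :=
  expi (t * (i == j)%:R) *: nct_gen T i.

(** Both sides of a commutation relation pick up the same phases, and unitarity is insensitive to
    them. *)
Lemma gauge_genP j t : nct_relations theta (gauge_gen j t).
Proof.
split=> [i|a b].
  by apply: unitaryZ (gen_unitary i); rewrite normc_expi.
rewrite /gauge_gen -!scalerAl -!scalerAr; have [_ ->] := nct_genP T.
rewrite !scalerA; congr (_ *: _).
by rewrite -mulrA mulrC [X in X * _]mulrC.
Qed.

(** The universal property applied to the rotated generators gives an endomorphism that has every
    monomial as an eigenvector, so that two distinct exponents can be told apart by their
    eigenvalues for suitable j and t. *)
Lemma gauge_ex j t : exists phi : T -> T, [/\ linear phi, forall a, cnorm (phi a) <= cnorm a &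
  forall k, phi (gen_pow T k) = expi (t * (k ord0 j)%:~R) *: gen_pow T k].
Proof.
have [phi [[hphi phiU] _]] := nct_universal T (gauge_genP j t).
exists phi; split; [by case: hphi|exact: cstar_hom_contractive|move=> k].
have [_ [phi1 phiM] phis _] := hphi.
have phiX a p : phi (a ^+ p) = phi a ^+ p.
  by elim: p => [|p IH]; rewrite ?expr0// !exprS phiM IH.
have phiu (a : T) (m : int) : phi (upow a m) = upow (phi a) m.
  by case: m => p /=; rewrite phiX ?phis.
rewrite /gen_pow (big_morph phi phiM phi1).
under eq_bigr do rewrite phiu phiU /gauge_gen upow_expi.
rewrite scaler_prod; congr (_ *: _).
rewrite (bigD1 j)//= eqxx mulr1 big1 ?mulr1// => i /negbTE ->.
by rewrite mulr0 mul0r expi0.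
Qed.

(* For each other term k, the average of the identity and of a gauge automorphism times a phase
   is contractive, fixes the term m and kills the term k. *)
Lemma coef_le_cnorm_seq (c : 'rV[int]_n -> R[i]) m (s : seq 'rV[int]_n) : m \notin s ->
  normc (c m) <= cnorm (c m *: gen_pow T m + \sum_(k <- s) c k *: gen_pow T k).
Proof.
elim: s c => [|k s IH] c.
  by rewrite big_nil addr0 cnormZ cnorm_gen_pow mulr1.
rewrite inE negb_or => /andP[mk /IH{}IH].
have [j kj] : exists j, m ord0 j != k ord0 j.
  apply/existsP; apply: contraNT mk => /existsPn H; apply/eqP/rowP => j.
  by have := H j; rewrite negbK => /eqP.
pose d : R := (k ord0 j)%:~R - (m ord0 j)%:~R.
have d0 : d != 0 by rewrite subr_eq0 eqr_int eq_sym.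
pose t := pi / d.
have [phi [phil phic phiU]] := gauge_ex j t.
pose e := expi (- (t * (m ord0 j)%:~R)).
pose S (a : T) : T := 2^-1 *: (a + e *: phi a).
have SU l : S (gen_pow T l) = (2^-1 * (1 + e * expi (t * (l ord0 j)%:~R))) *: gen_pow T l.
  by rewrite /S phiU scalerA -[X in X + _]scale1r -scalerDl scalerA.
have phiD a b : phi (a + b) = phi a + phi b by have := phil 1 a b; rewrite !scale1r.
have phi0 : phi 0 = 0.
  by apply: (@addrI _ (phi 0)); rewrite -phiD !addr0.
have phiZ c' a : phi (c' *: a) = c' *: phi a by have := phil c' a 0; rewrite phi0 !addr0.
have SD a b : S (a + b) = S a + S b.
  by rewrite /S phiD -scalerDr [e *: _]scalerDr addrACA.
have SZ c' a : S (c' *: a) = c' *: S a.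
  rewrite /S phiZ [RHS]scalerA mulrC -[RHS]scalerA; congr (_ *: _).
  by rewrite scalerDr !scalerA mulrC.
have S0 : S 0 = 0 by rewrite /S phi0 scaler0 addr0 scaler0.
have Sc a : cnorm (S a) <= cnorm a.
  have n2 : normc (2^-1 : R[i]) = 2^-1.
    have -> : (2^-1 : R[i]) = (2^-1 : R)%:C by rewrite rmorphV ?unitfE//= rmorph_nat.
    by rewrite normc_real ger0_norm ?invr_ge0.
  rewrite /S cnormZ n2 ler_pdivrMl//.
  apply: (le_trans (ler_cnormD _ _)); rewrite cnormZ normc_expi mul1r mulr_natl mulr2n.
  by rewrite lerD2l.
have eE l : e * expi (t * (l ord0 j)%:~R) = expi (t * ((l ord0 j)%:~R - (m ord0 j)%:~R)).
  by rewrite /e -expiD mulrBr addrC.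
have two : 2^-1 * (1 + 1) = 1 :> R[i] by rewrite -[1 + 1]/(2%:R) mulVf// pnatr_eq0.
have Sm : S (gen_pow T m) = gen_pow T m.
  by rewrite SU eE subrr mulr0 expi0 two scale1r.
have Sk : S (gen_pow T k) = 0.
  rewrite SU eE -/d /t divfK// /expi cospi sinpi.
  have -> : 1 + ((-1) +i* 0) = 0 :> R[i].
    by apply/eqP; rewrite eq_complex /= addr0 addrN eqxx.
  by rewrite mulr0 scale0r.
pose c' l := c l * (2^-1 * (1 + e * expi (t * (l ord0 j)%:~R))).
apply: le_trans (Sc _); rewrite big_cons SD SZ Sm SD SZ Sk scaler0 add0r.
rewrite (big_morph S SD S0).
have := IH c'; have -> : c' m = c m.
  by rewrite /c' eE subrr mulr0 expi0 two mulr1.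
move=> /le_trans; apply; rewrite le_eqVlt; apply/orP; left; apply/eqP.
congr (cnorm (_ + _)); apply: eq_bigr => l _.
by rewrite SZ SU scalerA.
Qed.

Lemma coef_le_cnorm (c : 'rV[int]_n -> R[i]) m (a : T) :
  has_sum (fun k => c k *: gen_pow T k) a -> normc (c m) <= cnorm a.
Proof.
move=> /has_sumP ca; apply/ler_addgt0Pr => e /ca[F0 /(_ (m |` F0)%fset)].
rewrite fsubsetUr => /(_ isT) H.
have -> : a = \sum_(k <- (m |` F0)%fset) c k *: gen_pow T k -
              (\sum_(k <- (m |` F0)%fset) c k *: gen_pow T k - a) by rewrite subKr.
have : normc (c m) <= cnorm (\sum_(k <- (m |` F0)%fset) c k *: gen_pow T k).
  rewrite (big_fsetD1 m) ?fset1U1//=; apply: coef_le_cnorm_seq.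
  by rewrite !inE eqxx.
set X := \sum_(k <- _) _ in H * => H1.
rewrite subKr; apply: (le_trans H1).
rewrite -[X in cnorm X <= _](subrK a) addrC.
apply: (le_trans (ler_cnormD _ _)); by rewrite lerD2l.
Qed.

End Monomials.

(** * Weights on the lattice and their summability *)

Section Weights.
Variables (R : realType) (n : nat).
Implicit Types (x y : 'rV[R]_n) (k l : 'rV[int]_n).

Lemma ler_coord_norm x j : `|x ord0 j| <= `|x|.
Proof.
rewrite [leRHS]/Num.norm /= mx_normrE; apply/bigmax_geP; right => /=.
by exists (ord0, j).
Qed.

Lemma ler_norm_coord x (M : R) : 0 <= M -> (forall j, `|x ord0 j| <= M) -> `|x| <= M.
Proof.
move=> M0 xM; rewrite [leLHS]/Num.norm /= mx_normrE; apply/bigmax_leP; split => //= -[i j] _ /=.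
by rewrite ord1.
Qed.

Lemma norm_le_enorm x : `|x| <= enorm x.
Proof.
apply: ler_norm_coord => [|j]; first exact: sqrtr_ge0.
rewrite -sqrtr_sqr ler_sqrt ?sumr_ge0// => [|i _]; last exact: sqr_ge0.
by rewrite (bigD1 j)//= lerDl sumr_ge0// => i _; exact: sqr_ge0.
Qed.

Lemma enorm_le_norm x : enorm x <= n.+1%:R * `|x|.
Proof.
have N0 : 0 <= n.+1%:R * `|x| by rewrite mulr_ge0.
rewrite -(ler_pXn2r (n := 2)) ?nnegrE ?sqrtr_ge0// sqr_sqrtr; last first.
  by apply: sumr_ge0 => i _; exact: sqr_ge0.
apply: (@le_trans _ _ (\sum_(j < n) `|x| ^+ 2)).
  apply: ler_sum => j _; rewrite -[leLHS]real_normK ?num_real// ler_pXn2r ?nnegrE//.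
  exact: ler_coord_norm.
rewrite sumr_const card_ord -[leLHS]mulr_natl exprMn ler_wpM2r ?sqr_ge0//.
by rewrite -natrX ler_nat (leq_trans (leqnSn n))// expnS expn1 leq_pmulr.
Qed.

(* Equivalent to the Japanese bracket of x. *)
Definition jap x : R := 1 + `|x|.

Lemma jap_ge1 x : 1 <= jap x. Proof. by rewrite lerDl. Qed.

Lemma jap_gt0 x : 0 < jap x. Proof. exact: lt_le_trans ltr01 (jap_ge1 x). Qed.

Lemma jap_ge0 x : 0 <= jap x. Proof. exact: ltW (jap_gt0 x). Qed.

Lemma japD x y : jap (x + y) <= jap x * jap y.
Proof.
rewrite /jap; have := ler_normD x y; have := normr_ge0 x; have := normr_ge0 y.
by move: `|x + y| `|x| `|y| => a b c; nra.
Qed.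

Lemma japN x : jap (- x) = jap x. Proof. by rewrite /jap normrN. Qed.

Definition wt k : R := jap (int_vec R k).

Lemma int_vecD k l : int_vec R (k + l) = int_vec R k + int_vec R l.
Proof. by apply/rowP => j; rewrite !mxE intrD. Qed.

Lemma wt_ge1 k : 1 <= wt k. Proof. exact: jap_ge1. Qed.
Lemma wt_gt0 k : 0 < wt k. Proof. exact: jap_gt0. Qed.
Lemma wt_ge0 k : 0 <= wt k. Proof. exact: jap_ge0. Qed.

Lemma wtD k l : wt (k + l) <= wt k * wt l.
Proof. by rewrite /wt int_vecD japD. Qed.

Lemma ler_coord_wt k j : `|(k ord0 j)%:~R| <= wt k :> R.
Proof. by have := ler_coord_norm (int_vec R k) j; rewrite mxE /wt /jap; lra. Qed.

Lemma wtX_ge0 k m : 0 <= wt k ^+ m. Proof. by rewrite exprn_ge0// wt_ge0. Qed.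
Lemma wtX_gt0 k m : 0 < wt k ^+ m. Proof. by rewrite exprn_gt0// wt_gt0. Qed.

Definition int_weight (i : int) : R := ((1 + `|i%:~R|) ^+ 2)^-1.

Lemma int_weight_ge0 i : 0 <= int_weight i.
Proof. by rewrite invr_ge0 exprn_ge0// addr_ge0. Qed.

(** The induction carries the stronger bound 2 - 1/(N+1), which plays the part of a telescoping
    sum. *)
Lemma sum_inv_sqr (N : nat) : \sum_(i < N) ((1 + i%:R) ^+ 2)^-1 <= 2 :> R.
Proof.
suff H : \sum_(i < N.+1) ((1 + i%:R) ^+ 2)^-1 <= 2 - N.+1%:R^-1 :> R.
  apply: (@le_trans _ _ (\sum_(i < N.+1) ((1 + i%:R) ^+ 2)^-1)).
    by rewrite big_ord_recr /= lerDl invr_ge0 exprn_ge0// addr_ge0.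
  by apply: (le_trans H); rewrite lerBlDr lerDl.
elim: N => [|N IH].
  by rewrite big_ord_recr big_ord0 /= add0r addr0 expr1n !invr1; lra.
rewrite big_ord_recr /=; apply: (le_trans (lerD IH (lexx _))).
have N0 : 0 <= N%:R :> R by [].
rewrite -!natr1; move: (N%:R : R) N0 => q q0.
have q1 : 0 < q + 1 by rewrite ltr_wpDl.
have q2 : 0 < q + 1 + 1 by lra.
rewrite -addrA lerD2l.
have -> : - (q + 1)^-1 + ((1 + (q + 1)) ^+ 2)^-1 = - (q + 1 + 1)^-1 - (((q + 1 + 1) ^+ 2) * (q + 1))^-1.
  by field; rewrite !gt_eqF//=; lra.
by rewrite gerBl invr_ge0 mulr_ge0 ?exprn_ge0// ltW.
Qed.

Lemma sum_int_weight (t : seq int) : uniq t -> \sum_(i <- t) int_weight i <= 4.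
Proof.
move=> ut.
pose N := (\max_(i <- t) `|i|%N).+1.
pose box := [seq Posz i | i <- iota 0 N] ++ [seq Negz i | i <- iota 0 N].
apply: (@le_trans _ _ (\sum_(i <- box) int_weight i)).
  apply: ler_sum_uniq => //; last exact: int_weight_ge0.
    rewrite cat_uniq; apply/and3P; split.
    - by rewrite map_inj_uniq ?iota_uniq// => x y [].
    - by apply/hasPn => x /mapP[p _ ->]; apply/mapP => -[q _].
    - by rewrite map_inj_uniq ?iota_uniq// => x y [].
  move=> i it; have iN : (`|i| < N)%N by rewrite ltnS (@leq_bigmax_seq _ t xpredT (fun i => `|i|%N) i).
  rewrite mem_cat; case: i it iN => p it iN; apply/orP; [left|right];
    apply/mapP; exists p => //; rewrite mem_iota /= add0n //.
  by apply: leq_ltn_trans iN.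
rewrite /box big_cat !big_map.
have -> : 4 = 2 + 2 :> R by lra.
have E (F : nat -> R) : \sum_(i <- iota 0 N) F i = \sum_(i < N) F i.
  by rewrite -(big_mkord xpredT) /index_iota subn0.
rewrite !E; apply: lerD; apply: le_trans (sum_inv_sqr N); apply: ler_sum => i _.
  by rewrite /int_weight ger0_norm// ler0z.
rewrite /int_weight NegzE mulrNz normrN ger0_norm ?ler0z//.
rewrite lef_pV2 ?posrE ?exprn_gt0 ?ltr_wpDr ?ltr0n//.
rewrite ler_pXn2r ?nnegrE ?addr_ge0// lerD2l.
by rewrite (_ : (Posz i.+1)%:~R = i.+1%:R :> R)// ler_nat.
Qed.

(** The exponent [2 * n] gives each coordinate an inverse square: wt k ^ (2n) dominates the product
    of the (1 + |k_j|)^2, and each one-dimensional sum is at most 4. *)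
Lemma sum_wt (F : {fset 'rV[int]_n}) : \sum_(k <- F) (wt k ^+ (2 * n))^-1 <= 4 ^+ n.
Proof.
pose g (k : 'rV[int]_n) : R := \prod_(j < n) int_weight (k ord0 j).
have wg k : (wt k ^+ (2 * n))^-1 <= g k.
  rewrite /g /int_weight prodfV.
  have P0 (j : 'I_n) : 0 < (1 + `|(k ord0 j)%:~R|) ^+ 2 :> R.
    by rewrite exprn_gt0// ltr_pwDl.
  rewrite lef_pV2 ?posrE ?wtX_gt0//; last by apply: prodr_gt0.
  rewrite exprM -[X in _ <= _ ^+ X](card_ord n) -prodr_const.
  apply: ler_prod => j _; rewrite (ltW (P0 j))/= ler_pXn2r ?nnegrE ?wt_ge0 ?addr_ge0//.
  by rewrite lerD2l; have := ler_coord_norm (int_vec R k) j; rewrite mxE.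
apply: (@le_trans _ _ (\sum_(k <- F) g k)); first exact: ler_sum.
(* All coordinates that occur in F. Then F lies in the box of functions from ['I_n] to s, over which
   the sum of products is a product of sums. *)
pose s := undup (flatten [seq [seq k ord0 j | j <- enum 'I_n] | k <- enum_fset F]).
pose h (f : {ffun 'I_n -> seq_sub s}) : 'rV[int]_n := \row_j val (f j).
have hinj : injective h.
  move=> f f' /rowP H; apply/ffunP => j; apply: val_inj.
  by have := H j; rewrite !mxE.
have ge0 k : 0 <= g k by apply: prodr_ge0 => j _; exact: int_weight_ge0.
apply: (@le_trans _ _ (\sum_(k <- [seq h f | f <- enum {: {ffun 'I_n -> seq_sub s}}]) g k)).
  apply: ler_sum_uniq => //; first by rewrite map_inj_uniq// enum_uniq.
  move=> k kF.
  have ks j : k ord0 j \in s.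
    rewrite mem_undup; apply/flattenP; exists [seq k ord0 j | j <- enum 'I_n].
      by apply/mapP; exists k.
    by apply/mapP; exists j; rewrite ?mem_enum.
  apply/mapP; exists [ffun j => SeqSub (ks j)]; first by rewrite mem_enum.
  by apply/rowP => j; rewrite mxE ffunE.
rewrite big_map big_enum /=.
have -> : \sum_(f : {ffun 'I_n -> seq_sub s}) g (h f) =
    \sum_(f : {ffun 'I_n -> seq_sub s}) \prod_(j < n) int_weight (val (f j)).
  by apply: eq_bigr => f _; apply: eq_bigr => j _; rewrite mxE.
rewrite -(bigA_distr_bigA (fun (j : 'I_n) (x : seq_sub s) => int_weight (val x))) /=.
rewrite -[X in _ <= _ ^+ X](card_ord n) -prodr_const; apply: ler_prod => j _.
rewrite sumr_ge0/= => [|i _]; last exact: int_weight_ge0.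
rewrite -big_enum /= -(big_map (fun x : seq_sub s => val x) xpredT int_weight).
by apply: sum_int_weight; rewrite map_inj_uniq ?enum_uniq//; exact: val_inj.
Qed.

Lemma rapid_decayP (c : 'rV[int]_n -> R[i]) : rapid_decay c <->
  forall m : nat, exists C : R, forall k, normc (c k) * wt k ^+ m <= C.
Proof.
split=> H m; have [C HC] := H m.
  exists C => k; apply: le_trans (HC k); rewrite ler_wpM2l ?normc_ge0//.
  have K : 1 + enorm (int_vec R k) >= wt k by rewrite lerD2l norm_le_enorm.
  by apply: lerXn2r K; rewrite ?nnegrE ?wt_ge0// addr_ge0// sqrtr_ge0.
exists (n.+1%:R ^+ m * C) => k.
apply: (@le_trans _ _ (normc (c k) * (n.+1%:R * wt k) ^+ m)).
  rewrite ler_wpM2l ?normc_ge0//.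
  apply: lerXn2r; rewrite ?nnegrE ?mulr_ge0 ?wt_ge0 ?addr_ge0 ?sqrtr_ge0//.
  rewrite /wt /jap mulrDr mulr1 lerD ?enorm_le_norm//.
  by rewrite (ler_nat _ 1).
by rewrite exprMn mulrCA ler_wpM2l ?exprn_ge0.
Qed.

End Weights.

(** * Fourier coefficients and the semi-norms they define *)

Section FourierCoefficients.
Variables (R : realType) (n : nat) (theta : 'M[R]_n) (T : nctorus theta).
Implicit Types (k l : 'rV[int]_n) (u v : Cinf T) (c d : 'rV[int]_n -> R[i]).

(** The [2 * n] additional powers of the weight are spent on summability. *)
Lemma rapid_sum_bound c m (C : R) :
  (forall k, normc (c k) * wt R k ^+ (m + 2 * n) <= C) ->
  forall F : {fset 'rV[int]_n}, \sum_(k <- F) normc (c k) * wt R k ^+ m <= C * 4 ^+ n.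
Proof.
move=> HC F.
have C0 : 0 <= C by apply: le_trans (HC 0); rewrite mulr_ge0 ?normc_ge0 ?wtX_ge0.
apply: le_trans (ler_wpM2l C0 (@sum_wt R n F)); rewrite mulr_sumr; apply: ler_sum => k _.
by rewrite ler_pdivlMr ?wtX_gt0// -mulrA -exprD.
Qed.

Lemma rapid_abs_sum c (C : R) : (forall k, normc (c k) * wt R k ^+ (2 * n) <= C) ->
  forall F : {fset 'rV[int]_n}, \sum_(k <- F) cnorm (c k *: gen_pow T k) <= C * 4 ^+ n.
Proof.
move=> HC F; have := @rapid_sum_bound c 0 C HC F; apply: le_trans; apply: ler_sum => k _.
by rewrite cnormZ cnorm_gen_pow expr0.
Qed.

Lemma rapid_has_sum c : rapid_decay c -> exists a : T, has_sum (fun k => c k *: gen_pow T k) a.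
Proof.
move=> /rapid_decayP/(_ (2 * n)%N)[C HC].
apply: (@abs_has_sum _ _ _ _ (C * 4 ^+ n)); exact: rapid_abs_sum.
Qed.

Lemma fourier_seriesP u : fourier_series (fourier u) (cval u).
Proof.
rewrite /fourier; case: xgetP => [c _ //|].
have : cval u \in @is_smooth _ _ _ T := valP u.
by move=> /asboolP[c cP] /(_ c).
Qed.

Lemma fourier_rapid u : rapid_decay (fourier u).
Proof. by have [] := fourier_seriesP u. Qed.

Lemma fourier_sum u : has_sum (fun k => fourier u k *: gen_pow T k) (cval u).
Proof. by have [] := fourier_seriesP u. Qed.

Lemma coef_unique c d (a : T) : has_sum (fun k => c k *: gen_pow T k) a ->
  has_sum (fun k => d k *: gen_pow T k) a -> c = d.
Proof.
move=> ca da; apply/funext => k.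
have H1 : has_sum (fun k => (c k - d k) *: gen_pow T k) (0 : T).
  have := has_sumD ca (has_sumZ (-1) da); rewrite scaleN1r subrr.
  by congr has_sum; apply/funext => l; rewrite scaleN1r scalerBl.
have := coef_le_cnorm k H1; rewrite cnorm0 => H2.
by apply/eqP; rewrite -subr_eq0; apply/eqP/eq0_normc/le_anti; rewrite H2 normc_ge0.
Qed.

Lemma fourier_unique c u : has_sum (fun k => c k *: gen_pow T k) (cval u) -> fourier u = c.
Proof. exact: coef_unique (fourier_sum u). Qed.

Lemma fourier_ex c : rapid_decay c -> exists u : Cinf T, fourier u = c.
Proof.
move=> cr; have [a ca] := rapid_has_sum cr.
have sa : a \in @is_smooth _ _ _ T by apply/asboolP; exists c.
by exists (MkCinf sa); apply: fourier_unique.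
Qed.

Lemma fourier_lin (a : R[i]) u v k : fourier (a *: u + v) k = a * fourier u k + fourier v k.
Proof.
rewrite (@fourier_unique (fun k => a * fourier u k + fourier v k))//.
have := has_sumZD a (fourier_sum u) (fourier_sum v).
by congr has_sum; apply/funext => l; rewrite scalerDl scalerA.
Qed.

Lemma fourierD u v k : fourier (u + v) k = fourier u k + fourier v k.
Proof. by have := fourier_lin 1 u v k; rewrite scale1r mul1r. Qed.

Lemma fourier0 k : fourier (0 : Cinf T) k = 0.
Proof. by have := fourierD 0 0 k; rewrite addr0 => /esym/eqP; rewrite -subr_eq0 addrK => /eqP. Qed.

Lemma fourierZ (a : R[i]) u k : fourier (a *: u) k = a * fourier u k.
Proof. by have := fourier_lin a u 0 k; rewrite addr0 fourier0 addr0. Qed.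

Lemma fourierN u k : fourier (- u) k = - fourier u k.
Proof. by rewrite -scaleN1r fourierZ mulN1r. Qed.

Lemma fourierB u v k : fourier (u - v) k = fourier u k - fourier v k.
Proof. by rewrite fourierD fourierN. Qed.

Lemma fourier_inj u v : fourier u =1 fourier v -> u = v.
Proof.
move=> /funext uv; apply: val_inj; apply: has_sum_unique (fourier_sum u) _.
by rewrite uv; exact: fourier_sum.
Qed.

Lemma normc_fourier_le u k : normc (fourier u k) <= cnorm (cval u).
Proof. exact: coef_le_cnorm (fourier_sum u). Qed.

(** A family of semi-norms equivalent to [Cinf_snorm], in terms of coefficients alone: see
    [Cinf_snorm_le_pn] and [pn_le_Cinf_snorm]. *)
Definition pn (m : nat) u : R := sup (range (fun k => normc (fourier u k) * wt R k ^+ m)).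

Lemma pn_has_sup m u : has_sup (range (fun k => normc (fourier u k) * wt R k ^+ m)).
Proof.
split; first by eexists; exists (0 : 'rV[int]_n).
have /rapid_decayP/(_ m)[C HC] := fourier_rapid u.
by exists C => _ [k _ <-].
Qed.

Lemma fourier_le_pn m u k : normc (fourier u k) * wt R k ^+ m <= pn m u.
Proof. by apply: ub_le_sup; [exact: (pn_has_sup m u).2|exists k]. Qed.

Lemma pn_le m u (B : R) : (forall k, normc (fourier u k) * wt R k ^+ m <= B) -> pn m u <= B.
Proof. by move=> H; apply: ge_sup; [exact: (pn_has_sup m u).1|move=> _ [k _ <-]]. Qed.

Lemma pn_ge0 m u : 0 <= pn m u.
Proof. by apply: le_trans (fourier_le_pn m u 0); rewrite mulr_ge0 ?normc_ge0 ?wtX_ge0. Qed.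

Lemma pnD m u v : pn m (u + v) <= pn m u + pn m v.
Proof.
apply: pn_le => k; rewrite fourierD.
apply: (le_trans (ler_wpM2r (wtX_ge0 _ _ _) (ler_normcD _ _))).
by rewrite mulrDl lerD// fourier_le_pn.
Qed.

Lemma pnZ m (a : R[i]) u : pn m (a *: u) = normc a * pn m u.
Proof.
have le b v : pn m (b *: v) <= normc b * pn m v.
  apply: pn_le => k; rewrite fourierZ normcM -mulrA.
  by rewrite ler_wpM2l ?normc_ge0 ?fourier_le_pn.
apply/le_anti; rewrite le/=.
have [->|a0] := eqVneq a 0; first by rewrite normc0 mul0r pn_ge0.
have := le a^-1 (a *: u); rewrite scalerA mulVf// scale1r normcV.
by rewrite -ler_pdivrMl ?invrK// invr_gt0 lt_neqAle normc_ge0 andbT eq_sym; apply/eqP => /eq0_normc/eqP; rewrite (negbTE a0).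
Qed.

Lemma pn0 m : pn m (0 : Cinf T) = 0.
Proof. by rewrite -(scale0r 0) pnZ normc0 mul0r. Qed.

Lemma pnN m u : pn m (- u) = pn m u.
Proof. by rewrite -scaleN1r pnZ normc_opp normc1 mul1r. Qed.

Lemma pnB m u v : pn m (u - v) <= pn m u + pn m v.
Proof. by rewrite -(pnN m v) pnD. Qed.

Lemma pn_sum (I : Type) (s : seq I) (P : pred I) (F : I -> Cinf T) m :
  pn m (\sum_(i <- s | P i) F i) <= \sum_(i <- s | P i) pn m (F i).
Proof.
elim/big_rec2 : _ => [|i x y _ xy]; first by rewrite pn0.
by apply: (le_trans (pnD _ _ _)); rewrite lerD2l.
Qed.

Lemma pn_eq0 m u : pn m u <= 0 -> u = 0.
Proof.
move=> u0; apply: fourier_inj => k; rewrite fourier0; apply/eq0_normc/le_anti.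
rewrite normc_ge0 andbT -(pmulr_lle0 _ (wtX_gt0 R k m)).
exact: le_trans (fourier_le_pn m u k) u0.
Qed.

Lemma cnorm_le_pn u : cnorm (cval u) <= 4 ^+ n * pn (2 * n) u.
Proof.
rewrite mulrC; apply: has_sum_le (fourier_sum u) => F.
by apply: rapid_abs_sum => k; exact: fourier_le_pn.
Qed.

(** [delta] is a choice with default value 0, so an element with these coefficients must be
    exhibited; rapid decay absorbs the factor k_j. *)
Lemma fourier_delta j u k : fourier (delta j u) k = (k ord0 j)%:~R * fourier u k.
Proof.
pose c l : R[i] := (l ord0 j)%:~R * fourier u l.
rewrite (@fourier_unique c)// /delta; case: xgetP => [v _ //|].
have cr : rapid_decay c.
  apply/rapid_decayP => m; exists (pn m.+1 u) => l; apply: le_trans (fourier_le_pn _ _ l).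
  rewrite /c normcM exprS -[leLHS]mulrA [leLHS]mulrCA ler_wpM2l ?normc_ge0// ler_wpM2r ?wtX_ge0//.
  have -> : ((l ord0 j)%:~R : R[i]) = ((l ord0 j)%:~R : R)%:C by rewrite rmorph_int.
  by rewrite normc_real ler_coord_wt.
have [v vc] := fourier_ex cr.
by move=> /(_ v) []; have := fourier_sum v; rewrite vc.
Qed.

Lemma fourier_miter_delta (a : 'I_n -> nat) u k :
  fourier (miter (@delta _ _ _ T) a u) k = (\prod_(j < n) (k ord0 j)%:~R ^+ a j) * fourier u k.
Proof.
rewrite /miter -big_enum /=; elim: (enum 'I_n) => [|j s IH] /=; first by rewrite big_nil mul1r.
rewrite big_cons -mulrA -IH; elim: (a j) => [|p IHp] /=; first by rewrite expr0 mul1r.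
by rewrite fourier_delta IHp exprS -!mulrA.
Qed.

Lemma normc_mono_le (a : 'I_n -> nat) k :
  normc (\prod_(j < n) ((k ord0 j)%:~R : R[i]) ^+ a j) <= wt R k ^+ mord_size a.
Proof.
rewrite /mord_size; elim/big_rec2 : _ => [|j x y _ xy]; first by rewrite expr0 normc1.
rewrite normcM exprD ler_pM ?normc_ge0//.
elim: (a j) => [|p IHp]; first by rewrite !expr0 normc1.
rewrite !exprS normcM ler_pM ?normc_ge0//.
have -> : ((k ord0 j)%:~R : R[i]) = ((k ord0 j)%:~R : R)%:C by rewrite rmorph_int.
by rewrite normc_real ler_coord_wt.
Qed.

Lemma Cinf_snorm_le_pn (a : 'I_n -> nat) u :
  Cinf_snorm a u <= 4 ^+ n * pn (mord_size a + 2 * n) u.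
Proof.
apply: (le_trans (cnorm_le_pn _)); rewrite ler_wpM2l ?exprn_ge0//.
apply: pn_le => k; rewrite fourier_miter_delta normcM.
apply: le_trans (fourier_le_pn _ _ k).
rewrite exprD -[leLHS]mulrA [leRHS]mulrCA ler_wpM2r ?mulr_ge0 ?normc_ge0 ?wtX_ge0//.
exact: normc_mono_le.
Qed.

Definition single_order (m : nat) (j : 'I_n) (i : 'I_n) : nat := if i == j then m else 0%N.

(** The multi-indices 0 and m e_j suffice: (1 + |k|)^m is at most 2^m if |k| <= 1, and otherwise at
    most 2^m |k_i|^m for a coordinate i of maximal modulus. *)
Lemma pn_le_Cinf_snorm m u :
  pn m u <= 2 ^+ m * (Cinf_snorm (fun=> 0%N) u + \sum_(j < n) Cinf_snorm (single_order m j) u).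
Proof.
apply: pn_le => k.
have B0 : normc (fourier u k) <= Cinf_snorm (fun=> 0%N) u.
  have := normc_fourier_le (miter (@delta _ _ _ T) (fun=> 0%N) u) k.
  by rewrite fourier_miter_delta big1 ?mul1r// => j _; rewrite expr0.
have Bj j : normc (fourier u k) * `|(k ord0 j)%:~R| ^+ m <= Cinf_snorm (single_order m j) u.
  have := normc_fourier_le (miter (@delta _ _ _ T) (single_order m j) u) k.
  rewrite fourier_miter_delta (bigD1 j)//= big1 => [|i /negbTE ij]; last first.
    by rewrite /single_order ij expr0.
  rewrite /single_order eqxx mulr1 normcM mulrC; congr (_ * _ <= _).
  rewrite -(rmorph_int (real_complex R)) -rmorphXn /=.
  by rewrite normc_real normrX.
have SU : \sum_(j < n) normc (fourier u k) * `|(k ord0 j)%:~R| ^+ m <=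
    \sum_(j < n) Cinf_snorm (single_order m j) u by apply: ler_sum.
have S0 : 0 <= \sum_(j < n) normc (fourier u k) * `|(k ord0 j)%:~R : R| ^+ m.
  by apply: sumr_ge0 => j _; rewrite mulr_ge0 ?normc_ge0 ?exprn_ge0.
suff W : normc (fourier u k) * wt R k ^+ m <= 2 ^+ m *
   (normc (fourier u k) + \sum_(j < n) normc (fourier u k) * `|(k ord0 j)%:~R| ^+ m).
  by apply: (le_trans W); rewrite ler_wpM2l ?exprn_ge0// lerD.
rewrite -mulr_sumr -[X in _ * (X + _)]mulr1 -mulrDr mulrCA ler_wpM2l ?normc_ge0//.
have S1 : 0 <= \sum_(j < n) `|(k ord0 j)%:~R : R| ^+ m.
  by apply: sumr_ge0 => j _; rewrite exprn_ge0.
have [k1|k1] := leP `|int_vec R k| 1.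
  apply: (@le_trans _ _ (2 ^+ m)).
    by apply: lerXn2r; rewrite ?nnegrE ?wt_ge0// /wt /jap; lra.
  by rewrite ler_peMr ?exprn_ge0// lerDl.
have [|i Hi] := @mx_norm_neq0 _ _ _ (int_vec R k).
  by rewrite -[mx_norm _]/(`|int_vec R k|) gt_eqF// (lt_trans ltr01).
apply: (@le_trans _ _ (2 ^+ m * `|int_vec R k| ^+ m)).
  rewrite -exprMn; apply: lerXn2r; rewrite ?nnegrE ?wt_ge0 ?mulr_ge0// /wt /jap; lra.
rewrite ler_wpM2l ?exprn_ge0// [X in X ^+ m](_ : _ = `|(k ord0 i.2)%:~R|); last first.
  by rewrite [LHS]Hi mxE ord1.
by rewrite (bigD1 i.2)//= addrCA lerDl addr_ge0// sumr_ge0.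
Qed.

Lemma sn_cvgP (X : Type) (F : set_system X) (FF : Filter F) (f : X -> Cinf T) (w : Cinf T) :
  sn_cvg (@Cinf_snorm _ _ _ T) F f w <->
  forall m (e : R), 0 < e -> \forall x \near F, pn m (f x - w) <= e.
Proof.
split=> H.
  move=> m.
  have K : (fun x => 2 ^+ m * (Cinf_snorm (fun=> 0%N) (f x - w) +
     \sum_(j < n) Cinf_snorm (single_order m j) (f x - w))) @ F --> (2 ^+ m * (0 + \sum_(j < n) 0) : R).
    apply: cvgM; first exact: cvg_cst.
    apply: cvgD; first exact: H.
    by apply: cvg_big => [|j _]; [exact: add_continuous|exact: H].
  rewrite big1// addr0 mulr0 in K.
  move=> e e0; move/cvgrPdist_le/(_ e e0) : K; apply: filterS => x.
  rewrite sub0r normrN; apply: le_trans; apply: le_trans (ler_norm _).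
  exact: pn_le_Cinf_snorm.
move=> a; apply/cvgrPdist_le => e e0.
have N0 : 0 < 4 ^+ n :> R by rewrite exprn_gt0.
have := H (mord_size a + 2 * n)%N _ (divr_gt0 e0 N0); apply: filterS => x.
rewrite sub0r normrN ger0_norm ?cnorm_ge0// ler_pdivlMr// mulrC; apply: le_trans.
exact: Cinf_snorm_le_pn.
Qed.

End FourierCoefficients.

Ltac cinf_ring :=
  apply: fourier_inj => ?; rewrite ?(fourierB, fourierD, fourierZ, fourierN, fourier0); ring.

(** * Twisted sums and composition *)

Section TwistedSum.
Variables (R : realType) (n : nat) (theta : 'M[R]_n) (T : nctorus theta).
Implicit Types (k l p : 'rV[int]_n) (r a b : 'rV[int]_n -> Cinf T) (s x u v : Cinf T).

Definition tempered r := forall m, exists A M, forall k, pn m (r k) <= A * wt R k ^+ M.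

Definition twisted_term r s k : T := fourier s k *: (cval (r k) * gen_pow T k).

Fact tcomp_key : unit. Proof. exact: tt. Qed.

(* sum_k s_k r(k) U^k; locked, as unification would otherwise unfold it. *)
Definition tcomp := locked_with tcomp_key (fun r s =>
  xget 0 [set x : Cinf T | has_sum (twisted_term r s) (cval x)]).

(** What the k-th term contributes to the coefficient of U^p, since U^(p-k) U^k is a phase times
    U^p. The type [R[i]^o] makes [has_sum] available for scalars. *)
Definition tcoef r s p k : R[i]^o := fourier s k * fourier (r k) (p - k) * cocycle T (p - k) k.

Lemma tempered_ge0 r m : tempered r -> exists A M, 0 <= A /\ forall k, pn m (r k) <= A * wt R k ^+ M.
Proof.
move=> /(_ m)[A [M H]]; exists A, M; split=> //.
by have := le_trans (pn_ge0 _ _) (H 0); rewrite pmulr_lge0// wtX_gt0.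
Qed.

(** By wt p <= wt (p - k) wt k, the weight of p is shared by r(k) and s. The exponent on s is m for
    its share, M for the growth of r and [2 * n] for summability. *)
Lemma tcoef_sum r s p m A M : 0 <= A -> (forall k, pn m (r k) <= A * wt R k ^+ M) ->
  forall F : {fset 'rV[int]_n}, \sum_(k <- F) normc (tcoef r s p k) <=
    A * (4 ^+ n * pn (m + M + 2 * n) s) / wt R p ^+ m.
Proof.
move=> A0 rA F.
have := @rapid_sum_bound _ n (fourier s) (m + M) _ (fourier_le_pn _ s) F => H.
rewrite ler_pdivlMr ?wtX_gt0// [4 ^+ n * _]mulrC.
apply: le_trans (ler_wpM2l A0 H); rewrite mulr_suml mulr_sumr; apply: ler_sum => k _.
rewrite /tcoef 2!normcM normc_cocycle mulr1 mulrCA -mulrA.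
rewrite ler_wpM2l ?normc_ge0//.
have W : wt R p ^+ m <= wt R (p - k) ^+ m * wt R k ^+ m.
  by rewrite -exprMn; apply: lerXn2r; rewrite ?nnegrE ?mulr_ge0 ?wt_ge0// -{1}(subrK k p) wtD.
apply: (le_trans (ler_wpM2l (normc_ge0 _) W)).
rewrite mulrA exprD [wt R k ^+ m * _]mulrC mulrA ler_wpM2r ?wtX_ge0//.
exact: le_trans (fourier_le_pn _ _ _) (rA k).
Qed.

(** The double series X over (k, l) of s_k r(k)_l U^l U^k converges absolutely. Summed over l first
    it is the twisted sum; summed first along l + k = p it is the Fourier series with coefficients e
    p. *)
Lemma tcomp_ex r s : tempered r -> exists x,
  has_sum (twisted_term r s) (cval x) /\
  (forall p, has_sum (A := R[i]^o) (tcoef r s p) (fourier x p)).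
Proof.
move=> tr.
have /choice[e He] p : exists a : R[i]^o, has_sum (tcoef r s p) a.
  have [A [M [A0 rA]]] := tempered_ge0 0 tr.
  by apply: abs_has_sum => F; exact: (@tcoef_sum r s p 0 A M A0 rA F).
have er : rapid_decay e.
  apply/rapid_decayP => m; have [A [M [A0 rA]]] := tempered_ge0 m tr.
  exists (A * (4 ^+ n * pn (m + M + 2 * n) s)) => p.
  rewrite -ler_pdivlMr ?wtX_gt0//.
  exact: (has_sum_le (@tcoef_sum r s p m A M A0 rA) (He p)).
have [x xe] := fourier_ex T er.
exists x; split; last by move=> p; rewrite xe.
pose X (q : 'rV[int]_n * 'rV[int]_n) : T :=
  (fourier s q.1 * fourier (r q.1) q.2) *: (gen_pow T q.2 * gen_pow T q.1).
have [S XS] : exists S, has_sum X S.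
  have [A [M [A0 rA]]] := tempered_ge0 (2 * n) tr.
  apply: (@abs_has_sum _ _ _ _ ((pn (M + 2 * n) s * 4 ^+ n) * (A * 4 ^+ n))) => F.
  apply: (@le_trans _ _ (\sum_(q <- F) (normc (fourier s q.1) * wt R q.1 ^+ M) *
     (A * (wt R q.2 ^+ (2 * n))^-1))).
    apply: ler_sum => -[k l] _ /=; rewrite /X /= gen_powM scalerA cnormZ cnorm_gen_pow mulr1.
    rewrite 2!normcM normc_cocycle mulr1 -mulrA ler_wpM2l ?normc_ge0//.
    rewrite mulrA ler_pdivlMr ?wtX_gt0// mulrC [leRHS]mulrC.
    by rewrite mulrC; apply: le_trans (fourier_le_pn _ _ _) (rA k).
  apply: (@ler_sum_prod R _ _ (fun k => normc (fourier s k) * wt R k ^+ M)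
    (fun l => A * (wt R l ^+ (2 * n))^-1)).
  - by move=> k; rewrite mulr_ge0 ?normc_ge0 ?wtX_ge0.
  - by move=> l; rewrite mulr_ge0// invr_ge0 wtX_ge0.
  - by apply: rapid_sum_bound => k; exact: fourier_le_pn.
  - by move=> G; rewrite -mulr_sumr ler_wpM2l// sum_wt.
have xS : S = cval x.
  pose h (q : 'rV[int]_n * 'rV[int]_n) := (q.2, q.1 - q.2).
  pose h' (q : 'rV[int]_n * 'rV[int]_n) := (q.2 + q.1, q.1).
  have hK : cancel h h' by move=> [p k]; rewrite /h /h' /= subrK.
  have h'K : cancel h' h by move=> [p k]; rewrite /h /h' /= addrK.
  apply: has_sum_unique (fourier_sum x).
  apply: has_sum_fubini (has_sum_bij hK h'K XS) _ => p.
  have phiB : {morph (fun c : R[i]^o => c *: gen_pow T p) : y z / y - z}.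
    by move=> y z; rewrite scalerBl.
  have phic (c : R[i]^o) : cnorm (c *: gen_pow T p) <= 1 * cnorm c.
    by rewrite cnormZ cnorm_gen_pow mulr1 mul1r.
  have := has_sum_additive phiB phic (He p); rewrite xe; congr has_sum; apply/funext => k /=.
  by rewrite /X /= gen_powM scalerA subrK.
rewrite -xS; apply: has_sum_fubini XS _ => k.
have phiB : {morph (fun y : T => fourier s k *: (y * gen_pow T k)) : y z / y - z}.
  by move=> y z; rewrite mulrBl scalerBr.
have phic (y : T) : cnorm (fourier s k *: (y * gen_pow T k)) <= normc (fourier s k) * cnorm y.
  rewrite cnormZ ler_wpM2l ?normc_ge0//; apply: le_trans (ler_cnormM _ _) _.
  by rewrite cnorm_gen_pow mulr1.
have := has_sum_additive phiB phic (fourier_sum (r k)); congr has_sum; apply/funext => l /=.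
by rewrite /X /= -scalerAl scalerA.
Qed.

Lemma eq_tcomp a b s : a =1 b -> tcomp a s = tcomp b s.
Proof. by move=> /funext ->. Qed.

Lemma tcomp_unique r s x : has_sum (twisted_term r s) (cval x) -> tcomp r s = x.
Proof.
move=> xs; rewrite /tcomp unlock; case: xgetP => [y _ /= ys|/(_ x)//].
by apply: val_inj; apply: has_sum_unique ys xs.
Qed.

Lemma tcompP r s : tempered r -> has_sum (twisted_term r s) (cval (tcomp r s)).
Proof. by move=> /(tcomp_ex s)[x [xs _]]; rewrite (tcomp_unique xs). Qed.

Lemma fourier_tcomp r s p : tempered r -> has_sum (A := R[i]^o) (tcoef r s p) (fourier (tcomp r s) p).
Proof. by move=> /(tcomp_ex s)[x [/tcomp_unique -> ]]. Qed.

(** The growth of r in k is paid for by a higher semi-norm of s, while r itself keeps the semi-norm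
    of index m. *)
Lemma pn_tcomp r s m (A : R) M : tempered r -> 0 <= A ->
  (forall k, pn m (r k) <= A * wt R k ^+ M) ->
  pn m (tcomp r s) <= A * (4 ^+ n * pn (m + M + 2 * n) s).
Proof.
move=> tr A0 rA; apply: pn_le => p; rewrite -ler_pdivlMr ?wtX_gt0//.
exact: (has_sum_le (@tcoef_sum r s p m A M A0 rA) (fourier_tcomp s p tr)).
Qed.

Lemma tempered_cst x : tempered (fun=> x).
Proof. by move=> m; exists (pn m x), 0%N => k; rewrite expr0 mulr1. Qed.

Lemma temperedD a b : tempered a -> tempered b -> tempered (fun k => a k + b k).
Proof.
move=> ta tb m; have [A [M [A0 aA]]] := tempered_ge0 m ta; have [B [N [B0 bB]]] := tempered_ge0 m tb.
exists (A + B), (maxn M N) => k; apply: (le_trans (pnD _ _ _)); rewrite mulrDl; apply: lerD.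
  by apply: (le_trans (aA k)); rewrite ler_wpM2l// ler_weXn2l ?wt_ge1 ?leq_maxl.
by apply: (le_trans (bB k)); rewrite ler_wpM2l// ler_weXn2l ?wt_ge1 ?leq_maxr.
Qed.

Lemma temperedZ (c : R[i]) a : tempered a -> tempered (fun k => c *: a k).
Proof.
move=> ta m; have [A [M aA]] := ta m; exists (normc c * A), M => k.
by rewrite pnZ -mulrA ler_wpM2l ?normc_ge0.
Qed.

Lemma temperedB a b : tempered a -> tempered b -> tempered (fun k => a k - b k).
Proof.
move=> ta /(temperedZ (-1)) tb.
rewrite (_ : (fun _ => _) = (fun k => a k + -1 *: b k)); first exact: temperedD.
by apply/funext => k; rewrite scaleN1r.
Qed.

Lemma tempered_sum (I : Type) (q : seq I) (P : pred I) (F : I -> 'rV[int]_n -> Cinf T) :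
  (forall i, tempered (F i)) -> tempered (fun k => \sum_(i <- q | P i) F i k).
Proof.
move=> tF; elim: q => [|i q IH].
  by under eq_fun do rewrite big_nil; exact: tempered_cst.
under eq_fun do rewrite big_cons; case: (P i) => //; exact: temperedD.
Qed.

Lemma tcomp_linl (c : R[i]) a b s : tempered a -> tempered b ->
  tcomp (fun k => c *: a k + b k) s = c *: tcomp a s + tcomp b s.
Proof.
move=> ta tb; apply: tcomp_unique => /=.
have := has_sumZD c (tcompP s ta) (tcompP s tb); congr has_sum; apply/funext => k.
by rewrite /twisted_term /= mulrDl scalerDr -scalerAl !scalerA mulrC.
Qed.

Lemma tcompDl a b s : tempered a -> tempered b ->
  tcomp (fun k => a k + b k) s = tcomp a s + tcomp b s.
Proof.
move=> ta tb; have := tcomp_linl 1 s ta tb; rewrite scale1r => <-.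
by apply: eq_tcomp => k; rewrite scale1r.
Qed.

Lemma tcomp0l s : tcomp (fun=> 0) s = 0.
Proof.
apply: tcomp_unique; rewrite /twisted_term /=.
under eq_fun do rewrite mul0r scaler0; exact: has_sum0.
Qed.

Lemma tcompZl (c : R[i]) a s : tempered a -> tcomp (fun k => c *: a k) s = c *: tcomp a s.
Proof.
move=> ta; have := tcomp_linl c s ta (tempered_cst 0); rewrite tcomp0l addr0 => <-.
by apply: eq_tcomp => k; rewrite addr0.
Qed.

Lemma tcompBl a b s : tempered a -> tempered b ->
  tcomp (fun k => a k - b k) s = tcomp a s - tcomp b s.
Proof.
move=> ta tb; have := tcomp_linl (-1) s tb ta; rewrite scaleN1r addrC => <-.
by apply: eq_tcomp => k; rewrite scaleN1r addrC.
Qed.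

Lemma tcomp_suml (I : Type) (q : seq I) (F : I -> 'rV[int]_n -> Cinf T) s :
  (forall i, tempered (F i)) ->
  tcomp (fun k => \sum_(i <- q) F i k) s = \sum_(i <- q) tcomp (F i) s.
Proof.
move=> tF; elim: q => [|i q IH].
  by under eq_fun do rewrite big_nil; rewrite big_nil tcomp0l.
under eq_fun do rewrite big_cons.
by rewrite big_cons tcompDl ?IH//; exact: tempered_sum.
Qed.

Lemma tcomp_linr (c : R[i]) a u v : tempered a ->
  tcomp a (c *: u + v) = c *: tcomp a u + tcomp a v.
Proof.
move=> ta; apply: tcomp_unique => /=.
have := has_sumZD c (tcompP u ta) (tcompP v ta); congr has_sum; apply/funext => k.
by rewrite /twisted_term fourier_lin scalerDl scalerA.
Qed.

Lemma tcompDr a u v : tempered a -> tcomp a (u + v) = tcomp a u + tcomp a v.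
Proof. by move=> ta; have := tcomp_linr 1 u v ta; rewrite !scale1r. Qed.

Lemma tcomp0r a : tempered a -> tcomp a 0 = 0.
Proof. by move=> ta; apply: (@addrI _ (tcomp a 0)); rewrite -tcompDr// !addr0. Qed.

Lemma tcompZr (c : R[i]) a u : tempered a -> tcomp a (c *: u) = c *: tcomp a u.
Proof. by move=> ta; have := tcomp_linr c u 0 ta; rewrite tcomp0r// !addr0. Qed.

Lemma tcompBr a u v : tempered a -> tcomp a (u - v) = tcomp a u - tcomp a v.
Proof. by move=> ta; have := tcomp_linr (-1) v u ta; rewrite !scaleN1r addrC => ->; rewrite addrC. Qed.

Lemma tcomp_sumr (I : Type) (q : seq I) (F : I -> Cinf T) a : tempered a ->
  tcomp a (\sum_(i <- q) F i) = \sum_(i <- q) tcomp a (F i).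
Proof.
move=> ta; elim: q => [|i q IH]; first by rewrite !big_nil tcomp0r.
by rewrite !big_cons tcompDr ?IH.
Qed.

Lemma tempered_shift a m : tempered a -> tempered (fun k => a (m + k)).
Proof.
move=> ta j; have [A [M [A0 aA]]] := tempered_ge0 j ta.
exists (A * wt R m ^+ M), M => k; apply: (le_trans (aA _)).
rewrite -mulrA ler_wpM2l// -exprMn; apply: lerXn2r (wtD _ _ _); rewrite ?nnegrE ?mulr_ge0 ?wt_ge0//.
Qed.

(** This is the composition formula. In the double series W over (m, k), the terms with m + k = p
    add up to the coefficient at p of [tcomp b u] times a(p) U^p, and those with m fixed give the
    m-th term of the right-hand side. *)
Lemma tcompA a b u : tempered a -> tempered b ->
  tcomp a (tcomp b u) = tcomp (fun m => tcomp (fun k => a (m + k)) (b m)) u.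
Proof.
move=> ta tb; symmetry; apply: tcomp_unique.
pose W (q : 'rV[int]_n * 'rV[int]_n) : T := (fourier u q.1 * fourier (b q.1) q.2) *:
  (cval (a (q.1 + q.2)) * (gen_pow T q.2 * gen_pow T q.1)).
have [S WS] : exists S, has_sum W S.
  have [A [M [A0 aA]]] := tempered_ge0 (2 * n) ta.
  have [B [N [B0 bB]]] := tempered_ge0 (M + 2 * n) tb.
  apply: (@abs_has_sum _ _ _ _ ((pn (M + N + 2 * n) u * 4 ^+ n) * ((B * (4 ^+ n * A)) * 4 ^+ n))) => F.
  apply: (@le_trans _ _ (\sum_(q <- F) (normc (fourier u q.1) * wt R q.1 ^+ (M + N)) *
     ((B * (4 ^+ n * A)) * (wt R q.2 ^+ (2 * n))^-1))).
    apply: ler_sum => -[k l] _ /=; rewrite /W /= gen_powM cnormZ normcM -2!mulrA.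
    rewrite ler_wpM2l ?normc_ge0//.
    have H1 : cnorm (cval (a (k + l)) * (cocycle T l k *: gen_pow T (l + k))) <=
        4 ^+ n * (A * (wt R k * wt R l) ^+ M).
      apply: (le_trans (ler_cnormM _ _)); rewrite cnormZ normc_cocycle mul1r cnorm_gen_pow mulr1.
      apply: (le_trans (cnorm_le_pn _)); rewrite ler_wpM2l ?exprn_ge0//.
      apply: (le_trans (aA _)); rewrite ler_wpM2l//.
      by apply: lerXn2r (wtD _ _ _); rewrite ?nnegrE ?mulr_ge0 ?wt_ge0.
    apply: (le_trans (ler_wpM2l (normc_ge0 _) H1)).
    have := le_trans (fourier_le_pn (M + 2 * n) (b k) l) (bB k).
    have := wtX_gt0 R k M; have := wtX_gt0 R l M; have := wtX_gt0 R l (2 * n).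
    move: (2 * n)%N => q; rewrite !exprD exprMn.
    move: (wt R k ^+ M) (wt R l ^+ M) (wt R l ^+ q) (wt R k ^+ N) => x y z t z0 y0 x0.
    set f := normc _ => H2.
    rewrite [leRHS](_ : _ = (B * t) * (4 ^+ n * A * x) / z); last by ring.
    rewrite ler_pdivlMr// [leLHS](_ : _ = (f * (y * z)) * (4 ^+ n * A * x)); last by ring.
    by rewrite ler_wpM2r ?mulr_ge0 ?exprn_ge0// ltW.
  apply: (@ler_sum_prod R _ _ (fun k => normc (fourier u k) * wt R k ^+ (M + N))
    (fun l => B * (4 ^+ n * A) * (wt R l ^+ (2 * n))^-1)).
  - by move=> k; rewrite mulr_ge0 ?normc_ge0 ?wtX_ge0.
  - by move=> l; rewrite mulr_ge0// ?mulr_ge0 ?exprn_ge0// invr_ge0 wtX_ge0.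
  - by apply: rapid_sum_bound => k; exact: fourier_le_pn.
  - by move=> G; rewrite -mulr_sumr ler_wpM2l ?mulr_ge0 ?exprn_ge0// sum_wt.
have -> : cval (tcomp a (tcomp b u)) = S.
  pose h (q : 'rV[int]_n * 'rV[int]_n) := (q.2, q.1 - q.2).
  pose h' (q : 'rV[int]_n * 'rV[int]_n) := (q.2 + q.1, q.1).
  have hK : cancel h h' by move=> [p k]; rewrite /h /h' /= subrK.
  have h'K : cancel h' h by move=> [p k]; rewrite /h /h' /= addrK.
  apply: has_sum_unique (tcompP (tcomp b u) ta) _.
  apply: has_sum_fubini (has_sum_bij hK h'K WS) _ => p.
  pose y : T := cval (a p) * gen_pow T p.
  have phiB : {morph (fun c : R[i]^o => c *: y) : y z / y - z}.
    by move=> c d; rewrite scalerBl.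
  have phic (c : R[i]^o) : cnorm (c *: y) <= cnorm y * cnorm c.
    by rewrite cnormZ mulrC.
  have := has_sum_additive phiB phic (fourier_tcomp u p tb); congr has_sum; apply/funext => k /=.
  rewrite /W /= gen_powM subrK [k + _]addrC subrK -scalerAr scalerA.
  by congr (_ *: _).
apply: has_sum_fubini WS _ => m.
have phiB : {morph (fun y : T => fourier u m *: (y * gen_pow T m)) : y z / y - z}.
  by move=> y z; rewrite mulrBl scalerBr.
have phic (y : T) : cnorm (fourier u m *: (y * gen_pow T m)) <= normc (fourier u m) * cnorm y.
  rewrite cnormZ ler_wpM2l ?normc_ge0//; apply: le_trans (ler_cnormM _ _) _.
  by rewrite cnorm_gen_pow mulr1.
have := has_sum_additive phiB phic (tcompP (b m) (tempered_shift m ta)).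
congr has_sum; apply/funext => k /=.
by rewrite /W /twisted_term /= -scalerAl scalerA mulrA.
Qed.

Lemma is_quantizationP (rho : 'rV[R]_n -> Cinf T) (P : Cinf T -> Cinf T) :
  tempered (fun k => rho (int_vec R k)) ->
  is_quantization rho P <-> forall u, P u = tcomp (fun k => rho (int_vec R k)) u.
Proof.
move=> tr; split=> H u; first by symmetry; apply: tcomp_unique; exact: H.
by rewrite H; exact: tcompP.
Qed.

End TwistedSum.

(** * Differential calculus with values in the smooth algebra *)

Section RealTaylor.
Variable R : realType.
Implicit Types (f df : R -> R).

Lemma mvt_bound_seg f df (a b B : R) : a <= b ->
  (forall t : R, a <= t <= b -> is_derive t 1 f (df t)) ->
  (forall t : R, a <= t <= b -> `|df t| <= B) -> `|f b - f a| <= B * (b - a).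
Proof.
move=> ab fd dB.
have [| |c + ->] := @MVT_segment R f df a b ab.
- by move=> x; rewrite in_itv/= => /andP[/ltW x0 /ltW x1]; apply: fd; rewrite x0.
- apply: continuous_in_subspaceT => x /set_mem/=; rewrite in_itv/= => /fd[dx _].
  by apply: differentiable_continuous; apply/derivable1_diffP.
- by rewrite in_itv/= normrM => /dB H; rewrite (@ger0_norm _ (b - a)) ?subr_ge0// ler_wpM2r ?subr_ge0.
Qed.

Lemma is_derive_monomial (c t : R) (p : nat) :
  is_derive t 1 (fun x : R => x ^+ p.+1 / p.+1`!%:R * c) (t ^+ p / p`!%:R * c).
Proof.
have X q : is_derive t 1 (fun x : R => x ^+ q.+1) (q.+1%:R * t ^+ q).
  elim: q => [|q IH].
    rewrite expr0 mulr1 (_ : (fun x : R => x ^+ 1) = id); last by apply/funext => x; rewrite expr1.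
    exact: is_derive_id.
  rewrite (_ : (fun x : R => x ^+ q.+2) = (id : R -> R) * (fun x : R => x ^+ q.+1)); last first.
    by apply/funext => x; rewrite exprS.
  apply: is_derive_eq; rewrite /GRing.scale/= mulr1 exprS -[in RHS]natr1; ring.
rewrite (_ : (fun x : R => _) = (fun x => (c / p.+1`!%:R) *: (x ^+ p.+1))); last first.
  by apply/funext => x; rewrite /GRing.scale/= mulrC -mulrA [_^-1 * _]mulrC mulrA.
have := X p => Xp; apply: is_derive_eq; rewrite /GRing.scale/= factS natrM.
have p0 : p.+1%:R != 0 :> R by rewrite pnatr_eq0.
have f0 : p`!%:R != 0 :> R by rewrite pnatr_eq0 -lt0n fact_gt0.
move: (p.+1%:R : R) (p`!%:R : R) p0 f0 => q f q0 f0.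
by field; rewrite q0 f0.
Qed.

(** Here f i stands for the i-th derivative. The derivative of the remainder is the remainder of one
    order less for the shifted sequence, and the mean value inequality over a length T <= 1 does not
    increase the bound: the factor 1 / N! is given up. *)
Lemma real_taylor N (f : nat -> R -> R) (B T : R) : 0 <= T <= 1 ->
  (forall i (t : R), (i < N)%N -> 0 <= t <= 1 -> is_derive t 1 (f i) (f i.+1 t)) ->
  (forall t : R, 0 <= t <= 1 -> `|f N t| <= B) ->
  `|f 0%N T - \sum_(i < N) T ^+ i / i`!%:R * f i 0| <= B.
Proof.
elim: N f T => [|N IH] f T T01 fd fB; first by rewrite big_ord0 subr0 fB.
have B0 : 0 <= B by apply: le_trans (fB 0 _) => //; rewrite lexx ler01.
have /andP[T0 T1] := T01.
pose F (x : R) := f 0%N x - \sum_(i < N.+1) x ^+ i / i`!%:R * f i 0.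
pose dF (x : R) := f 1%N x - \sum_(i < N) x ^+ i / i`!%:R * f i.+1 0.
have Fd (t : R) : 0 <= t <= T -> is_derive t 1 F (dF t).
  move=> /andP[t0 tT]; have t01 : 0 <= t <= 1 by rewrite t0 (le_trans tT).
  have -> : F = f 0%N - (cst (f 0%N 0) + \sum_(i < N) (fun x : R => x ^+ i.+1 / i.+1`!%:R * f i.+1 0)).
    apply/funext => x; rewrite /F big_ord_recl /= expr0 fact0 divr1 mul1r.
    by rewrite !fctE fct_sumE.
  have D0 := fd 0%N t isT t01.
  have DS : is_derive t 1 (\sum_(i < N) (fun x : R => x ^+ i.+1 / i.+1`!%:R * f i.+1 0))
      (\sum_(i < N) (t ^+ i / i`!%:R * f i.+1 0)).
    by apply: is_derive_sum => i; exact: is_derive_monomial.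
  by apply: is_derive_eq; rewrite add0r.
have := @mvt_bound_seg F dF 0 T B T0 Fd.
have -> : F 0 = 0.
  rewrite /F big_ord_recl /= expr0 fact0 divr1 mul1r big1 ?addr0 ?subrr// => i _.
  by rewrite expr0n /= !mul0r.
rewrite !subr0 => H; apply: (le_trans (H _)); last by rewrite ler_piMr.
move=> t /andP[t0 tT]; apply: (IH (fun i => f i.+1)) => //.
- by rewrite t0 (le_trans tT).
- by move=> i s iN; exact: fd.
Qed.

End RealTaylor.

(** * Curves in the smooth algebra *)

Section CurveCalculus.
Variables (R : realType) (n : nat) (theta : 'M[R]_n) (T : nctorus theta).
Implicit Types (g dg : R -> Cinf T) (u v w : Cinf T) (t h : R) (m : nat).

Definition has_cd g t w := forall m (e : R), 0 < e -> exists2 r : R, 0 < r &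
  forall h, `|h| < r -> pn m (g (t + h) - g t - h%:C *: w) <= e * `|h|.

Lemma pn_le_ReIm m u (B : R) :
  (forall k, `|complex.Re (fourier u k)| * wt R k ^+ m <= B) ->
  (forall k, `|complex.Im (fourier u k)| * wt R k ^+ m <= B) -> pn m u <= 2 * B.
Proof.
move=> H1 H2; apply: pn_le => k.
apply: le_trans (ler_wpM2r (wtX_ge0 _ _ _) (normc_le_ReIm _)) _.
by rewrite mulrDl mulr_natl mulr2n lerD.
Qed.

Lemma normc_fourier_le_pn0 u k : normc (fourier u k) <= pn 0 u.
Proof. by have := fourier_le_pn 0 u k; rewrite expr0 mulr1. Qed.

Lemma complex_ReB (x y : R[i]) : complex.Re (x - y) = complex.Re x - complex.Re y.
Proof. by case: x; case: y. Qed.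
Lemma complex_ImB (x y : R[i]) : complex.Im (x - y) = complex.Im x - complex.Im y.
Proof. by case: x; case: y. Qed.
Lemma complex_ReZ (x : R) (y : R[i]) : complex.Re (x%:C * y) = x * complex.Re y.
Proof. by case: y => a b /=; rewrite mul0r subr0. Qed.
Lemma complex_ImZ (x : R) (y : R[i]) : complex.Im (x%:C * y) = x * complex.Im y.
Proof. by case: y => a b /=; rewrite mul0r addr0. Qed.

Lemma complex_Re_sum (I : Type) (s : seq I) (F : I -> R[i]) :
  complex.Re (\sum_(i <- s) F i) = \sum_(i <- s) complex.Re (F i).
Proof. by elim/big_rec2 : _ => //= i x y _ <-; case: (F i); case: y. Qed.
Lemma complex_Im_sum (I : Type) (s : seq I) (F : I -> R[i]) :
  complex.Im (\sum_(i <- s) F i) = \sum_(i <- s) complex.Im (F i).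
Proof. by elim/big_rec2 : _ => //= i x y _ <-; case: (F i); case: y. Qed.

Lemma fourier_sumE (I : Type) (s : seq I) (F : I -> Cinf T) k :
  fourier (\sum_(i <- s) F i) k = \sum_(i <- s) fourier (F i) k.
Proof. by elim/big_rec2 : _ => [|i x y _ <-]; rewrite ?fourier0 ?fourierD. Qed.

Lemma has_cd_Re g t w k : has_cd g t w ->
  is_derive t 1 (fun x => complex.Re (fourier (g x) k)) (complex.Re (fourier w k)).
Proof.
move=> gw; apply: small_is_derive => e /(gw 0%N)[r r0 H]; exists r => // h /H.
apply: le_trans; apply: le_trans (normc_fourier_le_pn0 _ k).
by rewrite !fourierB fourierZ mulrC -complex_ReZ -!complex_ReB ler_normc_Re.
Qed.

Lemma has_cd_Im g t w k : has_cd g t w ->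
  is_derive t 1 (fun x => complex.Im (fourier (g x) k)) (complex.Im (fourier w k)).
Proof.
move=> gw; apply: small_is_derive => e /(gw 0%N)[r r0 H]; exists r => // h /H.
apply: le_trans; apply: le_trans (normc_fourier_le_pn0 _ k).
by rewrite !fourierB fourierZ mulrC -complex_ImZ -!complex_ImB ler_normc_Im.
Qed.

(** Real and imaginary parts of each coefficient obey the scalar estimate with the bound B / wt k ^
    m; the supremum over k restores [pn]. *)
Lemma curve_taylor N (g : nat -> R -> Cinf T) m (B : R) :
  (forall i t, (i < N)%N -> 0 <= t <= 1 -> has_cd (g i) t (g i.+1 t)) ->
  (forall t, 0 <= t <= 1 -> pn m (g N t) <= B) ->
  pn m (g 0%N 1 - \sum_(i < N) (i`!%:R^-1)%:C *: g i 0) <= 2 * B.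
Proof.
move=> gd gB.
have T01 : 0 <= (1 : R) <= 1 by rewrite ler01 lexx.
have gB' t k : 0 <= t <= 1 -> normc (fourier (g N t) k) <= B / wt R k ^+ m.
  by move=> /gB H; rewrite ler_pdivlMr ?wtX_gt0// (le_trans (fourier_le_pn _ _ _) H).
apply: pn_le_ReIm => k; rewrite -ler_pdivlMr ?wtX_gt0//.
  have := @real_taylor R N (fun i t => complex.Re (fourier (g i t) k)) (B / wt R k ^+ m) 1 T01.
  rewrite fourierB complex_ReB fourier_sumE complex_Re_sum.
  rewrite (eq_bigr (fun i : 'I_N => i`!%:R^-1 * complex.Re (fourier (g i 0) k))); last first.
    by move=> i _; rewrite expr1n div1r.
  have <- : \sum_(i < N) complex.Re (fourier ((i`!%:R^-1)%:C *: g i 0) k) =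
    \sum_(i < N) (i`!%:R^-1 * complex.Re (fourier (g i 0) k)).
  by apply: eq_bigr => i _; rewrite fourierZ complex_ReZ.
  apply; first by move=> i t iN t01; apply: has_cd_Re; exact: gd.
  by move=> t t01; exact: le_trans (ler_normc_Re _) (gB' t k t01).
have := @real_taylor R N (fun i t => complex.Im (fourier (g i t) k)) (B / wt R k ^+ m) 1 T01.
rewrite fourierB complex_ImB fourier_sumE complex_Im_sum.
rewrite (eq_bigr (fun i : 'I_N => i`!%:R^-1 * complex.Im (fourier (g i 0) k))); last first.
  by move=> i _; rewrite expr1n div1r.
have <- : \sum_(i < N) complex.Im (fourier ((i`!%:R^-1)%:C *: g i 0) k) =
    \sum_(i < N) (i`!%:R^-1 * complex.Im (fourier (g i 0) k)).
  by apply: eq_bigr => i _; rewrite fourierZ complex_ImZ.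
apply; first by move=> i t iN t01; apply: has_cd_Im; exact: gd.
by move=> t t01; exact: le_trans (ler_normc_Im _) (gB' t k t01).
Qed.

Lemma has_cdB g1 g2 t u v : has_cd g1 t u -> has_cd g2 t v ->
  has_cd (fun x => g1 x - g2 x) t (u - v).
Proof.
move=> H1 H2 m e e0; have e2 : 0 < e / 2 by rewrite divr_gt0.
have [r1 r10 K1] := H1 m _ e2; have [r2 r20 K2] := H2 m _ e2.
exists (Num.min r1 r2); first by rewrite lt_min r10 r20.
move=> h; rewrite lt_min => /andP[/K1 h1 /K2 h2].
have -> : g1 (t + h) - g2 (t + h) - (g1 t - g2 t) - h%:C *: (u - v) =
  (g1 (t + h) - g1 t - h%:C *: u) - (g2 (t + h) - g2 t - h%:C *: v).
  cinf_ring.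
apply: (le_trans (pnB _ _ _)); rewrite (splitr e) mulrDl; exact: lerD.
Qed.

Lemma has_cd_lin t w : has_cd (fun x => x%:C *: w) t w.
Proof.
move=> m e e0; exists 1 => // h _.
have -> : (t + h)%:C *: w - t%:C *: w - h%:C *: w = 0 by rewrite rmorphD/=; cinf_ring.
by rewrite pn0 mulr_ge0// ltW.
Qed.

Lemma has_cd_cst t u : has_cd (fun=> u) t 0.
Proof.
move=> m e e0; exists 1 => // h _.
by rewrite subrr scaler0 subr0 pn0 mulr_ge0// ltW.
Qed.

(** The Taylor estimate of order 1 for g(t) - t w. *)
Lemma curve_mvt g dg w m (B : R) :
  (forall t, 0 <= t <= 1 -> has_cd g t (dg t)) ->
  (forall t, 0 <= t <= 1 -> pn m (dg t - w) <= B) -> pn m (g 1 - g 0 - w) <= 2 * B.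
Proof.
move=> gd gB.
pose G (i : nat) t : Cinf T := if i is 0%N then g t - t%:C *: w else dg t - w.
have := @curve_taylor 1 G m B.
have -> : G 0%N 1 - \sum_(i < 1) (i`!%:R^-1)%:C *: G i 0 = g 1 - g 0 - w.
  by rewrite big_ord1 /= fact0 invr1 scale1r scale0r subr0 scale1r addrAC.
apply; last exact: gB.
by case=> // t _ t01; apply: has_cdB; [exact: gd|exact: has_cd_lin].
Qed.

Lemma has_cd_ext g1 g2 t w (r0 : R) : 0 < r0 -> (forall h, `|h| < r0 -> g1 (t + h) = g2 (t + h)) ->
  has_cd g1 t w -> has_cd g2 t w.
Proof.
move=> r00 E H m e e0; have [r r1 K] := H m e e0.
exists (Num.min r r0); first by rewrite lt_min r1 r00.
move=> h; rewrite lt_min => /andP[/K + /E <-].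
by have := E 0; rewrite normr0 addr0 => /(_ r00) <-.
Qed.

Lemma has_cd_unique g t u v : has_cd g t u -> has_cd g t v -> u = v.
Proof.
move=> H1 H2; apply/eqP; rewrite -subr_eq0; apply/eqP/(@pn_eq0 _ _ _ _ 0).
apply/ler_addgt0Pr => e e0; rewrite add0r; have e2 : 0 < e / 2 by rewrite divr_gt0.
have [r1 r10 K1] := H1 0%N _ e2; have [r2 r20 K2] := H2 0%N _ e2.
pose h : R := Num.min r1 r2 / 2.
have m0 : 0 < Num.min r1 r2 by rewrite lt_min r10 r20.
have h0 : 0 < h by rewrite divr_gt0.
have hm : h < Num.min r1 r2 by rewrite /h ltr_pdivrMr//; lra.
move: hm; rewrite lt_min -{1 2}(gtr0_norm h0) => /andP[/K1 A1 /K2 A2].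
have E : h%:C *: (u - v) = (g (t + h) - g t - h%:C *: v) - (g (t + h) - g t - h%:C *: u) by cinf_ring.
have := pnB 0 (g (t + h) - g t - h%:C *: v) (g (t + h) - g t - h%:C *: u).
rewrite -E pnZ normc_real; rewrite (gtr0_norm h0) in A1 A2 *.
move: (pn 0 (u - v)) A1 A2 => p A1 A2 A3.
by rewrite -(ler_pM2l h0); lra.
Qed.

End CurveCalculus.

Lemma add2rK (V : zmodType) (x a b : V) : x + a + b - x = a + b.
Proof. by rewrite -(addrA x) (addrC x) addrK. Qed.

Lemma addrKl (V : zmodType) (x a : V) : x + a - x = a.
Proof. by rewrite addrC addrA addNr add0r. Qed.

(** * Directional derivatives and the symmetry of second derivatives *)

Section DirectionalDerivatives.
Variables (R : realType) (n : nat) (theta : 'M[R]_n) (T : nctorus theta).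
Implicit Types (f g : 'rV[R]_n -> Cinf T) (x y v : 'rV[R]_n) (u w : Cinf T) (t h : R) (m : nat).

Definition has_dd v f x w := has_cd (fun t => f (x + t *: v)) 0 w.

Definition cont_at f x := forall m (e : R), 0 < e -> exists2 r : R, 0 < r &
  forall y, `|y - x| < r -> pn m (f y - f x) <= e.

Lemma has_ddP v f x w : has_dd v f x w <-> forall m (e : R), 0 < e -> exists2 r : R, 0 < r &
  forall h, `|h| < r -> pn m (f (x + h *: v) - f x - h%:C *: w) <= e * `|h|.
Proof.
by split=> H m e e0; have [r r0 K] := H m e e0; (exists r; first exact: r0) => h /K;
  rewrite (add0r h) (scale0r v) (addr0 x).
Qed.

Lemma has_pderivP j f x w : has_pderiv j f x w <-> has_dd (delta_mx ord0 j) f x w.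
Proof.
rewrite /has_pderiv sn_cvgP has_ddP; split=> H m e e0; have := H m e e0.
  rewrite near_withinE => /nbhs_ballP[r /= r0 K]; exists r; first exact: r0.
  move=> h hr.
  have [->|h0] := eqVneq h 0.
    by rewrite scale0r addr0 subrr sub0r scale0r oppr0 pn0 normr0 mulr0.
  have := K h; rewrite /ball/= sub0r normrN => /(_ hr h0) L.
  have hc : (h%:C : R[i]) != 0 by rewrite eq_complex/= eqxx andbT.
  have -> : f (x + h *: delta_mx ord0 j) - f x - h%:C *: w =
     h%:C *: ((h^-1)%:C *: (f (x + h *: delta_mx ord0 j) - f x) - w).
    by rewrite [RHS]scalerBr scalerA -rmorphM/= divff// scale1r.
  by rewrite pnZ normc_real mulrC ler_wpM2r.
move=> [r r0 K]; rewrite near_withinE; apply/nbhs_ballP; exists r => // h.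
rewrite /ball/= sub0r normrN => /K{}K h0.
have hc : (h%:C : R[i]) != 0 by rewrite eq_complex/= eqxx andbT.
have -> : (h^-1)%:C *: (f (x + h *: delta_mx ord0 j) - f x) - w =
    (h^-1)%:C *: (f (x + h *: delta_mx ord0 j) - f x - h%:C *: w).
  by rewrite [RHS]scalerBr scalerA -rmorphM/= mulVf// scale1r.
by rewrite pnZ normc_real normfV mulrC ler_pdivrMr ?normr_gt0.
Qed.

Lemma cont_atP f x : sn_cvg (@Cinf_snorm _ _ _ T) (nbhs x) f (f x) <-> cont_at f x.
Proof.
rewrite sn_cvgP; split=> H m e e0; have := H m e e0.
  move=> /nbhs_ballP[r /= r0 K]; exists r; first exact: r0.
  move=> y yr; apply: K.
  by rewrite mx_norm_ball /ball_ /= distrC.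
move=> [r r0 K]; apply/nbhs_ballP; exists r => // y.
by rewrite mx_norm_ball /ball_ /= distrC => /K.
Qed.

Lemma has_dd_line v f x t w : has_dd v f (x + t *: v) w -> has_cd (fun s => f (x + s *: v)) t w.
Proof.
move=> /has_ddP H m e e0; have [r r0 K] := H m e e0; exists r; first exact: r0.
move=> h /K; have -> : x + (t + h) *: v = x + t *: v + h *: v by rewrite scalerDl addrA.
exact.
Qed.

Lemma has_ddZ (c : R) v f x w : has_dd v f x w -> has_dd (c *: v) f x (c%:C *: w).
Proof.
move=> /has_ddP H; apply/has_ddP => m e e0.
have c0 : 0 < 1 + `|c| by rewrite ltr_pwDl.
have [r r0 K] := H m _ (divr_gt0 e0 c0); exists (r / (1 + `|c|)); first by rewrite divr_gt0.
move=> h; rewrite ltr_pdivlMr// => hr.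
have hc : `|h * c| <= `|h| * (1 + `|c|) by rewrite normrM ler_wpM2l// lerDr.
have := K _ (le_lt_trans hc hr); rewrite rmorphM/= !scalerA => L; apply: (le_trans L).
by rewrite mulrAC ler_pdivrMr// -mulrA ler_wpM2l// ltW.
Qed.

Lemma dd_mvt v f x (df : R -> Cinf T) w m (B : R) :
  (forall t, 0 <= t <= 1 -> has_dd v f (x + t *: v) (df t)) ->
  (forall t, 0 <= t <= 1 -> pn m (df t - w) <= B) -> pn m (f (x + v) - f x - w) <= 2 * B.
Proof.
move=> fd dB.
have f1 : f (x + 1 *: v) = f (x + v) by congr f; rewrite scale1r.
have f0 : f (x + 0 *: v) = f x by congr f; rewrite scale0r addr0.
rewrite -f1 -f0; apply: (@curve_mvt _ _ _ _ (fun t => f (x + t *: v)) df w m B) => [t /fd|t /dB].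
  exact: has_dd_line.
exact.
Qed.

Lemma has_dd0 f x : has_dd 0 f x 0.
Proof.
have E : (fun t : R => f (x + t *: (0 : 'rV[R]_n))) = (fun=> f x).
  by apply/funext => t; congr f; rewrite scaler0 addr0.
by rewrite /has_dd E; exact: has_cd_cst.
Qed.

(** The increment is split into a step along v1 at x and a step along v2 at x + h v1. Over the
    second one the mean value inequality replaces the derivative by g x, up to an error controlled
    by the continuity of g at x. *)
Lemma has_dd_add v1 v2 f (g : 'rV[R]_n -> Cinf T) x w (r0 : R) : 0 < r0 ->
  has_dd v1 f x w ->
  (forall y, `|y - x| < r0 -> has_dd v2 f y (g y)) -> cont_at g x ->
  has_dd (v1 + v2) f x (w + g x).
Proof.
move=> r00 /has_ddP H1 H2 gc; apply/has_ddP => m e e0.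
have e2 : 0 < e / 2 by rewrite divr_gt0.
have e4 : 0 < e / 4 by rewrite divr_gt0.
have [r1 r10 K1] := H1 m _ e2; have [r2 r20 K2] := gc m _ e4.
have N0 : 0 < 1 + (`|v1| + `|v2|) by rewrite ltr_pwDl// addr_ge0.
exists (Num.min r1 (Num.min r0 r2 / (1 + (`|v1| + `|v2|)))).
  by rewrite lt_min r10 divr_gt0// lt_min r00 r20.
move=> h; rewrite lt_min ltr_pdivlMr// lt_min => /andP[/K1 h1 /andP[h0 h2]].
have pt t : 0 <= t <= 1 -> `|x + h *: v1 + t *: (h *: v2) - x| <= `|h| * (1 + (`|v1| + `|v2|)).
  move=> /andP[t0 t1]; rewrite add2rK scalerA.
  apply: (le_trans (ler_normD _ _)); rewrite !mx_normZ normrM (ger0_norm t0).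
  have := normr_ge0 h; have := normr_ge0 v1; have := normr_ge0 v2.
  move: `|h| `|v1| `|v2| => a b c c0 b0 a0.
  have : t * a * c <= a * c by rewrite -mulrA ler_piMl// mulr_ge0.
  nra.
have := @dd_mvt (h *: v2) f (x + h *: v1) (fun t => h%:C *: g (x + h *: v1 + t *: (h *: v2)))
   (h%:C *: g x) m (`|h| * (e / 4)).
have E : f (x + h *: (v1 + v2)) - f x - h%:C *: (w + g x) =
  (f (x + h *: v1 + h *: v2) - f (x + h *: v1) - h%:C *: g x) + (f (x + h *: v1) - f x - h%:C *: w).
  by rewrite [h *: (v1 + v2)]scalerDr addrA; cinf_ring.
move=> L; rewrite E; apply: (le_trans (pnD _ _ _)).
have -> : e * `|h| = 2 * (`|h| * (e / 4)) + e / 2 * `|h| by field.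
apply: lerD => //; apply: L => t t01.
  by apply: has_ddZ; apply: H2; apply: le_lt_trans (pt t t01) h0.
rewrite -scalerBr pnZ normc_real ler_wpM2l//; apply: K2.
exact: le_lt_trans (pt t t01) h2.
Qed.

Lemma has_dd_ext v f g x w (r0 : R) : 0 < r0 -> (forall y, `|y - x| < r0 -> f y = g y) ->
  has_dd v f x w -> has_dd v g x w.
Proof.
move=> r00 E; have N0 : 0 < 1 + `|v| by rewrite ltr_pwDl.
apply: (@has_cd_ext _ _ _ _ _ _ _ _ (r0 / (1 + `|v|))); first by rewrite divr_gt0.
move=> h; rewrite ltr_pdivlMr// add0r => hr; apply: E.
rewrite addrKl mx_normZ; apply: le_lt_trans hr.
by rewrite ler_wpM2l// lerDr.
Qed.

Lemma cont_at_ext f g x (r0 : R) : 0 < r0 -> (forall y, `|y - x| < r0 -> f y = g y) ->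
  cont_at f x -> cont_at g x.
Proof.
move=> r00 E H m e e0; have [r r1 K] := H m e e0.
exists (Num.min r r0); first by rewrite lt_min r1 r00.
move=> y; rewrite lt_min => /andP[/K + /E <-].
by have := E x; rewrite subrr normr0 => /(_ r00) <-.
Qed.

(** The mean value inequality is used twice, in direction i for the difference G taken in direction
    j, then in direction j for gi; its two factors 2 account for e / 4. *)
Lemma second_difference i j f gi gij x (r0 : R) m (e : R) : 0 < r0 -> 0 < e ->
  (forall y, `|y - x| < r0 -> has_dd (delta_mx ord0 i) f y (gi y)) ->
  (forall y, `|y - x| < r0 -> has_dd (delta_mx ord0 j) gi y (gij y)) ->
  cont_at gij x ->
  exists2 r : R, 0 < r & forall h, `|h| < r ->
   pn m ((f (x + h *: delta_mx ord0 i + h *: delta_mx ord0 j) - f (x + h *: delta_mx ord0 i))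
     - (f (x + h *: delta_mx ord0 j) - f x) - (h ^+ 2)%:C *: gij x) <= e * `|h| ^+ 2.
Proof.
move=> r00 e0 fi fij cij.
have e4 : 0 < e / 4 by rewrite divr_gt0.
have [r1 r10 K1] := cij m _ e4.
have d1 k : `|delta_mx ord0 k : 'rV[R]_n| <= 1.
  apply: ler_norm_coord => // l; by rewrite mxE; case: (_ && _); rewrite /= ?normr1 ?normr0 ?ler01.
exists (Num.min r0 r1 / 3); first by rewrite divr_gt0// lt_min r00 r10.
move=> h; rewrite ltr_pdivlMr// lt_min => /andP[h0 h1].
pose di : 'rV[R]_n := delta_mx ord0 i; pose dj : 'rV[R]_n := delta_mx ord0 j.
have pt t s : 0 <= t <= 1 -> 0 <= s <= 1 -> `|x + t *: (h *: di) + s *: (h *: dj) - x| <= `|h| * 2.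
  move=> /andP[t0 t1] /andP[s0 s1]; rewrite add2rK.
  apply: (le_trans (ler_normD _ _)); rewrite !mx_normZ (ger0_norm t0) (ger0_norm s0).
  have A t' k : 0 <= t' -> t' <= 1 -> t' * (`|h| * `|delta_mx ord0 k : 'rV[R]_n|) <= `|h|.
    move=> t'0 t'1; rewrite -[leRHS]mul1r ler_pM// ?mulr_ge0// ler_piMr//; exact: d1.
  by rewrite mulr_natr mulr2n lerD// A.
have lt1 (a : R) : a <= `|h| * 2 -> a < r0 /\ a < r1.
  by have := normr_ge0 h; lra.
have z01 : 0 <= (0 : R) <= 1 by rewrite lexx ler01.
have o01 : 0 <= (1 : R) <= 1 by rewrite lexx ler01.
pose G (t : R) := f (x + t *: (h *: di) + h *: dj) - f (x + t *: (h *: di)).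
pose dG (t : R) := h%:C *: gi (x + t *: (h *: di) + h *: dj) - h%:C *: gi (x + t *: (h *: di)).
have GdG t : 0 <= t <= 1 -> has_cd G t (dG t).
  move=> t01; apply: has_cdB.
    have := @has_dd_line (h *: di) f (x + h *: dj) t (h%:C *: gi (x + t *: (h *: di) + h *: dj)).
    rewrite (_ : (fun s => f (x + h *: dj + s *: (h *: di))) = (fun s => f (x + s *: (h *: di) + h *: dj))); last first.
      by apply/funext => s; rewrite addrAC.
    apply; rewrite addrAC; apply: has_ddZ; apply: fi.
    by have := lt1 _ (pt t 1 t01 o01); rewrite scale1r => -[].
  apply: has_dd_line; apply: has_ddZ; apply: fi.
  by have := lt1 _ (pt t 0 t01 z01); rewrite scale0r addr0 => -[].
have B t : 0 <= t <= 1 -> pn m (dG t - (h ^+ 2)%:C *: gij x) <= `|h| * (2 * (`|h| * (e / 4))).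
  move=> t01; have -> : dG t - (h ^+ 2)%:C *: gij x =
    h%:C *: (gi (x + t *: (h *: di) + h *: dj) - gi (x + t *: (h *: di)) - h%:C *: gij x).
    by rewrite /dG expr2 rmorphM/=; cinf_ring.
  rewrite pnZ normc_real ler_wpM2l//.
  apply: (@dd_mvt _ _ _ (fun s => h%:C *: gij (x + t *: (h *: di) + s *: (h *: dj)))) => s s01.
    by apply: has_ddZ; apply: fij; have [] := lt1 _ (pt t s t01 s01).
  rewrite -scalerBr pnZ normc_real ler_wpM2l//; apply: K1.
  by have [] := lt1 _ (pt t s t01 s01).
have := @curve_mvt _ _ _ _ G dG ((h ^+ 2)%:C *: gij x) m _ GdG B.
rewrite /G scale1r scale0r addr0 => L; apply: (le_trans L).
by rewrite le_eqVlt; apply/orP; left; apply/eqP; field.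
Qed.

(** The second difference over the square of side h is symmetric in i and j, and its quotient by h^2
    is close to both mixed derivatives. *)
Lemma clairaut i j f gi gj gij gji x (r0 : R) : 0 < r0 ->
  (forall y, `|y - x| < r0 -> has_dd (delta_mx ord0 i) f y (gi y)) ->
  (forall y, `|y - x| < r0 -> has_dd (delta_mx ord0 j) f y (gj y)) ->
  (forall y, `|y - x| < r0 -> has_dd (delta_mx ord0 j) gi y (gij y)) ->
  (forall y, `|y - x| < r0 -> has_dd (delta_mx ord0 i) gj y (gji y)) ->
  cont_at gij x -> cont_at gji x -> gij x = gji x.
Proof.
move=> r00 fi fj fij fji cij cji.
apply/eqP; rewrite -subr_eq0; apply/eqP/(@pn_eq0 _ _ _ _ 0).
apply/ler_addgt0Pr => e e0; rewrite add0r; have e2 : 0 < e / 2 by rewrite divr_gt0.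
have [r1 r10 K1] := second_difference 0 r00 e2 fi fij cij.
have [r2 r20 K2] := second_difference 0 r00 e2 fj fji cji.
pose h : R := Num.min r1 r2 / 2.
have m0 : 0 < Num.min r1 r2 by rewrite lt_min r10 r20.
have h0 : 0 < h by rewrite divr_gt0.
have hm : h < Num.min r1 r2 by rewrite /h ltr_pdivrMr//; lra.
move: hm; rewrite lt_min -{1 2}(gtr0_norm h0) => /andP[/K1 A1 /K2 A2].
have := le_trans (pnB _ _ _) (lerD A2 A1).
rewrite [x + h *: delta_mx ord0 j + _]addrAC (gtr0_norm h0).
set a := f (x + _ + _); set b := f (x + h *: delta_mx _ j); set c := f (x + _); set d := f x.
have -> : (a - b - (c - d) - (h ^+ 2)%:C *: gji x) - (a - c - (b - d) - (h ^+ 2)%:C *: gij x) =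
  (h ^+ 2)%:C *: (gij x - gji x) by cinf_ring.
rewrite pnZ normc_real ger0_norm ?sqr_ge0// => L.
have h20 : 0 < h ^+ 2 by rewrite exprn_gt0.
by rewrite -(ler_pM2l h20); apply: (le_trans L); lra.
Qed.

End DirectionalDerivatives.

(** * Systems of iterated partial derivatives *)

Section Jets.
Variables (R : realType) (n : nat) (theta : 'M[R]_n) (T : nctorus theta).
Implicit Types (f g : 'rV[R]_n -> Cinf T) (x y v : 'rV[R]_n) (u w : Cinf T) (s : seq 'I_n).
Implicit Types (V : set 'rV[R]_n).
Local Notation e_ j := (delta_mx ord0 j : 'rV[R]_n).

(* Derivatives are indexed by words rather than multi-indices; by Clairaut's theorem they depend
   only on the number of occurrences of each letter. *)
Definition D s f : 'rV[R]_n -> Cinf T := foldr (@pderiv _ _ _ T) f s.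

Definition isopen V := forall x, V x -> exists2 r : R, 0 < r & forall y, `|y - x| < r -> V y.

Lemma isopenT : isopen setT.
Proof. by move=> x _; exists 1. Qed.

Lemma isopen_neq0 : isopen [set x | x != 0].
Proof.
move=> x /= x0; exists `|x|; first by rewrite normr_gt0.
by move=> y yx; apply: contraTneq yx => ->; rewrite sub0r normrN ltxx.
Qed.

Lemma pderivE j f x w : has_dd (e_ j) f x w -> pderiv j f x = w.
Proof.
move=> fw; rewrite /pderiv; case: xgetP => [y _ /= /has_pderivP fy|/(_ w)].
  exact: has_cd_unique fy fw.
by move=> /= H; case: H; apply/has_pderivP.
Qed.

Lemma pderiv_spec j f x w : has_dd (e_ j) f x w -> has_dd (e_ j) f x (pderiv j f x).
Proof. by move=> fw; rewrite (pderivE fw). Qed.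

(** A system of candidates for the iterated derivatives. As [pderiv] is a choice with default 0,
    smoothness is proved by exhibiting such a system: see [jet_D] and [jet_smooth]. *)
Definition jet V (F : seq 'I_n -> 'rV[R]_n -> Cinf T) := forall s x, V x ->
  cont_at (F s) x /\ forall j, has_dd (e_ j) (F s) x (F (j :: s) x).

Lemma smooth_onP V f : smooth_on V f <-> jet V (fun s => D s f).
Proof.
split=> H s x Vx; have := H s x Vx => /=.
  move=> [/cont_atP c d]; split; first exact: c.
  by move=> j; have [w /has_pderivP fw] := d j; exact: pderiv_spec fw.
move=> [c d]; split; first by apply/cont_atP.
by move=> j; exists (D (j :: s) f x); apply/has_pderivP; exact: d.
Qed.

Lemma eq_D V f g : isopen V -> (forall x, V x -> f x = g x) ->
  forall s x, V x -> D s f x = D s g x.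
Proof.
move=> oV fg; elim=> [|j s IH] x Vx; first exact: fg.
have [r r0 Vr] := oV x Vx.
rewrite /= /pderiv; congr xget; apply/funext => l; apply/propext.
split=> /has_pderivP H; apply/has_pderivP.
  by apply: has_dd_ext r0 _ H => y /Vr; exact: IH.
by apply: has_dd_ext r0 _ H => y /Vr Vy; rewrite IH.
Qed.

Lemma jet_D V F f : isopen V -> jet V F -> (forall x, V x -> f x = F [::] x) ->
  forall s x, V x -> D s f x = F s x.
Proof.
move=> oV jF fF; elim=> [|j s IH] x Vx; first exact: fF.
have [r r0 Vr] := oV x Vx; apply: pderivE.
apply: (@has_dd_ext _ _ _ _ _ (F s) _ _ _ r r0) => [y /Vr Vy|]; first exact/esym/IH.
by have [_] := jF s x Vx.
Qed.

Lemma jet_smooth V F f : isopen V -> jet V F -> (forall x, V x -> f x = F [::] x) ->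
  smooth_on V f.
Proof.
move=> oV jF fF; have E := jet_D oV jF fF; apply/smooth_onP => s x Vx.
have [r r0 Vr] := oV x Vx; have [c d] := jF s x Vx; split.
  by apply: cont_at_ext r0 _ c => y /Vr Vy; rewrite E.
move=> j; rewrite E//; apply: has_dd_ext r0 _ (d j) => y /Vr Vy; by rewrite E.
Qed.

Lemma smooth_onS V W f : V `<=` W -> smooth_on W f -> smooth_on V f.
Proof. by move=> VW fW s x /VW; exact: fW. Qed.

Lemma D_swap V f i j s x : isopen V -> smooth_on V f -> V x ->
  D (i :: j :: s) f x = D (j :: i :: s) f x.
Proof.
move=> oV /smooth_onP jf Vx; have [r r0 Vr] := oV x Vx.
apply: (@clairaut _ _ _ _ j i (D s f) (D (j :: s) f) (D (i :: s) f)
  (D (i :: j :: s) f) (D (j :: i :: s) f) x r r0) => [y /Vr Vy|y /Vr Vy|y /Vr Vy|y /Vr Vy||].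
- by have [_] := jf s y Vy.
- by have [_] := jf s y Vy.
- by have [_] := jf (j :: s) y Vy.
- by have [_] := jf (i :: s) y Vy.
- by have [] := jf (i :: j :: s) x Vx.
- by have [] := jf (j :: i :: s) x Vx.
Qed.

Lemma D_cons_eq V f s s' j x : isopen V -> V x ->
  (forall y, V y -> D s f y = D s' f y) -> D (j :: s) f x = D (j :: s') f x.
Proof. by move=> oV Vx H; exact: (eq_D oV H [:: j] Vx). Qed.

(** Adjacent swaps bring any letter of s' to the front; induction on the word then matches the
    rest. *)
Lemma D_perm V f s s' : isopen V -> smooth_on V f -> perm_eq s s' ->
  forall x, V x -> D s f x = D s' f x.
Proof.
move=> oV sf.
have mid j s1 s2 x : V x -> D (s1 ++ j :: s2) f x = D (j :: s1 ++ s2) f x.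
  elim: s1 x => [//|i s1 IH] x Vx; rewrite cat_cons.
  have -> := @D_cons_eq V f (s1 ++ j :: s2) (j :: s1 ++ s2) i x oV Vx IH.
  exact: (D_swap _ _ _ oV sf Vx).
elim: s s' => [|j s IH] s' pe x Vx.
  by rewrite perm_sym in pe; rewrite (perm_nilP pe).
have js' : j \in s' by rewrite -(perm_mem pe) mem_head.
case/splitPr: js' pe => s1 s2 pe.
rewrite mid//; apply: (D_cons_eq _ oV Vx) => y Vy; apply: IH => //.
by rewrite -(perm_cons j) (permPl pe) -[j :: s2]cat1s perm_catCA.
Qed.

(** The letters follow the enumeration used by [miter], so that [miterE] involves no commutation of
    derivatives. *)
Definition word (b : 'I_n -> nat) : seq 'I_n := flatten [seq nseq (b j) j | j <- enum 'I_n].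

Lemma miterE b f : miter (@pderiv _ _ _ T) b f = D (word b) f.
Proof.
rewrite /miter /D /word; elim: (enum 'I_n) => [//|j s IH] /=.
rewrite foldr_cat -IH; elim: (b j) => [//|p IHp] /=.
by rewrite IHp.
Qed.

Lemma count_word b j : count_mem j (word b) = b j.
Proof.
rewrite /word count_flatten -map_comp sumnE big_map big_enum/= (bigD1 j)//= count_nseq /= eqxx mul1n.
rewrite big1 ?addn0// => i /negbTE ij.
by rewrite count_nseq /= ij.
Qed.

Lemma size_word b : size (word b) = mord_size b.
Proof.
rewrite /word size_flatten /shape -map_comp sumnE big_map big_enum/=.
by apply: eq_bigr => j _ /=; rewrite size_nseq.
Qed.

Lemma perm_word s : perm_eq s (word (fun j => count_mem j s)).
Proof. by apply/allP => j _ /=; rewrite count_word. Qed.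

Lemma size_count_word s : mord_size (fun j => count_mem j s) = size s.
Proof. by rewrite -size_word; apply/esym/perm_size/perm_word. Qed.

Lemma D_miter V f s x : isopen V -> smooth_on V f -> V x ->
  D s f x = miter (@pderiv _ _ _ T) (fun j => count_mem j s) f x.
Proof. by move=> oV sf Vx; rewrite miterE; apply: (D_perm oV sf (perm_word s) Vx). Qed.

Lemma D_cat s s' f : D s (D s' f) = D (s ++ s') f.
Proof. by rewrite /D foldr_cat. Qed.

Lemma smooth_on_D V f s : smooth_on V f -> smooth_on V (D s f).
Proof.
move=> /smooth_onP jf; apply/smooth_onP => s' x Vx; rewrite D_cat.
have [c d] := jf (s' ++ s) x Vx; split; first exact: c.
by move=> j; rewrite D_cat; exact: (d j).
Qed.

Lemma cont_atD f g x : cont_at f x -> cont_at g x -> cont_at (fun y => f y + g y) x.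
Proof.
move=> cf cg m e e0; have e2 : 0 < e / 2 by rewrite divr_gt0.
have [r1 r10 K1] := cf m _ e2; have [r2 r20 K2] := cg m _ e2.
exists (Num.min r1 r2); first by rewrite lt_min r10 r20.
move=> y; rewrite lt_min => /andP[/K1 h1 /K2 h2].
have -> : f y + g y - (f x + g x) = (f y - f x) + (g y - g x) by cinf_ring.
by apply: (le_trans (pnD _ _ _)); rewrite (splitr e); exact: lerD.
Qed.

Lemma cont_atZ (c : R[i]) f x : cont_at f x -> cont_at (fun y => c *: f y) x.
Proof.
move=> cf m e e0; have c0 : 0 < 1 + normc c by rewrite ltr_pwDl// normc_ge0.
have [r r0 K] := cf m _ (divr_gt0 e0 c0); exists r; first exact: r0.
move=> y /K; rewrite -scalerBr pnZ ler_pdivlMr// mulrC; apply: le_trans.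
by rewrite ler_wpM2r ?pn_ge0// lerDr.
Qed.

Lemma cont_at_cst u x : cont_at (fun=> u) x.
Proof. by move=> m e e0; exists 1 => // y _; rewrite subrr pn0 ltW. Qed.

Lemma has_ddD v f g x u w : has_dd v f x u -> has_dd v g x w ->
  has_dd v (fun y => f y + g y) x (u + w).
Proof.
move=> /has_ddP H1 /has_ddP H2; apply/has_ddP => m e e0; have e2 : 0 < e / 2 by rewrite divr_gt0.
have [r1 r10 K1] := H1 m _ e2; have [r2 r20 K2] := H2 m _ e2.
exists (Num.min r1 r2); first by rewrite lt_min r10 r20.
move=> h; rewrite lt_min => /andP[/K1 h1 /K2 h2].
have -> : f (x + h *: v) + g (x + h *: v) - (f x + g x) - h%:C *: (u + w) =
  (f (x + h *: v) - f x - h%:C *: u) + (g (x + h *: v) - g x - h%:C *: w) by cinf_ring.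
apply: (le_trans (pnD _ _ _)); rewrite (splitr e) mulrDl; exact: lerD.
Qed.

Lemma has_ddZl (c : R[i]) v f x u : has_dd v f x u -> has_dd v (fun y => c *: f y) x (c *: u).
Proof.
move=> /has_ddP H; apply/has_ddP => m e e0; have c0 : 0 < 1 + normc c by rewrite ltr_pwDl// normc_ge0.
have [r r0 K] := H m _ (divr_gt0 e0 c0); exists r; first exact: r0.
move=> h /K.
have -> : c *: f (x + h *: v) - c *: f x - h%:C *: (c *: u) =
  c *: (f (x + h *: v) - f x - h%:C *: u) by cinf_ring.
rewrite pnZ mulrAC ler_pdivlMr// mulrC; apply: le_trans.
by rewrite ler_wpM2r ?pn_ge0// lerDr.
Qed.

Lemma has_dd_cst v u x : has_dd v (fun=> u) x 0.
Proof. exact: has_cd_cst. Qed.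

Lemma has_dd_sum (I : Type) (q : seq I) v (F : I -> 'rV[R]_n -> Cinf T) (G : I -> Cinf T) x :
  (forall i, has_dd v (F i) x (G i)) ->
  has_dd v (fun y => \sum_(i <- q) F i y) x (\sum_(i <- q) G i).
Proof.
move=> H; elim: q => [|i q IH].
  have -> : (fun y => \sum_(i <- [::]) F i y) = (fun=> 0) by apply/funext => y; rewrite big_nil.
  by rewrite big_nil; exact: has_dd_cst.
have -> : (fun y => \sum_(i <- i :: q) F i y) = (fun y => F i y + \sum_(i <- q) F i y).
  by apply/funext => y; rewrite big_cons.
by rewrite big_cons; exact: has_ddD.
Qed.

Lemma cont_at_sum (I : Type) (q : seq I) (F : I -> 'rV[R]_n -> Cinf T) x :
  (forall i, cont_at (F i) x) -> cont_at (fun y => \sum_(i <- q) F i y) x.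
Proof.
move=> H; elim: q => [|i q IH].
  have -> : (fun y => \sum_(i <- [::]) F i y) = (fun=> 0) by apply/funext => y; rewrite big_nil.
  exact: cont_at_cst.
have -> : (fun y => \sum_(i <- i :: q) F i y) = (fun y => F i y + \sum_(i <- q) F i y).
  by apply/funext => y; rewrite big_cons.
exact: cont_atD.
Qed.

Lemma jet_sum (I : Type) (q : seq I) V (F : I -> seq 'I_n -> 'rV[R]_n -> Cinf T) :
  (forall i, jet V (F i)) -> jet V (fun s y => \sum_(i <- q) F i s y).
Proof.
move=> H s x Vx; split; first by apply: cont_at_sum => i; have [] := H i s x Vx.
by move=> j; apply: has_dd_sum => i; have [] := H i s x Vx.
Qed.

Lemma jetZ (c : R[i]) V (F : seq 'I_n -> 'rV[R]_n -> Cinf T) :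
  jet V F -> jet V (fun s y => c *: F s y).
Proof.
move=> H s x Vx; have [a b] := H s x Vx; split; first exact: cont_atZ.
by move=> j; apply: has_ddZl.
Qed.

Lemma jetD V (F G : seq 'I_n -> 'rV[R]_n -> Cinf T) :
  jet V F -> jet V G -> jet V (fun s y => F s y + G s y).
Proof.
move=> H K s x Vx; have [a b] := H s x Vx; have [c d] := K s x Vx; split; first exact: cont_atD.
by move=> j; apply: has_ddD.
Qed.

Lemma smooth_onD V f g : isopen V -> smooth_on V f -> smooth_on V g ->
  smooth_on V (fun y => f y + g y) /\
  forall s x, V x -> D s (fun y => f y + g y) x = D s f x + D s g x.
Proof.
move=> oV /smooth_onP jf /smooth_onP jg; split; first by apply: jet_smooth oV (jetD jf jg) _.
by apply: jet_D oV (jetD jf jg) _.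
Qed.

Lemma smooth_onZ (c : R[i]) V f : isopen V -> smooth_on V f ->
  smooth_on V (fun y => c *: f y) /\ forall s x, V x -> D s (fun y => c *: f y) x = c *: D s f x.
Proof.
move=> oV /smooth_onP jf; split; first by apply: jet_smooth oV (jetZ c jf) _.
by apply: jet_D oV (jetZ c jf) _.
Qed.

Lemma smooth_onB V f g : isopen V -> smooth_on V f -> smooth_on V g ->
  smooth_on V (fun y => f y - g y) /\
  forall s x, V x -> D s (fun y => f y - g y) x = D s f x - D s g x.
Proof.
move=> oV sf sg; have [sN DN] := smooth_onZ (-1) oV sg.
have [sD DD] := smooth_onD oV sf sN.
have E : (fun y => f y - g y) = (fun y => f y + -1 *: g y).
  by apply/funext => y; rewrite scaleN1r.
rewrite E; split; first exact: sD.
by move=> s x Vx; rewrite (DD s x Vx) (DN s x Vx) scaleN1r.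
Qed.

Lemma smooth_on_sum (I : Type) (q : seq I) V (F : I -> 'rV[R]_n -> Cinf T) : isopen V ->
  (forall i, smooth_on V (F i)) ->
  smooth_on V (fun y => \sum_(i <- q) F i y) /\
  forall s x, V x -> D s (fun y => \sum_(i <- q) F i y) x = \sum_(i <- q) D s (F i) x.
Proof.
move=> oV H; have jF i : jet V (fun s => D s (F i)) by apply/smooth_onP.
split; first by apply: jet_smooth oV (jet_sum q jF) _.
by apply: jet_D oV (jet_sum q jF) _.
Qed.

(** The vector v is written in the canonical basis and the directions are added one at a time by
    [has_dd_add], which consumes the continuity of the partial derivatives. *)
Lemma smooth_dd V f v s x : isopen V -> smooth_on V f -> V x ->
  has_dd v (D s f) x (\sum_(j < n) (v ord0 j)%:C *: D (j :: s) f x).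
Proof.
move=> oV /smooth_onP jf Vx; have [r r0 Vr] := oV x Vx.
have {1}-> : v = \sum_(j < n) v ord0 j *: e_ j by exact: row_sum_delta.
elim: (index_enum 'I_n) => [|j q IH]; first by rewrite !big_nil; exact: has_dd0.
rewrite !big_cons [X in has_dd X _ _ _]addrC [X in has_dd _ _ _ X]addrC.
apply: (@has_dd_add _ _ _ _ _ _ _ (fun y => (v ord0 j)%:C *: D (j :: s) f y) x _ r r0 IH).
  by move=> y /Vr Vy; apply: has_ddZ; have [_] := jf s y Vy.
by apply: cont_atZ; have [] := jf (j :: s) x Vx.
Qed.

End Jets.

Lemma common_bound (R : realType) (I : eqType) (L : seq I) (Q : I -> R -> nat -> R -> Prop) :
  (forall i A A' M M' d d', 0 <= A -> A <= A' -> (M <= M')%N -> d' <= d -> Q i A M d -> Q i A' M' d') ->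
  (forall i, exists A M d, [/\ 0 <= A, 0 < d & Q i A M d]) ->
  exists A M d, [/\ 0 <= A, 0 < d & forall i, i \in L -> Q i A M d].
Proof.
move=> mono ex; elim: L => [|i L [A [M [d [A0 d0 H]]]]].
  by exists 0, 0%N, 1; split.
have [B [N [c [B0 c0 Hi]]]] := ex i.
exists (A + B), (M + N)%N, (Num.min d c); split; [exact: addr_ge0|by rewrite lt_min d0 c0|].
move=> j; rewrite inE => /predU1P[->|jL].
  by apply: mono Hi => //; rewrite ?lerDr ?leq_addl ?ge_min ?lexx ?orbT.
by apply: mono (H j jL) => //; rewrite ?lerDl ?leq_addr ?ge_min ?lexx.
Qed.

(** * Differentiation of twisted sums *)

Section Leibniz.
Variables (R : realType) (n : nat) (theta : 'M[R]_n) (T : nctorus theta).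
Implicit Types (x y v : 'rV[R]_n) (s : seq 'I_n) (k : 'rV[int]_n).
Local Notation e_ j := (delta_mx ord0 j : 'rV[R]_n).

(* The terms of the Leibniz formula for the derivative along the word s. *)
Fixpoint splits s : seq (seq 'I_n * seq 'I_n) :=
  if s is j :: s' then
    [seq (j :: p.1, p.2) | p <- splits s'] ++ [seq (p.1, j :: p.2) | p <- splits s']
  else [:: ([::], [::])].

Lemma splits_size s p : p \in splits s -> (size p.1 + size p.2)%N = size s.
Proof.
elim: s p => [|j s IH] p /=; first by rewrite inE => /eqP ->.
by rewrite mem_cat => /orP[] /mapP[q /IH <- ->] /=; rewrite ?addnS.
Qed.

Variables (V : set 'rV[R]_n) (oV : isopen V).
Variables (r : 'rV[int]_n -> 'rV[R]_n -> Cinf T) (sg : 'rV[R]_n -> Cinf T).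

(** Temperedness locally uniform in x, for all derivatives: this is what allows limits in x to pass
    under the sum over k. *)
Definition loctame := forall s m x, V x -> exists A M d, [/\ 0 <= A, 0 < d &
  forall y, `|y - x| < d -> forall k, pn m (D s (r k) y) <= A * wt R k ^+ M].

Hypotheses (sr : forall k, smooth_on V (r k)) (lr : loctame) (ss : smooth_on V sg).

Lemma loctame_tempered s x : V x -> tempered (fun k => D s (r k) x).
Proof.
move=> Vx m; have [A [M [d [_ d0 H]]]] := lr s m Vx; exists A, M => k.
by apply: H; rewrite subrr normr0.
Qed.

(** The mean value inequality along the segment from x to y, the n partial derivatives having a
    common polynomial bound in k. *)
Lemma loctame_lip s m x : V x -> exists A M d, [/\ 0 <= A, 0 < d &
  forall y, `|y - x| < d -> V y /\
  forall k, pn m (D s (r k) y - D s (r k) x) <= `|y - x| * (A * wt R k ^+ M)].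
Proof.
move=> Vx; have [r0 r00 Vr] := oV Vx.
have [|j|A [M [d [A0 d0 H]]]] := @common_bound R 'I_n (enum 'I_n)
    (fun j A M d => forall y, `|y - x| < d -> forall k, pn m (D (j :: s) (r k) y) <= A * wt R k ^+ M).
- move=> j A A' M M' d d' A0 AA MM dd H y yd k; apply: (le_trans (H y (lt_le_trans yd dd) k)).
  by rewrite ler_pM ?wtX_ge0// ler_weXn2l ?wt_ge1.
- exact: lr.
exists (2 * (n%:R * A)), M, (Num.min d r0); split; first by rewrite !mulr_ge0.
  by rewrite lt_min d0 r00.
move=> y; rewrite lt_min => /andP[yd yr]; split; first exact: Vr.
move=> k; have E : D s (r k) y - D s (r k) x = D s (r k) (x + (y - x)) - D s (r k) x - 0.
  have xy : x + (y - x) = y by rewrite addrC subrK.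
  by rewrite subr0 xy.
have pt t : 0 <= t <= 1 -> `|x + t *: (y - x) - x| <= `|y - x|.
  move=> /andP[t0 t1]; rewrite addrKl mx_normZ (ger0_norm t0).
  by rewrite -[leRHS]mul1r ler_wpM2r.
rewrite E; have -> : `|y - x| * (2 * (n%:R * A) * wt R k ^+ M) = 2 * (`|y - x| * (n%:R * (A * wt R k ^+ M))).
  by ring.
apply: (@dd_mvt _ _ _ _ _ _ _ (fun t => \sum_(j < n) ((y - x) ord0 j)%:C *: D (j :: s) (r k) (x + t *: (y - x)))).
  move=> t t01; apply: (smooth_dd (y - x) s oV (sr k)); apply: Vr.
  exact: le_lt_trans (pt t t01) yr.
move=> t t01; rewrite subr0; apply: (le_trans (pn_sum _ _ _ _)).
apply: (@le_trans _ _ (\sum_(j < n) `|y - x| * (A * wt R k ^+ M))).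
  apply: ler_sum => j _; rewrite pnZ normc_real ler_pM ?pn_ge0//; first exact: ler_coord_norm.
  by apply: H; [rewrite mem_enum|exact: le_lt_trans (pt t t01) yd].
by rewrite sumr_const card_ord -[leLHS]mulr_natl mulrCA.
Qed.

Lemma cont_at_bound f m x : @cont_at _ _ _ T f x -> exists2 d : R, 0 < d &
  forall y, `|y - x| < d -> pn m (f y) <= pn m (f x) + 1.
Proof.
move=> /(_ m 1 ltr01)[d d0 H]; exists d; first exact: d0.
move=> y /H K; have -> : f y = (f y - f x) + f x by cinf_ring.
by apply: (le_trans (pnD _ _ _)); rewrite addrC lerD2l.
Qed.

Definition tprod s1 s2 y : Cinf T := tcomp (fun k => D s1 (r k) y) (D s2 sg y).

Lemma cont_at_tprod s1 s2 x : V x -> cont_at (tprod s1 s2) x.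
Proof.
move=> Vx m e e0.
have [A [M [d [A0 d0 HA]]]] := loctame_lip s1 m Vx.
have tx := loctame_tempered s1 Vx.
have [B [N [B0 HB]]] := tempered_ge0 m tx.
have cs : cont_at (D s2 sg) x by have [] := (smooth_onP V sg).1 ss s2 x Vx.
have [d1 d10 H1] := cont_at_bound (m + M + 2 * n) cs.
pose C1 := A * (4 ^+ n * (pn (m + M + 2 * n) (D s2 sg x) + 1)).
have C10 : 0 <= C1 by rewrite !mulr_ge0 ?exprn_ge0 ?addr_ge0 ?pn_ge0.
pose C2 := B * 4 ^+ n.
have C20 : 0 <= C2 by rewrite mulr_ge0 ?exprn_ge0.
have e2 : 0 < e / 2 by rewrite divr_gt0.
have C1p : 0 < C1 + 1 by rewrite ltr_wpDl.
have C2p : 0 < C2 + 1 by rewrite ltr_wpDl.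
have [d2 d20 H2] := cs (m + N + 2 * n)%N _ (divr_gt0 e2 C2p).
exists (Num.min (Num.min d d1) (Num.min d2 (e / 2 / (C1 + 1)))).
  by rewrite !lt_min d0 d10 d20 !divr_gt0.
move=> y; rewrite !lt_min => /andP[/andP[yd yd1] /andP[yd2 yd3]].
have [Vy HA'] := HA y yd; have ty := loctame_tempered s1 Vy.
have -> : tprod s1 s2 y - tprod s1 s2 x =
   tcomp (fun k => D s1 (r k) y - D s1 (r k) x) (D s2 sg y) +
   tcomp (fun k => D s1 (r k) x) (D s2 sg y - D s2 sg x).
  rewrite /tprod.
  rewrite (tcompBl (D s2 sg y) ty tx).
  rewrite (tcompBr (D s2 sg y) (D s2 sg x) tx).
  move: (tcomp _ _) (tcomp _ _) (tcomp _ _) => a b c.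
  cinf_ring.
apply: (le_trans (pnD _ _ _)); rewrite (splitr e); apply: lerD.
  have K k : pn m (D s1 (r k) y - D s1 (r k) x) <= (`|y - x| * A) * wt R k ^+ M.
    by rewrite -mulrA; exact: HA'.
  have yA : 0 <= `|y - x| * A by rewrite mulr_ge0.
  apply: (le_trans (pn_tcomp (D s2 sg y) (temperedB ty tx) yA K)).
  apply: (@le_trans _ _ (`|y - x| * C1)).
    by rewrite -mulrA ler_wpM2l// ler_wpM2l// ler_wpM2l ?exprn_ge0// H1.
  move: (ltW yd3); rewrite ler_pdivlMr// => Q; apply: le_trans Q.
  by rewrite ler_wpM2l// lerDl.
apply: (le_trans (pn_tcomp _ tx B0 HB)).
rewrite mulrA -/C2; have := H2 y yd2; rewrite ler_pdivlMr// mulrC; apply: le_trans.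
by rewrite ler_wpM2r ?pn_ge0// lerDl.
Qed.

(** The error of the product rule has three parts: the first-order error of r against sg(y),
    quadratic in h with polynomial growth in k; h times the derivative of r against the increment of
    sg; r(x) against the first-order error of sg. Each receives e / 3. *)
Lemma has_dd_tprod j s1 s2 x : V x ->
  has_dd (e_ j) (tprod s1 s2) x (tprod (j :: s1) s2 x + tprod s1 (j :: s2) x).
Proof.
move=> Vx; apply/has_ddP => m e e0.
have [A [M [d [A0 d0 HA]]]] := loctame_lip (j :: s1) m Vx.
have tx := loctame_tempered s1 Vx; have tjx := loctame_tempered (j :: s1) Vx.
have [B [N [B0 HB]]] := tempered_ge0 m tx.
have [B' [N' [B'0 HB']]] := tempered_ge0 m tjx.
have [cs ds] := (smooth_onP V sg).1 ss s2 x Vx.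
have [d1 d10 H1] := cont_at_bound (m + M + 2 * n) cs.
pose C1 := 2 * (A * (4 ^+ n * (pn (m + M + 2 * n) (D s2 sg x) + 1))).
have C10 : 0 <= C1 by rewrite !mulr_ge0 ?exprn_ge0 ?addr_ge0 ?pn_ge0.
pose C2 := B * 4 ^+ n.
have C20 : 0 <= C2 by rewrite mulr_ge0 ?exprn_ge0.
pose C3 := B' * 4 ^+ n.
have C30 : 0 <= C3 by rewrite mulr_ge0 ?exprn_ge0.
have e3 : 0 < e / 3 by rewrite divr_gt0.
have C1p : 0 < C1 + 1 by rewrite ltr_wpDl.
have C2p : 0 < C2 + 1 by rewrite ltr_wpDl.
have C3p : 0 < C3 + 1 by rewrite ltr_wpDl.
have [d2 d20 H2] := (has_ddP _ _ _ _).1 (ds j) (m + N + 2 * n)%N _ (divr_gt0 e3 C2p).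
have [d3 d30 H3] := cs (m + N' + 2 * n)%N _ (divr_gt0 e3 C3p).
have ej : `|e_ j| <= 1.
  apply: ler_norm_coord => // l.
  by rewrite mxE; case: (_ && _); rewrite /= ?normr1 ?normr0 ?ler01.
exists (Num.min (Num.min d d1) (Num.min (Num.min d2 d3) (e / 3 / (C1 + 1)))).
  by rewrite !lt_min d0 d10 d20 d30 !divr_gt0.
move=> h; rewrite !lt_min => /andP[/andP[hd hd1] /andP[/andP[hd2 hd3] hd4]].
have pt t : 0 <= t <= 1 -> `|x + t *: (h *: e_ j) - x| <= `|h|.
  move=> /andP[t0 t1]; rewrite addrKl !mx_normZ (ger0_norm t0).
  rewrite -[leRHS]mul1r ler_pM// ?mulr_ge0// ler_piMr//.
have p1 : `|x + h *: e_ j - x| <= `|h|.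
  have z : 0 <= (1 : R) <= 1 by rewrite ler01 lexx.
  by have := pt 1 z; rewrite (scale1r (h *: e_ j)).
set y := x + h *: e_ j in p1 *.
have [Vy _] := HA y (le_lt_trans p1 hd); have ty := loctame_tempered s1 Vy.
have thx := temperedZ h%:C tjx.
have -> : tprod s1 s2 y - tprod s1 s2 x - h%:C *: (tprod (j :: s1) s2 x + tprod s1 (j :: s2) x) =
   tcomp (fun k => D s1 (r k) y - D s1 (r k) x - h%:C *: D (j :: s1) (r k) x) (D s2 sg y) +
   (h%:C *: tcomp (fun k => D (j :: s1) (r k) x) (D s2 sg y - D s2 sg x) +
    tcomp (fun k => D s1 (r k) x) (D s2 sg y - D s2 sg x - h%:C *: D (j :: s2) sg x)).
  rewrite (tcompBl _ (temperedB ty tx) thx) (tcompBl _ ty tx) (tcompZl _ _ tjx).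
  by rewrite !(tcompBr _ _ tjx) !(tcompBr _ _ tx) (tcompZr _ _ tx) /tprod; cinf_ring.
have -> : e * `|h| = e / 3 * `|h| + (e / 3 * `|h| + e / 3 * `|h|) by field.
apply: (le_trans (pnD _ _ _)); apply: lerD; last first.
  apply: (le_trans (pnD _ _ _)); apply: lerD.
    rewrite pnZ normc_real mulrC ler_wpM2r//.
    apply: (le_trans (pn_tcomp _ tjx B'0 HB')).
    rewrite mulrA -/C3; have := H3 y (le_lt_trans p1 hd3); rewrite ler_pdivlMr// mulrC; apply: le_trans.
    by rewrite ler_wpM2r ?pn_ge0// lerDl.
  apply: (le_trans (pn_tcomp _ tx B0 HB)).
  rewrite mulrA -/C2; have := H2 h hd2; rewrite -/y mulrAC ler_pdivlMr// mulrC; apply: le_trans.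
  by rewrite ler_wpM2r ?pn_ge0// lerDl.
have K k : pn m (D s1 (r k) y - D s1 (r k) x - h%:C *: D (j :: s1) (r k) x) <=
    (`|h| * `|h| * (2 * A)) * wt R k ^+ M.
  have -> : `|h| * `|h| * (2 * A) * wt R k ^+ M = 2 * (`|h| * (`|h| * (A * wt R k ^+ M))) by ring.
  apply: (@dd_mvt _ _ _ _ _ _ _ (fun t => h%:C *: D (j :: s1) (r k) (x + t *: (h *: e_ j)))) => t t01.
    have [Vt _] := HA _ (le_lt_trans (pt t t01) hd).
    apply: has_ddZ; have [_ dk] := (smooth_onP V (r k)).1 (sr k) s1 _ Vt; exact: (dk j).
  rewrite -scalerBr pnZ normc_real ler_wpM2l//.
  have [_ Ht] := HA _ (le_lt_trans (pt t t01) hd).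
  apply: (le_trans (Ht k)); rewrite ler_wpM2r ?mulr_ge0 ?wtX_ge0//; exact: pt.
have hA : 0 <= `|h| * `|h| * (2 * A) by rewrite !mulr_ge0.
apply: (le_trans (pn_tcomp (D s2 sg y) (temperedB (temperedB ty tx) thx) hA K)).
apply: (@le_trans _ _ (`|h| * (`|h| * C1))).
  rewrite /C1 -!mulrA ler_wpM2l// ler_wpM2l// ler_wpM2l// ler_wpM2l// ler_wpM2l ?exprn_ge0//.
  exact: H1 _ (le_lt_trans p1 hd1).
rewrite [e / 3 * _]mulrC ler_wpM2l//.
move: (ltW hd4); rewrite ler_pdivlMr// => Q; apply: le_trans Q.
by rewrite ler_wpM2l// lerDl.
Qed.

(** One more derivative puts the letter j in front of the first or of the second word, which is the
    recursion of [splits]; repetition of words stands for the binomial coefficients. *)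
Lemma jet_tprod : jet V (fun s y => \sum_(p <- splits s) tprod p.1 p.2 y).
Proof.
move=> s x Vx; split; first by apply: cont_at_sum => p; exact: cont_at_tprod.
move=> j; rewrite /= big_cat !big_map /= -big_split /=.
by apply: has_dd_sum => p; exact: has_dd_tprod.
Qed.

Lemma smooth_tprod : smooth_on V (fun y => tcomp (fun k => r k y) (sg y)).
Proof.
apply: jet_smooth oV jet_tprod _ => x Vx /=.
by rewrite big_cons big_nil addr0.
Qed.

Lemma D_tprod s x : V x -> D s (fun y => tcomp (fun k => r k y) (sg y)) x =
  \sum_(p <- splits s) tcomp (fun k => D p.1 (r k) x) (D p.2 sg x).
Proof.
move=> Vx; apply: (jet_D oV jet_tprod) => // y Vy /=.
by rewrite big_cons big_nil addr0.
Qed.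

End Leibniz.

(** * Taylor expansion in terms of words *)

Section WordSums.
Variables (R : realType) (n : nat) (theta : 'M[R]_n) (T : nctorus theta).
Implicit Types (x y v : 'rV[R]_n) (s w : seq 'I_n) (k : 'rV[int]_n).
Implicit Types (c : 'I_n -> R[i]) (G : seq 'I_n -> Cinf T).

(* the sum of c_w G (w ++ s) over the words w of length i, where
   c_w is the product of the c_j over the letters of w *)
Fixpoint wsum i c G s : Cinf T :=
  if i is i'.+1 then \sum_(j < n) c j *: wsum i' c G (j :: s) else G s.

Lemma eq_wsum i c G G' s : (forall w, size w = i -> G (w ++ s) = G' (w ++ s)) ->
  wsum i c G s = wsum i c G' s.
Proof.
elim: i s => [|i IH] s H /=; first exact: (H [::]).
apply: eq_bigr => j _; congr (_ *: _); apply: IH => w wi.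
by rewrite -cat_rcons H// size_rcons wi.
Qed.

Lemma wsum_linear i c (a : R[i]) G G' s :
  wsum i c (fun w => a *: G w + G' w) s = a *: wsum i c G s + wsum i c G' s.
Proof.
elim: i s => [//|i IH] s /=.
rewrite scaler_sumr -big_split /=; apply: eq_bigr => j _; rewrite IH; cinf_ring.
Qed.

Lemma wsumZ i c (a : R[i]) G s : wsum i c (fun w => a *: G w) s = a *: wsum i c G s.
Proof.
elim: i s => [//|i IH] s /=.
by rewrite scaler_sumr; apply: eq_bigr => j _; rewrite IH; cinf_ring.
Qed.

Lemma pn_wsum i c G s m (C B : R) : 0 <= C -> (forall j, normc (c j) <= C) ->
  (forall w, size w = i -> pn m (G (w ++ s)) <= B) ->
  pn m (wsum i c G s) <= (n%:R * C) ^+ i * B.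
Proof.
move=> C0 cC; elim: i s => [|i IH] s H /=; first by rewrite expr0 mul1r; exact: (H [::]).
apply: (le_trans (pn_sum _ _ _ _)).
apply: (@le_trans _ _ (\sum_(j < n) C * ((n%:R * C) ^+ i * B))).
  apply: ler_sum => j _; rewrite pnZ ler_pM ?normc_ge0 ?pn_ge0//.
  by apply: IH => w wi; rewrite -cat_rcons H// size_rcons wi.
by rewrite sumr_const card_ord -[leLHS]mulr_natl exprS !mulrA.
Qed.

Lemma has_dd_wsum i c v (F : seq 'I_n -> 'rV[R]_n -> Cinf T) (G : seq 'I_n -> Cinf T) x s :
  (forall w, has_dd v (F w) x (G w)) ->
  has_dd v (fun y => wsum i c (fun w => F w y) s) x (wsum i c G s).
Proof.
move=> H; elim: i s => [|i IH] s /=; first exact: H.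
by apply: has_dd_sum => j; apply: has_ddZl.
Qed.

Lemma cont_at_wsum i c (F : seq 'I_n -> 'rV[R]_n -> Cinf T) x s :
  (forall w, cont_at (F w) x) -> cont_at (fun y => wsum i c (fun w => F w y) s) x.
Proof.
move=> H; elim: i s => [|i IH] s /=; first exact: H.
by apply: cont_at_sum => j; apply: cont_atZ.
Qed.

Lemma jet_wsum i c V (F : seq 'I_n -> 'rV[R]_n -> Cinf T) : jet V F ->
  jet V (fun s y => wsum i c (fun w => F (s ++ w) y) [::]).
Proof.
move=> H s x Vx; split; first by apply: cont_at_wsum => w; have [] := H (s ++ w) x Vx.
move=> j; apply: has_dd_wsum => w; have [_ d] := H (s ++ w) x Vx; exact: (d j).
Qed.

Lemma has_dd_line_wsum i v (f : 'rV[R]_n -> Cinf T) V s x : isopen V -> smooth_on V f -> V x ->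
  has_dd v (fun y => wsum i (fun j => (v ord0 j)%:C) (fun w => D w f y) s) x
    (wsum i.+1 (fun j => (v ord0 j)%:C) (fun w => D w f x) s).
Proof.
move=> oV sf Vx; elim: i s => [|i IH] s; first exact: smooth_dd oV sf Vx.
by apply: has_dd_sum => j; apply: has_ddZl; exact: IH.
Qed.

(** Along t -> x + t v the i-th derivative is a sum over all words of length i, where each
    multi-index occurs as often as it has orderings; hence 1 / i! in place of the inverse factorials
    of multi-indices. *)
Lemma line_taylor N v (f : 'rV[R]_n -> Cinf T) x m (B : R) : smooth_on setT f ->
  (forall t, 0 <= t <= 1 ->
     pn m (wsum N (fun j => (v ord0 j)%:C) (fun w => D w f (x + t *: v)) [::]) <= B) ->
  pn m (f (x + v) - \sum_(i < N) (i`!%:R^-1)%:C *: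
     wsum i (fun j => (v ord0 j)%:C) (fun w => D w f x) [::]) <= 2 * B.
Proof.
move=> sf HB.
pose g i (t : R) := wsum i (fun j => (v ord0 j)%:C) (fun w => D w f (x + t *: v)) [::].
have g0 i : g i 0 = wsum i (fun j => (v ord0 j)%:C) (fun w => D w f x) [::].
  have E : x + 0 *: v = x by rewrite scale0r addr0.
  by rewrite /g; apply: eq_wsum => w _; rewrite E.
have g1 : g 0%N 1 = f (x + v) by rewrite /g /=; congr f; rewrite scale1r.
have -> : f (x + v) - \sum_(i < N) (i`!%:R^-1)%:C *:
     wsum i (fun j => (v ord0 j)%:C) (fun w => D w f x) [::] =
   g 0%N 1 - \sum_(i < N) (i`!%:R^-1)%:C *: g i 0.
  by rewrite g1; congr (_ - _); apply: eq_bigr => i _; rewrite g0.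
apply: curve_taylor => [i t iN t01|t /HB]; last exact.
apply: (@has_dd_line _ _ _ _ v (fun y => wsum i (fun j => (v ord0 j)%:C) (fun w => D w f y) [::])).
by apply: (@has_dd_line_wsum i v f setT) => //; exact: isopenT.
Qed.

End WordSums.

(** * Uniform symbol estimates *)

Section Peetre.
Variables (R : realType) (n : nat).
Implicit Types (x y : 'rV[R]_n) (k : 'rV[int]_n).

Lemma powR_base_le (a b p : R) : 0 <= p -> 0 <= a -> a <= b -> a `^ p <= b `^ p.
Proof. by move=> p0 a0 ab; apply: ge0_ler_powR => //; rewrite nnegrE// (le_trans a0). Qed.

(** For a < 0 the inequality jap x <= jap (x + y) jap y, raised to the power - a, is rearranged. *)
Lemma peetre x y (a : R) : jap (x + y) `^ a <= jap x `^ a * jap y `^ `|a|.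
Proof.
have [a0|a0] := leP 0 a.
  rewrite ger0_norm// -powRM ?jap_ge0//.
  by apply: powR_base_le; rewrite ?jap_ge0 ?japD.
rewrite ltr0_norm// -[X in jap (x + y) `^ X]opprK -[X in jap x `^ X]opprK !(powRN _ (- a)).
have a0' : 0 <= - a by rewrite oppr_ge0 ltW.
rewrite mulrC ler_pdivlMr ?powR_gt0 ?jap_gt0// mulrC ler_pdivrMr ?powR_gt0 ?jap_gt0//.
rewrite -powRM ?jap_ge0//; apply: powR_base_le; rewrite ?jap_ge0//.
by rewrite -{1}(addrK y x) -(japN y) mulrC; apply: japD.
Qed.

Lemma powR_exp_le (x a b : R) : 1 <= x -> a <= b -> x `^ a <= x `^ b.
Proof. by move=> x1 ab; apply: ler_powR. Qed.

Lemma powR_le_expr (x a : R) (M : nat) : 1 <= x -> a <= M%:R -> x `^ a <= x ^+ M.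
Proof. by move=> x1 aM; rewrite -powR_mulrn ?(le_trans ler01)//; exact: powR_exp_le. Qed.

(** The factor t covers the points of the segment on which Taylor remainders are evaluated, and |a|
    is rounded up to a natural number in order to have polynomial growth in k. *)
Lemma peetre_wt x k (t a : R) (M : nat) : 0 <= t <= 1 -> `|a| <= M%:R ->
  jap (x + t *: int_vec R k) `^ a <= jap x `^ a * wt R k ^+ M.
Proof.
move=> /andP[t0 t1] aM; apply: (le_trans (peetre _ _ _)); rewrite ler_wpM2l ?powR_ge0//.
apply: (le_trans _ (powR_le_expr (wt_ge1 _ _) aM)); apply: powR_base_le; rewrite ?jap_ge0//.
by rewrite /wt /jap lerD2l mx_normZ ger0_norm// ler_piMl.
Qed.

End Peetre.

Lemma fin_bound (R : realType) (I : eqType) (L : seq I) (Q : I -> R -> Prop) :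
  (forall i A A', 0 <= A -> A <= A' -> Q i A -> Q i A') ->
  (forall i, i \in L -> exists A, 0 <= A /\ Q i A) ->
  exists A, 0 <= A /\ forall i, i \in L -> Q i A.
Proof.
move=> mono; elim: L => [|i L IH] ex; first by exists 0.
have [|A [A0 H]] := IH; first by move=> j jL; apply: ex; rewrite inE jL orbT.
have [|B [B0 Hi]] := ex i; first exact: mem_head.
exists (A + B); split; first exact: addr_ge0.
move=> j; rewrite inE => /predU1P[->|jL]; first by apply: mono Hi => //; rewrite lerDr.
by apply: mono (H j jL) => //; rewrite lerDl.
Qed.

(** * Classes of symbols with parameters *)

Section SymbolClasses.
Variables (R : realType) (n : nat) (theta : 'M[R]_n) (T : nctorus theta).
Implicit Types (x y v : 'rV[R]_n) (s w : seq 'I_n) (k : 'rV[int]_n) (z : R[i]).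
Implicit Types (X V : set 'rV[R]_n) (K : set R[i]) (mu nu : R[i] -> R).
Implicit Types (f g : R[i] -> 'rV[R]_n -> Cinf T) (r : R[i] -> 'rV[int]_n -> 'rV[R]_n -> Cinf T).

(* Symbol estimates of order mu z on X, uniform in the parameter z in K. *)
Definition gsymb X K mu f := forall m s, exists C, 0 <= C /\ forall z, K z ->
  forall x, X x -> pn m (D s (f z) x) <= C * jap x `^ (mu z - (size s)%:R).

(** Sequences of symbols with polynomial growth in k, uniformly in z and x: the left factors for
    which [tcomp] yields a symbol. *)
Definition ksymb X K mu r := forall m s, exists C M, 0 <= C /\ forall z, K z ->
  forall x, X x -> forall k, pn m (D s (r z k) x) <= C * wt R k ^+ M * jap x `^ (mu z - (size s)%:R).

Lemma pn_sum_bound (I : eqType) (L : seq I) X K (F : I -> R[i] -> 'rV[R]_n -> Cinf T)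
    (G : R[i] -> 'rV[R]_n -> R) m :
  (forall z x, 0 <= G z x) ->
  (forall i, i \in L -> exists C, 0 <= C /\ forall z, K z -> forall x, X x -> pn m (F i z x) <= C * G z x) ->
  exists C, 0 <= C /\ forall z, K z -> forall x, X x -> pn m (\sum_(i <- L) F i z x) <= C * G z x.
Proof.
move=> G0 ex.
have [|A [A0 H]] := @fin_bound R I L (fun i C => forall z, K z -> forall x, X x -> pn m (F i z x) <= C * G z x) _ ex.
  by move=> i A A' A0 AA H z Kz x Xx; apply: (le_trans (H z Kz x Xx)); rewrite ler_wpM2r.
exists ((size L)%:R * A); split; first by rewrite mulr_ge0.
move=> z Kz x Xx; apply: (le_trans (pn_sum _ _ _ _)).
apply: (@le_trans _ _ (\sum_(i <- L) A * G z x)).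
  by rewrite big_seq [leRHS]big_seq; apply: ler_sum => i iL; exact: H.
by rewrite big_const_seq count_predT iter_addr_0 -[leLHS]mulr_natl mulrA.
Qed.

Lemma gsymb_tcomp X V K mu nu r f : X `<=` V -> isopen V ->
  (forall z, K z -> forall k, smooth_on V (r z k)) ->
  (forall z, K z -> loctame V (r z)) ->
  (forall z, K z -> smooth_on V (f z)) ->
  ksymb X K mu r -> gsymb X K nu f ->
  gsymb X K (fun z => mu z + nu z) (fun z x => tcomp (fun k => r z k x) (f z x)).
Proof.
move=> XV oV sr lr sf kr gf m s.
have [|p ps|C [C0 HC]] := @pn_sum_bound _ (splits s) X K
    (fun p z x => tcomp (fun k => D p.1 (r z k) x) (D p.2 (f z) x))
    (fun z x => jap x `^ (mu z + nu z - (size s)%:R)) m.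
- by move=> z x; rewrite powR_ge0.
- have [A [M [A0 HA]]] := kr m p.1.
  have [B [B0 HB]] := gf (m + M + 2 * n)%N p.2.
  exists (A * (4 ^+ n * B)); split; first by rewrite !mulr_ge0 ?exprn_ge0.
  move=> z Kz x Xx; have Vx := XV _ Xx.
  have A0' : 0 <= A * jap x `^ (mu z - (size p.1)%:R) by rewrite mulr_ge0 ?powR_ge0.
  have HA' k : pn m (D p.1 (r z k) x) <= A * jap x `^ (mu z - (size p.1)%:R) * wt R k ^+ M.
    by rewrite mulrAC; exact: HA.
  apply: (le_trans (pn_tcomp _ (loctame_tempered (lr z Kz) p.1 Vx) A0' HA')).
  rewrite -(splits_size ps) natrD.
  have -> : mu z + nu z - ((size p.1)%:R + (size p.2)%:R) =
    (mu z - (size p.1)%:R) + (nu z - (size p.2)%:R) by ring.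
  have P : jap x `^ ((mu z - (size p.1)%:R) + (nu z - (size p.2)%:R)) =
      jap x `^ (mu z - (size p.1)%:R) * jap x `^ (nu z - (size p.2)%:R).
    by rewrite powRD// (gt_eqF (jap_gt0 x)) implybT.
  rewrite P {P}; have HBx := HB z Kz x Xx; move: HBx A0'.
  set a := jap x `^ (mu z - _); set b := jap x `^ (nu z - _) => HBx A0'.
  have -> : A * (4 ^+ n * B) * (a * b) = (A * a) * (4 ^+ n * (B * b)) by ring.
  by rewrite ler_wpM2l// ler_wpM2l ?exprn_ge0.
exists C; split=> // z Kz x Xx; rewrite (D_tprod oV (sr z Kz) (lr z Kz) (sf z Kz) s (XV _ Xx)).
exact: HC.
Qed.

Lemma gsymb_sum (I : eqType) (L : seq I) X V K mu (F : I -> R[i] -> 'rV[R]_n -> Cinf T) :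
  X `<=` V -> isopen V ->
  (forall i z, K z -> smooth_on V (F i z)) ->
  (forall i, i \in L -> gsymb X K mu (F i)) ->
  gsymb X K mu (fun z x => \sum_(i <- L) F i z x).
Proof.
move=> XV oV sF gF m s.
have [|i iL|C [C0 HC]] := @pn_sum_bound _ L X K (fun i z x => D s (F i z) x)
    (fun z x => jap x `^ (mu z - (size s)%:R)) m.
- by move=> z x; rewrite powR_ge0.
- exact: gF.
exists C; split=> // z Kz x Xx.
by rewrite ((smooth_on_sum L oV (fun i => sF i z Kz)).2 s x (XV _ Xx)); exact: HC.
Qed.

Lemma gsymbD X V K mu f g : X `<=` V -> isopen V ->
  (forall z, K z -> smooth_on V (f z)) -> (forall z, K z -> smooth_on V (g z)) ->
  gsymb X K mu f -> gsymb X K mu g -> gsymb X K mu (fun z x => f z x + g z x).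
Proof.
move=> XV oV sf sg gf gg m s; have [A [A0 HA]] := gf m s; have [B [B0 HB]] := gg m s.
exists (A + B); split; first exact: addr_ge0.
move=> z Kz x Xx; rewrite ((smooth_onD oV (sf z Kz) (sg z Kz)).2 s x (XV _ Xx)).
by apply: (le_trans (pnD _ _ _)); rewrite mulrDl; apply: lerD; [exact: HA|exact: HB].
Qed.

Lemma gsymbB X V K mu f g : X `<=` V -> isopen V ->
  (forall z, K z -> smooth_on V (f z)) -> (forall z, K z -> smooth_on V (g z)) ->
  gsymb X K mu f -> gsymb X K mu g -> gsymb X K mu (fun z x => f z x - g z x).
Proof.
move=> XV oV sf sg gf gg m s; have [A [A0 HA]] := gf m s; have [B [B0 HB]] := gg m s.
exists (A + B); split; first exact: addr_ge0.
move=> z Kz x Xx; rewrite ((smooth_onB oV (sf z Kz) (sg z Kz)).2 s x (XV _ Xx)).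
by apply: (le_trans (pnB _ _ _)); rewrite mulrDl; apply: lerD; [exact: HA|exact: HB].
Qed.

Lemma gsymb_mono X K mu nu f : (forall z, K z -> mu z <= nu z) ->
  gsymb X K mu f -> gsymb X K nu f.
Proof.
move=> mn gf m s; have [A [A0 HA]] := gf m s; exists A; split=> // z Kz x Xx.
apply: (le_trans (HA z Kz x Xx)); rewrite ler_wpM2l//.
by apply: powR_exp_le (jap_ge1 x) _; rewrite lerD2r mn.
Qed.

(** The equality is asked on an open V around X, since derivatives at the points of X see a
    neighbourhood, and [X1] below is closed. *)
Lemma gsymb_ext X V K mu f g : X `<=` V -> isopen V ->
  (forall z, K z -> forall x, V x -> f z x = g z x) -> gsymb X K mu f -> gsymb X K mu g.
Proof.
move=> XV oV fg gf m s; have [A [A0 HA]] := gf m s; exists A; split=> // z Kz x Xx.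
by rewrite -(eq_D oV (fg z Kz) s (XV _ Xx)); exact: HA.
Qed.

Lemma gsymbS X X' K mu f : X `<=` X' -> gsymb X' K mu f -> gsymb X K mu f.
Proof.
move=> XX gf m s; have [A [A0 HA]] := gf m s; exists A; split=> // z Kz x Xx.
by apply: HA => //; exact: XX.
Qed.

Lemma ksymbS X X' K mu r : X `<=` X' -> ksymb X' K mu r -> ksymb X K mu r.
Proof.
move=> XX gf m s; have [A [M [A0 HA]]] := gf m s; exists A, M; split=> // z Kz x Xx.
by apply: HA => //; exact: XX.
Qed.

Lemma jap_near x y : `|y - x| < 1 -> jap y <= jap x + 1.
Proof.
move=> yx; have := ler_normD x (y - x); rewrite addrC subrK /jap; lra.
Qed.

(** Locally [jap] is bounded, and as it is at least 1 its real power is bounded by a natural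
    power. *)
Lemma ksymbT_loctame K mu r z : K z -> ksymb setT K mu r -> loctame setT (r z).
Proof.
move=> Kz kr s m x _; have [C [M [C0 HC]]] := kr m s.
pose p := Num.bound `|mu z|.
exists (C * (jap x + 1) ^+ p), M, 1; split=> //.
  by rewrite mulr_ge0// exprn_ge0// addr_ge0 ?jap_ge0.
move=> y yx k; apply: (le_trans (HC z Kz y I k)); rewrite mulrAC ler_wpM2r ?wtX_ge0//.
rewrite ler_wpM2l//; apply: (@le_trans _ _ (jap y ^+ p)).
  apply: powR_le_expr (jap_ge1 y) _; apply: (@le_trans _ _ (mu z)).
    by rewrite lerBlDr lerDl.
  by apply: (le_trans (ler_norm _)); apply/ltW/archi_boundP.
by apply: lerXn2r (jap_near yx); rewrite nnegrE ?addr_ge0 ?jap_ge0.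
Qed.

Definition kcoef k (j : 'I_n) : R[i] := (int_vec R k ord0 j)%:C.

Lemma normc_kcoef k j : normc (kcoef k j) <= wt R k.
Proof. by rewrite /kcoef normc_real mxE ler_coord_wt. Qed.

Definition taylor_term i (h : 'rV[R]_n -> Cinf T) k x : Cinf T :=
  (i`!%:R^-1)%:C *: wsum i (kcoef k) (fun w => D w h x) [::].

Lemma taylor_term_smooth i h k V : isopen V -> smooth_on V h ->
  smooth_on V (taylor_term i h k) /\ forall s x, V x ->
   D s (taylor_term i h k) x = (i`!%:R^-1)%:C *: wsum i (kcoef k) (fun w => D (s ++ w) h x) [::].
Proof.
move=> oV /smooth_onP jh.
have J := jetZ (i`!%:R^-1)%:C (jet_wsum i (kcoef k) jh).
by split; [apply: jet_smooth oV J _|apply: jet_D oV J _].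
Qed.

Lemma fact_inv_le1 i : normc ((i`!%:R^-1 : R)%:C) <= 1.
Proof.
rewrite normc_real ger0_norm ?invr_ge0// invf_le1 ?ltr0n ?fact_gt0//.
by rewrite ler1n fact_gt0.
Qed.

Definition words i : seq (seq 'I_n) := [seq tval t | t <- enum {: i.-tuple 'I_n}].

Lemma mem_words i w : size w = i -> w \in words i.
Proof.
move=> wi; apply/mapP; exists (Tuple (introT eqP wi)) => //.
by rewrite mem_enum.
Qed.

(** The i derivatives lower the order by i, and the i factors k_j account for the growth (n wt
    k)^i. *)
Lemma taylor_term_ksymb i X V K mu f : X `<=` V -> isopen V ->
  (forall z, K z -> smooth_on V (f z)) -> gsymb X K mu f ->
  ksymb X K (fun z => mu z - i%:R) (fun z => taylor_term i (f z)).
Proof.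
move=> XV oV sf gf m s.
have [||C [C0 HC]] := @fin_bound R _ (words i) (fun w C => forall z, K z -> forall x, X x ->
   pn m (D (s ++ w) (f z) x) <= C * jap x `^ (mu z - (size (s ++ w))%:R)).
- by move=> w A A' A0 AA H z Kz x Xx; apply: (le_trans (H z Kz x Xx)); rewrite ler_wpM2r ?powR_ge0.
- by move=> w _; exact: gf.
exists (n%:R ^+ i * C), i; split; first by rewrite mulr_ge0 ?exprn_ge0.
move=> z Kz x Xx k; rewrite ((taylor_term_smooth i k oV (sf z Kz)).2 s x (XV _ Xx)) pnZ.
apply: (@le_trans _ _ (1 * pn m (wsum i (kcoef k) (fun w => D (s ++ w) (f z) x) [::]))).
  by rewrite ler_wpM2r ?pn_ge0// fact_inv_le1.
rewrite mul1r; apply: (le_trans (@pn_wsum _ _ _ _ i (kcoef k) _ _ m (wt R k)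
    (C * jap x `^ (mu z - i%:R - (size s)%:R)) (wt_ge0 _ _) (normc_kcoef k) _)).
  move=> w wi; rewrite cats0; apply: (le_trans (HC w (mem_words wi) z Kz x Xx)).
  by rewrite size_cat wi natrD opprD addrA addrAC.
by rewrite exprMn -!mulrA ler_wpM2l ?exprn_ge0// mulrCA.
Qed.

Lemma taylor_term_loctame i V h : isopen V -> smooth_on V h -> loctame V (taylor_term i h).
Proof.
move=> oV sh s m x Vx; have [r0 r00 Vr] := oV x Vx.
have [||A [M [d [A0 d0 H]]]] := @common_bound R _ (words i) (fun w A M d =>
   forall y, `|y - x| < d -> pn m (D (s ++ w) h y) <= A).
- by move=> w A A' M M' d d' A0 AA _ dd H y yd; apply: (le_trans (H y (lt_le_trans yd dd))).
- move=> w; have [c _] := (smooth_onP V h).1 sh (s ++ w) x Vx.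
  have [d d0 H] := cont_at_bound m c.
  by exists (pn m (D (s ++ w) h x) + 1), 0%N, d; split; [rewrite addr_ge0 ?pn_ge0|exact: d0|exact: H].
exists (n%:R ^+ i * A), i, (Num.min d r0); split; first by rewrite mulr_ge0 ?exprn_ge0.
  by rewrite lt_min d0 r00.
move=> y; rewrite lt_min => /andP[yd yr] k.
rewrite ((taylor_term_smooth i k oV sh).2 s y (Vr _ yr)) pnZ.
apply: (@le_trans _ _ (1 * pn m (wsum i (kcoef k) (fun w => D (s ++ w) h y) [::]))).
  by rewrite ler_wpM2r ?pn_ge0// fact_inv_le1.
rewrite mul1r; apply: (le_trans (@pn_wsum _ _ _ _ i (kcoef k) _ _ m (wt R k)
    A (wt_ge0 _ _) (normc_kcoef k) _)).
  by move=> w wi; rewrite cats0; exact: H (mem_words wi) y yd.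
by rewrite exprMn mulrAC.
Qed.

Definition bounded_on K mu := exists M : nat, forall z, K z -> `|mu z| <= M%:R.

Lemma shift_smooth (h : 'rV[R]_n -> Cinf T) v : smooth_on setT h ->
  smooth_on setT (fun x => h (x + v)) /\
  forall s x, D s (fun x => h (x + v)) x = D s h (x + v).
Proof.
move=> /smooth_onP jh.
have J : jet setT (fun s x => D s h (x + v)).
  move=> s x _; have [c d] := jh s (x + v) I; split.
    move=> m e e0; have [r r0 H] := c m e e0; exists r; first exact: r0.
    by move=> y yx; apply: H; rewrite opprD addrACA subrr addr0.
  move=> j; have /has_ddP H := d j; apply/has_ddP => m e e0; have [r r0 K] := H m e e0.
  exists r; first exact: r0.
  move=> t tr; have -> : x + t *: delta_mx ord0 j + v = x + v + t *: delta_mx ord0 j by rewrite addrAC.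
  exact: K.
split; first by apply: jet_smooth (@isopenT R n) J _.
by move=> s x; apply: (jet_D (@isopenT R n) J).
Qed.

(** [bounded_on] provides a single exponent of wt k for all z. *)
Lemma shift_ksymb K mu f : bounded_on K mu ->
  (forall z, K z -> smooth_on setT (f z)) -> gsymb setT K mu f ->
  ksymb setT K mu (fun z k x => f z (x + int_vec R k)).
Proof.
move=> [M HM] sf gf m s; have [C [C0 HC]] := gf m s; exists C, (M + size s)%N; split=> // z Kz x _ k.
rewrite ((shift_smooth (int_vec R k) (sf z Kz)).2 s x); apply: (le_trans (HC z Kz _ I)).
rewrite -mulrA ler_wpM2l// mulrC -{1}[int_vec R k]scale1r; apply: peetre_wt; first by rewrite ler01 lexx.
by apply: (le_trans (ler_normB _ _)); rewrite natrD lerD ?HM// ger0_norm.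
Qed.

Definition taylor_rem N (h : 'rV[R]_n -> Cinf T) k x : Cinf T :=
  h (x + int_vec R k) - \sum_(i < N) taylor_term i h k x.

Lemma taylor_rem_smooth N h k : smooth_on setT h -> smooth_on setT (taylor_rem N h k) /\
  forall s x, D s (taylor_rem N h k) x =
    D s h (x + int_vec R k) - \sum_(i < N) (i`!%:R^-1)%:C *: wsum i (kcoef k) (fun w => D (s ++ w) h x) [::].
Proof.
move=> sh; have [s1 D1] := shift_smooth (int_vec R k) sh.
have st i := taylor_term_smooth i k (@isopenT R n) sh.
have [s2 D2] := smooth_on_sum (index_enum 'I_N) (@isopenT R n) (fun i : 'I_N => (st i).1).
have [s3 D3] := smooth_onB (@isopenT R n) s1 s2.
split; first exact: s3.
move=> s x; rewrite (D3 s x I) D1 (D2 s x I); congr (_ - _); apply: eq_bigr => i _.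
exact: (st i).2.
Qed.

(** A derivative of the remainder is the remainder of the derivative, so [line_taylor] applies to D
    s f; [D_perm] reconciles the words s ++ w and w ++ s. *)
Lemma taylor_rem_ksymb N K mu f : bounded_on K mu ->
  (forall z, K z -> smooth_on setT (f z)) -> gsymb setT K mu f ->
  ksymb setT K (fun z => mu z - N%:R) (fun z => taylor_rem N (f z)).
Proof.
move=> [M HM] sf gf m s.
have [||C [C0 HC]] := @fin_bound R _ (words N) (fun w C => forall z, K z -> forall x, setT x ->
   pn m (D (w ++ s) (f z) x) <= C * jap x `^ (mu z - (size (w ++ s))%:R)).
- by move=> w A A' A0 AA H z Kz x Xx; apply: (le_trans (H z Kz x Xx)); rewrite ler_wpM2r ?powR_ge0.
- by move=> w _; exact: gf.
(* N powers of wt k come from the increments in the remainder, the others from Peetre's inequality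
   with an exponent of modulus at most M + N + |s|. *)
exists (2 * (n%:R ^+ N * C)), (N + (M + (N + size s)))%N; split; first by rewrite !mulr_ge0 ?exprn_ge0.
move=> z Kz x _ k; rewrite (taylor_rem_smooth N k (sf z Kz)).2.
have -> : \sum_(i < N) (i`!%:R^-1)%:C *: wsum i (kcoef k) (fun w => D (s ++ w) (f z) x) [::] =
   \sum_(i < N) (i`!%:R^-1)%:C *: wsum i (kcoef k) (fun w => D w (D s (f z)) x) [::].
  apply: eq_bigr => i _; congr (_ *: _); apply: eq_wsum => w _; rewrite cats0 D_cat.
  by apply: (D_perm (@isopenT R n) (sf z Kz)) => //; rewrite perm_catC.
set a := mu z - N%:R - (size s)%:R.
have aM : `|a| <= (M + (N + size s))%:R.
  rewrite /a -addrA -opprD; apply: (le_trans (ler_normB _ _)).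
  by rewrite 2!natrD lerD ?HM// ger0_norm.
have -> : 2 * (n%:R ^+ N * C) * wt R k ^+ (N + (M + (N + size s))) * jap x `^ a =
  2 * ((n%:R * wt R k) ^+ N * (C * (jap x `^ a * wt R k ^+ (M + (N + size s))))).
  by rewrite exprMn [wt R k ^+ (N + _)]exprD; ring.
apply: line_taylor => [|t t01]; first by apply: smooth_on_D; exact: sf.
apply: (pn_wsum _ (normc_kcoef k)); first exact: wt_ge0.
move=> w wN; rewrite cats0 D_cat; apply: (le_trans (HC w (mem_words wN) z Kz _ I)).
rewrite ler_wpM2l// size_cat wN natrD opprD addrA -/a.
exact: peetre_wt.
Qed.

End SymbolClasses.

(** Both sides run over the triples with i + l + m < N, the left one by increasing total degree. *)
Lemma triangular_sum (W : zmodType) (t : nat -> nat -> nat -> W) N :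
  \sum_(j < N) \sum_(i < j.+1) \sum_(l < j.+1 - i) t i l (j - i - l)%N =
  \sum_(i < N) \sum_(l < N - i) \sum_(m < N - i - l) t i l m.
Proof.
elim: N => [|N IH]; first by rewrite !big_ord0.
rewrite big_ord_recr /= IH.
have E (i : 'I_N.+1) : \sum_(l < N.+1 - i) \sum_(m < N.+1 - i - l) t i l m =
  \sum_(l < N - i) \sum_(m < N - i - l) t i l m + \sum_(l < N.+1 - i) t i l (N - i - l)%N.
  have iN : (i <= N)%N by rewrite -ltnS.
  rewrite (eq_bigr (fun l : 'I_(N.+1 - i) => \sum_(m < N - i - l) t i l m + t i l (N - i - l)%N)); last first.
    move=> l _; have lN : (l <= N - i)%N by rewrite -ltnS -subSn.
    have -> : (N.+1 - i - l = (N - i - l).+1)%N by move: (nat_of_ord l) lN => p lN; rewrite !subSn.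
    by rewrite big_ord_recr.
  rewrite big_split /=; congr (_ + _); rewrite subSn// big_ord_recr /=.
  by rewrite subnn big_ord0 addr0.
rewrite [RHS](eq_bigr _ (fun i _ => E i)) big_split /=; congr (_ + _).
by rewrite [RHS]big_ord_recr /= subnn big_ord0 addr0.
Qed.

(** * Asymptotic expansion of the composed symbol *)

Section Expansion.
Variables (R : realType) (n : nat) (theta : 'M[R]_n) (T : nctorus theta).
Implicit Types (x y v : 'rV[R]_n) (k : 'rV[int]_n) (z : R[i]) (f g h : 'rV[R]_n -> Cinf T).

Definition V0 : set 'rV[R]_n := [set x | x != 0].
Definition X1 : set 'rV[R]_n := [set x | 1 <= enorm x].

Lemma X1_V0 : X1 `<=` V0.
Proof.
move=> x x1; apply/eqP => x0; have := le_trans x1 (enorm_le_norm x).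
by rewrite x0 normr0 mulr0 ler10.
Qed.

Lemma oV0 : isopen V0. Proof. exact: isopen_neq0. Qed.
Lemma V0T : V0 `<=` setT. Proof. by []. Qed.

(* The symbol of the composition P_f P_g. *)
Definition sharp (f g : 'rV[R]_n -> Cinf T) x : Cinf T :=
  tcomp (fun k => f (x + int_vec R k)) (g x).

Definition tterm i (f g : 'rV[R]_n -> Cinf T) x : Cinf T :=
  tcomp (fun k => taylor_term i f k x) (g x).

(** All contributions of order j below the top: i derivatives of the l-th term of the first symbol,
    paired with the m-th term of the second, where i + l + m = j. *)
Definition sharp_term (rj sj : nat -> 'rV[R]_n -> Cinf T) j x : Cinf T :=
  \sum_(i < j.+1) \sum_(l < j.+1 - i) tterm i (rj l) (sj (j - i - l)%N) x.

Lemma tterm_smooth i f g V : isopen V -> smooth_on V f -> smooth_on V g ->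
  smooth_on V (tterm i f g).
Proof.
move=> oV sf sg; apply: smooth_tprod => //.
  by move=> k; exact: (taylor_term_smooth i k oV sf).1.
exact: taylor_term_loctame.
Qed.

Lemma tterm_gsymb i X V K mu nu (f g : R[i] -> 'rV[R]_n -> Cinf T) : X `<=` V -> isopen V ->
  (forall z, K z -> smooth_on V (f z)) -> (forall z, K z -> smooth_on V (g z)) ->
  gsymb X K mu f -> gsymb X K nu g ->
  gsymb X K (fun z => mu z - i%:R + nu z) (fun z => tterm i (f z) (g z)).
Proof.
move=> XV oV sf sg gf gg; apply: (gsymb_tcomp XV oV).
- by move=> z Kz k; exact: (taylor_term_smooth i k oV (sf z Kz)).1.
- by move=> z Kz; apply: taylor_term_loctame => //; exact: sf.
- exact: sg.
- exact: (taylor_term_ksymb i XV oV sf gf).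
- exact: gg.
Qed.

Lemma taylor_term_tempered i V f x : isopen V -> smooth_on V f -> V x ->
  tempered (fun k => taylor_term i f k x).
Proof. by move=> oV sf Vx; have := loctame_tempered (taylor_term_loctame i oV sf) [::] Vx. Qed.

Lemma tterm_subl i V f g h x : isopen V -> smooth_on V f -> smooth_on V g -> V x ->
  tterm i (fun y => f y - g y) h x = tterm i f h x - tterm i g h x.
Proof.
move=> oV sf sg Vx; rewrite /tterm -tcompBl; try exact: taylor_term_tempered Vx.
apply: eq_tcomp => k; rewrite /taylor_term -scalerBr; congr (_ *: _).
have := @wsum_linear R n theta T i (kcoef R k) (-1) (fun w => D w g x) (fun w => D w f x) [::].
rewrite scaleN1r addrC => <-; apply: eq_wsum => w _.
by rewrite ((smooth_onB oV sf sg).2 _ x Vx) scaleN1r addrC.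
Qed.

Lemma tterm_suml i V N (F : nat -> 'rV[R]_n -> Cinf T) h x : isopen V ->
  (forall l, smooth_on V (F l)) -> V x ->
  tterm i (fun y => \sum_(l < N) F l y) h x = \sum_(l < N) tterm i (F l) h x.
Proof.
move=> oV sF Vx; rewrite /tterm -tcomp_suml => [|l]; last exact: (taylor_term_tempered i oV (sF l) Vx).
apply: eq_tcomp => k; rewrite /taylor_term -scaler_sumr; congr (_ *: _).
have {1}-> : wsum i (kcoef R k) (fun w => D w (fun y => \sum_(l < N) F l y) x) [::] =
   wsum i (kcoef R k) (fun w => \sum_(l < N) D w (F l) x) [::].
  apply: eq_wsum => w _.
  exact: ((smooth_on_sum (index_enum 'I_N) oV (fun l : 'I_N => sF l)).2 _ x Vx).
elim: (index_enum 'I_N) => [|l L IH].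
  rewrite big_nil (@eq_wsum R n theta T i (kcoef R k) _ (fun w => 0 *: D w h x)); last first.
    by move=> w _; rewrite big_nil scale0r.
  by rewrite wsumZ scale0r.
rewrite big_cons -IH -[wsum i _ (fun w => D w (F l) x) _]scale1r -wsum_linear.
by apply: eq_wsum => w _; rewrite big_cons scale1r.
Qed.

Lemma remainder_smooth V f (fj : nat -> 'rV[R]_n -> Cinf T) N : isopen V ->
  smooth_on V f -> (forall j, smooth_on V (fj j)) -> smooth_on V (remainder f fj N).
Proof.
move=> oV sf sj; apply: (smooth_onB oV sf _).1.
exact: (smooth_on_sum (index_enum 'I_N) oV (fun j : 'I_N => sj j)).1.
Qed.

Lemma taylor_rem_tempered N f x : loctame setT (taylor_rem N f) ->
  tempered (fun k => taylor_rem N f k x).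
Proof. by move=> lf; exact: (loctame_tempered lf [::] (I : setT x)). Qed.

(** Three successive truncations: Taylor's formula for f at order N; then, in its i-th term, f is
    replaced by its first N - i homogeneous parts; then, in the term (i, l), g by its first N - i -
    l. What is left are exactly the products of total degree below N. *)
Lemma sharp_decomp f g (fj gj : nat -> 'rV[R]_n -> Cinf T) N x :
  smooth_on setT f -> smooth_on setT g -> loctame setT (taylor_rem N f) ->
  (forall j, smooth_on V0 (fj j)) -> (forall j, smooth_on V0 (gj j)) -> V0 x ->
  remainder (sharp f g) (sharp_term fj gj) N x =
    tcomp (fun k => taylor_rem N f k x) (g x)
    + (\sum_(i < N) tterm i (remainder f fj (N - i)) g x
    + \sum_(i < N) \sum_(l < N - i) tterm i (fj l) (remainder g gj (N - i - l)) x).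
Proof.
move=> sf sg lr sfj sgj Vx.
have sf0 := smooth_onS V0T sf.
rewrite /remainder /sharp_term (triangular_sum (fun i l m => tterm i (fj l) (gj m) x)).
have tt i := taylor_term_tempered i (@isopenT R n) sf (I : setT x).
have ttj i j := taylor_term_tempered i oV0 (sfj j) Vx.
have -> : sharp f g x = tcomp (fun k => taylor_rem N f k x) (g x) + \sum_(i < N) tterm i f g x.
  rewrite /tterm -tcomp_suml => [|i]; last exact: tt.
  rewrite -tcompDl; [|exact: taylor_rem_tempered|apply: tempered_sum => i; exact: tt].
  by apply: eq_tcomp => k; rewrite /taylor_rem subrK.
rewrite -addrA; congr (_ + _).
rewrite -big_split /= -sumrB; apply: eq_bigr => i _.
rewrite (tterm_subl i g oV0 sf0 _ Vx); last first.
  exact: (smooth_on_sum (index_enum 'I_(N - i)) oV0 (fun j : 'I_(N - i) => sfj j)).1.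
rewrite (tterm_suml i (N - i) g oV0 sfj Vx) -addrA; congr (_ + _).
rewrite -!sumrN -big_split /=; apply: eq_bigr => l _.
rewrite [X in _ = _ + X]/tterm /remainder (tcompBr _ _ (ttj i l)) (tcomp_sumr _ _ (ttj i l)).
by rewrite addrA addNr add0r.
Qed.

Variables (K : set R[i]) (mu nu : R[i] -> R) (rho sig : R[i] -> 'rV[R]_n -> Cinf T).
Variables (rj sj : nat -> R[i] -> 'rV[R]_n -> Cinf T).
Hypotheses (bmu : bounded_on K mu).
Hypotheses (srho : forall z, K z -> smooth_on setT (rho z)) (ssig : forall z, K z -> smooth_on setT (sig z)).
Hypotheses (grho : gsymb setT K mu rho) (gsig : gsymb setT K nu sig).
Hypotheses (srj : forall j z, K z -> smooth_on V0 (rj j z)) (ssj : forall j z, K z -> smooth_on V0 (sj j z)).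
Hypothesis (rrem : forall N, gsymb X1 K (fun z => mu z - N%:R) (fun z => remainder (rho z) (rj^~ z) N)).
Hypothesis (srem : forall N, gsymb X1 K (fun z => nu z - N%:R) (fun z => remainder (sig z) (sj^~ z) N)).

(** A homogeneous term is a difference of two consecutive remainders, and so inherits their bounds
    on X1, uniformly in z. *)
Lemma term_gsymb l : gsymb X1 K (fun z => mu z - l%:R) (rj l).
Proof.
have sr z N : K z -> smooth_on V0 (remainder (rho z) (rj^~ z) N).
  by move=> Kz; apply: (remainder_smooth N oV0 (smooth_onS V0T (srho Kz))) => j; exact: srj.
have E z : K z -> forall x, V0 x ->
    remainder (rho z) (rj^~ z) l x - remainder (rho z) (rj^~ z) l.+1 x = rj l z x.
  by move=> Kz x _; rewrite /remainder big_ord_recr /=; cinf_ring.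
apply: (gsymb_ext X1_V0 oV0 E); apply: (gsymbB X1_V0 oV0); [by move=> z; exact: sr|by move=> z; exact: sr|exact: rrem|].
apply: (gsymb_mono _ (@rrem l.+1)) => z Kz.
by rewrite lerD2l lerN2 ler_nat.
Qed.

Lemma sharp_loctame z : K z -> loctame setT (fun k x => rho z (x + int_vec R k)).
Proof. by move=> Kz; apply: (ksymbT_loctame Kz (shift_ksymb bmu srho grho)). Qed.

Lemma sharp_smooth z : K z -> smooth_on setT (sharp (rho z) (sig z)).
Proof.
move=> Kz; apply: smooth_tprod; [exact: isopenT| |exact: sharp_loctame|exact: ssig].
by move=> k; exact: (shift_smooth (int_vec R k) (srho Kz)).1.
Qed.

(** Each error of [sharp_decomp] has order mu + nu - N: the Taylor remainder as (mu - N) + nu, the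
    second kind as (mu - (N - i)) - i + nu, the third as (mu - l) - i + (nu - (N - i - l)). *)
Lemma sharp_remainder N : gsymb X1 K (fun z => mu z + nu z - N%:R)
  (fun z => remainder (sharp (rho z) (sig z)) (sharp_term (rj^~ z) (sj^~ z)) N).
Proof.
have sr0 z N' : K z -> smooth_on V0 (remainder (rho z) (rj^~ z) N').
  by move=> Kz; apply: (remainder_smooth N' oV0 (smooth_onS V0T (srho Kz))) => j; exact: srj.
have ss0 z N' : K z -> smooth_on V0 (remainder (sig z) (sj^~ z) N').
  by move=> Kz; apply: (remainder_smooth N' oV0 (smooth_onS V0T (ssig Kz))) => j; exact: ssj.
have kr := taylor_rem_ksymb N bmu srho grho.
have lr z : K z -> loctame setT (taylor_rem N (rho z)) by move=> Kz; exact: (ksymbT_loctame Kz kr).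
have stt k z : K z -> smooth_on V0 (taylor_rem N (rho z) k).
  by move=> Kz; apply: (smooth_onS V0T); exact: (taylor_rem_smooth N k (srho Kz)).1.
have ssig0 z : K z -> smooth_on V0 (sig z) by move=> Kz; exact: (smooth_onS V0T (ssig Kz)).
have lr0 z : K z -> loctame V0 (taylor_rem N (rho z)) by move=> Kz s m x Vx; exact: (lr z Kz s m x I).
have gsig1 : gsymb X1 K nu sig by apply: gsymbS gsig.
have E z : K z -> forall x, V0 x ->
    tcomp (fun k => taylor_rem N (rho z) k x) (sig z x)
    + (\sum_(i < N) tterm i (remainder (rho z) (rj^~ z) (N - i)) (sig z) x
    + \sum_(i < N) \sum_(l < N - i) tterm i (rj l z) (remainder (sig z) (sj^~ z) (N - i - l)) x)
    = remainder (sharp (rho z) (sig z)) (sharp_term (rj^~ z) (sj^~ z)) N x.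
  move=> Kz x Vx; rewrite sharp_decomp //; [exact: srho|exact: ssig|exact: lr| |].
    by move=> j; exact: srj.
  by move=> j; exact: ssj.
have sB (i : 'I_N) z : K z -> smooth_on V0 (tterm i (remainder (rho z) (rj^~ z) (N - i)) (sig z)).
  by move=> Kz; apply: tterm_smooth oV0 _ _; [exact: sr0|exact: ssig0].
have sC (i l : nat) N' z : K z -> smooth_on V0 (tterm i (rj l z) (remainder (sig z) (sj^~ z) N')).
  by move=> Kz; apply: tterm_smooth oV0 _ _; [exact: srj|exact: ss0].
have sC' (i : 'I_N) z : K z -> smooth_on V0 (fun x => \sum_(l < N - i) tterm i (rj l z) (remainder (sig z) (sj^~ z) (N - i - l)) x).
  by move=> Kz; exact: (smooth_on_sum (index_enum 'I_(N - i)) oV0 (fun l : 'I_(N - i) => sC i l (N - i - l)%N z Kz)).1.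
have sB' z : K z -> smooth_on V0 (fun x => \sum_(i < N) tterm i (remainder (rho z) (rj^~ z) (N - i)) (sig z) x).
  by move=> Kz; exact: (smooth_on_sum (index_enum 'I_N) oV0 (fun i => sB i z Kz)).1.
have sC'' z : K z -> smooth_on V0 (fun x => \sum_(i < N) \sum_(l < N - i) tterm i (rj l z) (remainder (sig z) (sj^~ z) (N - i - l)) x).
  by move=> Kz; exact: (smooth_on_sum (index_enum 'I_N) oV0 (fun i => sC' i z Kz)).1.
apply: (gsymb_ext X1_V0 oV0 E); apply: (gsymbD X1_V0 oV0).
- by move=> z Kz; apply: (smooth_tprod oV0 _ (lr0 z Kz) (ssig0 z Kz)) => k; exact: stt.
- by move=> z Kz; exact: (smooth_onD oV0 (sB' z Kz) (sC'' z Kz)).1.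
- apply: (@gsymb_mono _ _ _ _ _ _ (fun z => mu z - N%:R + nu z)); first by move=> z _; lra.
  apply: (gsymb_tcomp X1_V0 oV0); [by move=> z Kz k; exact: stt|exact: lr0|exact: ssig0| |exact: gsig1].
  by apply: ksymbS kr.
apply: (gsymbD X1_V0 oV0 sB' sC'').
  apply: (gsymb_sum X1_V0 oV0 sB) => i _.
  apply: (@gsymb_mono _ _ _ _ _ _ (fun z => mu z - (N - i)%:R - i%:R + nu z)).
    by move=> z _; rewrite natrB 1?ltnW//; lra.
  by apply: (tterm_gsymb i X1_V0 oV0) => // z; exact: sr0.
apply: (gsymb_sum X1_V0 oV0 sC') => i _.
apply: (gsymb_sum X1_V0 oV0 (fun l : 'I_(N - i) => sC i l (N - i - l)%N)) => l _.
apply: (@gsymb_mono _ _ _ _ _ _ (fun z => mu z - l%:R - i%:R + (nu z - (N - i - l)%:R))).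
  by move=> z _; rewrite natrB 1?ltnW// natrB 1?ltnW//; lra.
apply: (tterm_gsymb i X1_V0 oV0); [exact: srj|by move=> z; exact: ss0|exact: term_gsymb|exact: srem].
Qed.

End Expansion.

Arguments V0 {R n}.
Arguments X1 {R n}.
Arguments oV0 {R n} _ _.
Arguments V0T {R n} _ _.
Arguments X1_V0 {R n} _ _.

(** * Homogeneity of the terms of the expansion *)

Section ComplexPowers.
Variable R : realType.

Lemma cpowRD (t : R) (p q : R[i]) : 0 < t -> cpowR t (p + q) = cpowR t p * cpowR t q.
Proof.
move=> t0; rewrite /cpowR.
have -> : complex.Re (p + q) = complex.Re p + complex.Re q by case: p; case: q.
have -> : complex.Im (p + q) = complex.Im p + complex.Im q by case: p; case: q.
rewrite powRD ?(gt_eqF t0) ?implybT// mulrDl expiD rmorphM/=.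
by rewrite mulrACA.
Qed.

Lemma cpowRN1 (t : R) : 0 < t -> cpowR t (-1) = (t^-1)%:C.
Proof.
move=> t0; rewrite /cpowR /= oppr0 mul0r expi0 mulr1; congr (_%:C).
by rewrite powRN powRr1 ?ltW.
Qed.

End ComplexPowers.

Section Homogeneity.
Variables (R : realType) (n : nat) (theta : 'M[R]_n) (T : nctorus theta).
Implicit Types (x y v : 'rV[R]_n) (k : 'rV[int]_n) (q p : R[i]) (f g : 'rV[R]_n -> Cinf T).

Definition homog q f := forall (t : R) x, 0 < t -> V0 x -> f (t *: x) = cpowR t q *: f x.

Lemma D_homog q f s : smooth_on V0 f -> homog q f -> homog (q - (size s)%:R) (D s f).
Proof.
move=> /smooth_onP sf hf; elim: s => [|j s IH] /=; first by rewrite subr0.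
move=> t x t0 Vx; have [r r0 Vr] := oV0 x Vx.
have -> : q - (size s).+1%:R = (q - (size s)%:R) + -1 by rewrite -natr1; ring.
rewrite cpowRD// cpowRN1//; set c := cpowR t _.
apply: pderivE.
have [_ /(_ j) d1] := sf s x Vx.
have d2 := has_ddZl c (has_ddZ t^-1 d1).
rewrite -[(c * _) *: _]scalerA.
(* The increment h e_j at t x is t times the increment (h / t) e_j at x: this is the chain rule for
   the dilation, and it brings the factor 1 / t. *)
apply: (@has_cd_ext _ _ _ _ (fun h => c *: D s f (x + h *: (t^-1 *: delta_mx ord0 j))) _ _ _ (r * t)); last exact: d2.
  exact: mulr_gt0.
move=> h; rewrite (add0r h) => hr.
have tx : t *: x + h *: delta_mx ord0 j = t *: (x + h *: (t^-1 *: delta_mx ord0 j)).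
  rewrite [RHS]scalerDr; congr (_ + _); rewrite !scalerA; congr (_ *: _).
  by rewrite mulrAC divff ?mul1r// gt_eqF.
rewrite tx IH//; apply: Vr; rewrite addrKl !mx_normZ normfV (gtr0_norm t0).
have ej : `|delta_mx ord0 j : 'rV[R]_n| <= 1.
  apply: ler_norm_coord => // l.
  by rewrite mxE; case: (_ && _); rewrite /= ?normr1 ?normr0 ?ler01.
apply: (@le_lt_trans _ _ (`|h| / t)); last by rewrite ltr_pdivrMr.
by rewrite ler_wpM2l// ler_piMr// invr_ge0 ltW.
Qed.

Lemma taylor_term_homog i q f k : smooth_on V0 f -> homog q f ->
  homog (q - i%:R) (taylor_term i f k).
Proof.
move=> sf hf t x t0 Vx; rewrite /taylor_term.
rewrite (@eq_wsum _ _ _ _ i _ _ (fun w => cpowR t (q - i%:R) *: D w f x)); last first.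
  by move=> w wi; rewrite cats0 (D_homog w sf hf t0 Vx) wi.
by rewrite wsumZ !scalerA mulrC.
Qed.

Lemma tterm_homog i q p f g : smooth_on V0 f -> homog q f -> homog p g ->
  homog (q - i%:R + p) (tterm i f g).
Proof.
move=> sf hf hg t x t0 Vx; have tt := taylor_term_tempered i oV0 sf Vx.
rewrite /tterm hg// (@eq_tcomp _ _ _ _ _ (fun k => cpowR t (q - i%:R) *: taylor_term i f k x)).
  by rewrite (tcompZl _ _ tt) (tcompZr _ _ tt) scalerA -(cpowRD _ _ t0).
by move=> k; rewrite (taylor_term_homog i k sf hf).
Qed.

Lemma sharp_term_homogeneous p q (rj sj : nat -> 'rV[R]_n -> Cinf T) :
  (forall j, homogeneous_symbol (p - j%:R) (rj j)) ->
  (forall j, homogeneous_symbol (q - j%:R) (sj j)) ->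
  forall j, homogeneous_symbol (p + q - j%:R) (sharp_term rj sj j).
Proof.
move=> hr hs j; split.
  apply: (smooth_on_sum (index_enum 'I_j.+1) oV0 _).1 => i.
  apply: (smooth_on_sum (index_enum 'I_(j.+1 - i)) oV0 _).1 => l.
  by apply: tterm_smooth oV0 _ _; [exact: (hr l).1|exact: (hs _).1].
move=> t x t0 Vx; rewrite /sharp_term scaler_sumr; apply: eq_bigr => i _.
rewrite scaler_sumr; apply: eq_bigr => l _.
have li : (l <= j - i)%N by rewrite -ltnS -subSn ?ltn_ord// -ltnS ltn_ord.
have -> : p + q - j%:R = (p - l%:R) - i%:R + (q - (j - i - l)%:R).
  have ij : (i <= j)%N by rewrite -ltnS.
  by rewrite natrB// natrB//; ring.
by apply: tterm_homog => //; [exact: (hr l).1|exact: (hr l).2|exact: (hs _).2].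
Qed.

End Homogeneity.

(** * From Euclidean bounds in C*-semi-norms to [jap] bounds in [pn], and back *)

Section BoundConversion.
Variables (R : realType) (n : nat) (theta : 'M[R]_n) (T : nctorus theta).
Implicit Types (x y v : 'rV[R]_n) (k : 'rV[int]_n) (z : R[i]).

(** The constant depends on the exponents through their bound M only, hence is the same for all z of
    a compact set. *)
Lemma powR_comparable (x y c a : R) (M : nat) : 0 < x -> 0 < y -> 1 <= c ->
  x <= c * y -> y <= c * x -> `|a| <= M%:R -> x `^ a <= c ^+ M * y `^ a.
Proof.
move=> x0 y0 c1 xy yx aM; have c0 : 0 <= c by apply: le_trans c1.
apply: (@le_trans _ _ (c `^ `|a| * y `^ a)); last first.
  by rewrite ler_wpM2r ?powR_ge0// powR_le_expr.
have [a0|a0] := leP 0 a.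
  rewrite ger0_norm// -powRM ?(ltW y0)//; apply: powR_base_le => //; exact: ltW.
rewrite ltr0_norm// -[X in x `^ X]opprK -[X in y `^ X]opprK !(powRN _ (- a)).
have a0' : 0 <= - a by rewrite oppr_ge0 ltW.
rewrite mulrC ler_pdivlMl ?powR_gt0// ler_pdivrMr ?powR_gt0//.
by rewrite -powRM ?(ltW x0)//; apply: powR_base_le => //; exact: ltW.
Qed.

Lemma X1_enorm_gt0 x : X1 x -> 0 < enorm x.
Proof. exact: lt_le_trans. Qed.

(** The constant [n.+2] serves this comparison and the converse one on X1, where [jap x] is at most
    twice the Euclidean norm. *)
Lemma enorm_le_jap x : enorm x <= n.+2%:R * jap x.
Proof.
apply: (le_trans (enorm_le_norm x)); rewrite /jap mulrDr mulr1.
apply: (@le_trans _ _ (n.+2%:R * `|x|)); last by rewrite lerDr.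
by rewrite ler_wpM2r// ler_nat.
Qed.

Lemma jap_le_enorm x : X1 x -> jap x <= n.+2%:R * enorm x.
Proof.
move=> x1; apply: (@le_trans _ _ (2 * enorm x)).
  by rewrite /jap mulr_natl mulr2n lerD// norm_le_enorm.
by rewrite ler_wpM2r ?sqrtr_ge0// (ler_nat _ 2).
Qed.

Lemma enorm_powR x (a : R) M : X1 x -> `|a| <= M%:R ->
  enorm x `^ a <= n.+2%:R ^+ M * jap x `^ a /\ jap x `^ a <= n.+2%:R ^+ M * enorm x `^ a.
Proof.
move=> x1 aM; have c1 : 1 <= n.+2%:R :> R by rewrite (ler_nat _ 1).
by split; apply: powR_comparable => //; rewrite ?jap_gt0 ?X1_enorm_gt0 ?enorm_le_jap ?jap_le_enorm.
Qed.

Variables (K : set R[i]) (w : R[i] -> R[i]) (N : nat).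
Variables (rho : R[i] -> 'rV[R]_n -> Cinf T) (rj : nat -> R[i] -> 'rV[R]_n -> Cinf T).
Hypothesis bw : bounded_on K (fun z => complex.Re (w z)).
Hypothesis sr : forall z, K z -> smooth_on V0 (remainder (rho z) (rj^~ z) N).

Lemma order_bound (p : nat) : exists M : nat, forall z, K z ->
  `|complex.Re (w z) - N%:R - p%:R| <= M%:R.
Proof.
have [M HM] := bw; exists (M + (N + p))%N => z Kz; rewrite -addrA -opprD.
by apply: (le_trans (ler_normB _ _)); rewrite 2!natrD lerD ?HM// ger0_norm.
Qed.

Lemma remainder_gsymb :
  (forall a b, exists C, forall z, K z -> remainder_bound (w z) (rho z) (rj^~ z) N a b C) ->
  gsymb X1 K (fun z => complex.Re (w z) - N%:R) (fun z => remainder (rho z) (rj^~ z) N).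
Proof.
move=> H m s; have [M HM] := order_bound (size s).
(* The given bounds are indexed by multi-indices; [D_miter] turns the word s into the multi-index of
   its letter counts. *)
pose b j := count_mem j s.
have [C0 HC0] := H (fun=> 0%N) b.
have /choice[Cj HCj] j := H (single_order m j) b.
pose S := `|C0| + \sum_(j < n) `|Cj j|.
have S0 : 0 <= S by rewrite addr_ge0// sumr_ge0.
exists (2 ^+ m * (S * n.+2%:R ^+ M)); split; first by rewrite !mulr_ge0 ?exprn_ge0.
move=> z Kz x x1; rewrite (D_miter s oV0 (sr Kz) (X1_V0 x x1)) -/b.
apply: (le_trans (pn_le_Cinf_snorm _ _)); rewrite -mulrA ler_wpM2l ?exprn_ge0//.
have sb : mord_size b = size s by exact: size_count_word.
set a := complex.Re (w z) - N%:R - (size s)%:R.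
apply: (@le_trans _ _ (S * enorm x `^ a)).
  rewrite /S mulrDl mulr_suml; apply: lerD.
    have := HC0 z Kz x x1; rewrite sb => /le_trans; apply.
    by rewrite ler_wpM2r ?powR_ge0// ler_norm.
  apply: ler_sum => j _; have := HCj j z Kz x x1; rewrite sb => /le_trans; apply.
  by rewrite ler_wpM2r ?powR_ge0// ler_norm.
by rewrite -mulrA ler_wpM2l// (enorm_powR x1 (HM z Kz)).1.
Qed.

Lemma gsymb_remainder :
  gsymb X1 K (fun z => complex.Re (w z) - N%:R) (fun z => remainder (rho z) (rj^~ z) N) ->
  forall a b, exists C, forall z, K z -> remainder_bound (w z) (rho z) (rj^~ z) N a b C.
Proof.
move=> H a b; have [M HM] := order_bound (mord_size b).
have [C [C0 HC]] := H (mord_size a + 2 * n)%N (word b).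
exists (4 ^+ n * (C * n.+2%:R ^+ M)) => z Kz x x1; rewrite miterE.
apply: (le_trans (Cinf_snorm_le_pn _ _)); rewrite -mulrA ler_wpM2l ?exprn_ge0//.
apply: (le_trans (HC z Kz x x1)); rewrite size_word -mulrA ler_wpM2l//.
exact: (enorm_powR x1 (HM z Kz)).2.
Qed.

(** On the unit ball [jap x] lies between 1 and 2, so its power of exponent a is at least 2^-M when
    |a| <= M, and a plain bound there is a symbol estimate. *)
Lemma gsymb_global :
  (forall z, K z -> smooth_on setT (rho z)) ->
  gsymb X1 K (fun z => complex.Re (w z)) rho ->
  (forall m s, exists C, 0 <= C /\ forall z, K z -> forall x, enorm x <= 1 -> pn m (D s (rho z) x) <= C) ->
  gsymb setT K (fun z => complex.Re (w z)) rho.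
Proof.
move=> srho H1 H2 m s; have [A [A0 HA]] := H1 m s; have [B [B0 HB]] := H2 m s.
have [M0 HM0] := bw.
pose M := (M0 + size s)%N.
exists (A + B * 2 ^+ M); split; first by rewrite addr_ge0// mulr_ge0 ?exprn_ge0.
move=> z Kz x _; set a := complex.Re (w z) - (size s)%:R.
have aM : `|a| <= M%:R.
  by apply: (le_trans (ler_normB _ _)); rewrite natrD lerD ?HM0// ger0_norm.
have [x1|/ltW x1] := leP 1 (enorm x).
  by apply: (le_trans (HA z Kz x x1)); rewrite ler_wpM2r ?powR_ge0// lerDl mulr_ge0 ?exprn_ge0.
apply: (le_trans (HB z Kz x x1)); apply: (@le_trans _ _ (B * 2 ^+ M * jap x `^ a)); last first.
  by rewrite ler_wpM2r ?powR_ge0// lerDr.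
have j2 : jap x <= 2 * 1.
  by have := norm_le_enorm x; rewrite /jap; lra.
have h2 : 1 <= 2 * jap x by have := jap_ge1 x; lra.
have := @powR_comparable 1 (jap x) 2 a M ltr01 (jap_gt0 x) _ h2 j2 aM.
rewrite powR1 => K1; rewrite -mulrA -[leLHS]mulr1 ler_wpM2l//; apply: K1; lra.
Qed.

End BoundConversion.

(** * Neighbourhoods and compact sets *)

Lemma nbhs_normcP (R : realType) (z : R[i]) (A : set R[i]) :
  nbhs z A <-> exists2 r : R, 0 < r & forall y, normc (y - z) < r -> A y.
Proof.
have nE (x : R[i]) : `|x| = (normc x)%:C.
  by rewrite normc_def; case: x.
split.
  move=> /nbhs_ballP[e /= e0 H]; move: e0; rewrite ltcE => /andP[/eqP /= ei er].
  exists (complex.Re e) => // y yz; apply: H.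
  change (is_true (`|z - y| < e)%R); rewrite nE ltcE /= ei eqxx /= normc_sub//.
move=> [r r0 H]; apply/nbhs_ballP; exists (r%:C) => /=; first by rewrite ltcR.
move=> y yr; apply: H; move: yr; change (is_true (`|z - y| < r%:C)%R -> normc (y - z) < r).
by rewrite nE ltcR normc_sub.
Qed.

Lemma dnbhs0_normcP (R : realType) (A : set R[i]) :
  (0 : R[i])^' A <-> exists2 r : R, 0 < r & forall h, normc h < r -> h != 0 -> A h.
Proof.
split.
  move=> /nbhs_normcP[r r0 H]; exists r => // h hr h0; apply: H => //.
  by rewrite subr0.
move=> [r r0 H]; apply/nbhs_normcP; exists r => // h.
by rewrite subr0 => hr h0; exact: H.
Qed.

Lemma compact_near_bound (R : realType) (X : ptopologicalType) (K : set X) (P : X -> R -> Prop) :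
  compact K -> (forall x c c', c <= c' -> P x c -> P x c') ->
  (forall x, K x -> exists c, \forall y \near x, P y c) -> exists c, forall y, K y -> P y c.
Proof.
move=> /compact_near_coveringP cK mono ex.
have H : \forall c \near (pinfty_nbhs R), K `<=` (P^~ c).
  apply: (cK R (pinfty_nbhs R) (fun c x => P x c) _) => x Kx; have [c Hc] := ex x Kx.
  exists ([set y | P y c], [set c' | c < c']); first by split; [exact: Hc|apply: nbhs_pinfty_gt; exact: num_real].
  by move=> [y c'] /= [Py /ltW cc]; exact: mono Py.
have [c Hc] := filter_ex H.
by exists c.
Qed.

Lemma compact_unit_box (R : realType) (n : nat) (r : R) : compact [set x : 'rV[R]_n | `|x| <= r].
Proof.
have [r0|r0] := ltP r 0.
  rewrite (_ : [set _ | _] = set0); first exact: compact0.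
  apply/seteqP; split => // x /= xr; have := normr_ge0 x; lra.
have := @rV_compact R n (fun=> `[- r, r]%classic) (fun=> @segment_compact R (- r) r).
congr compact; apply/seteqP; split=> x /= H.
  by apply: ler_norm_coord => // j; have := H j; rewrite in_itv /= -ler_norml.
by move=> i; rewrite in_itv /= -ler_norml; apply: le_trans (ler_coord_norm x i) H.
Qed.

(** Closed squares serve as compact neighbourhoods, being images of products of two segments. *)
Definition csquare (R : realType) (z : R[i]) (r : R) : set R[i] :=
  [set y | `|complex.Re (y - z)| <= r /\ `|complex.Im (y - z)| <= r].

Lemma compact_csquare (R : realType) (z : R[i]) (r : R) : compact (csquare z r).
Proof.
pose F (p : R * R) : R[i] := z + (p.1 +i* p.2).
have -> : csquare z r = F @` (`[- r, r]%classic `*` `[- r, r]%classic).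
  apply/seteqP; split=> y /=.
    move=> [h1 h2]; exists (complex.Re (y - z), complex.Im (y - z)).
      by rewrite /= !in_itv /= -!ler_norml.
    have E (c : R[i]) : complex.Re c +i* complex.Im c = c by case: c.
    by rewrite /F [_ +i* _](E (y - z)) (addrC z (y - z)) subrK.
  move=> [[a b] /= []]; rewrite !in_itv /= -!ler_norml => ha hb <-.
  have E : F (a, b) - z = a +i* b by rewrite /F [z + _]addrC addrK.
  by rewrite /csquare [X in X (F _)]/mkset E.
apply: continuous_compact; last by apply: compact_setX; exact: segment_compact.
apply: continuous_subspaceT => -[a b] A /nbhs_normcP[d d0 H].
exists (ball a (d / 2), ball b (d / 2)); first by split; apply: nbhsx_ballx; rewrite divr_gt0.
move=> [a' b'] /= []; rewrite /ball/= => ha hb; apply: H.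
have -> : F (a', b') - F (a, b) = (a' - a) +i* (b' - b).
  by rewrite /F /= opprD addrACA subrr add0r.
apply: le_lt_trans (normc_le_ReIm _) _ => /=.
by rewrite [d]splitr ltrD// distrC.
Qed.

(** * Holomorphic families *)

Section UniformConvergence.
Variables (R : realType) (n : nat) (theta : 'M[R]_n) (T : nctorus theta).
Implicit Types (x y v : 'rV[R]_n) (s : seq 'I_n) (z : R[i]) (f g l : 'rV[R]_n -> Cinf T).

Lemma CinfRn_snorm_le i f (M : R) : 0 <= M ->
  (forall x, sval i.1.1 x -> Cinf_snorm i.1.2 (miter (@pderiv _ _ _ T) i.2 f x) <= M) ->
  CinfRn_snorm i f <= M.
Proof.
case: i => [[[K cK] a] b] /= M0 H.
have [[x Kx]|K0] := pselect (exists x, K x).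
  apply: ge_sup; last by move=> _ [y Ky <-]; exact: H.
  by exists (Cinf_snorm a (miter (@pderiv _ _ _ T) b f x)), x.
rewrite (_ : [set _ | _ in _] = set0) ?sup0//.
by apply/seteqP; split=> // t [y Ky _]; case: K0; exists y.
Qed.

Lemma pn_bound_compact (K : set 'rV[R]_n) m s f : compact K -> smooth_on setT f ->
  exists C, 0 <= C /\ forall x, K x -> pn m (D s f x) <= C.
Proof.
move=> cK /smooth_onP sf.
have ex x : K x -> exists c, \forall y \near x, pn m (D s f y) <= c.
  move=> _; have [d d0 H] := cont_at_bound m (sf s x I).1.
  exists (pn m (D s f x) + 1); apply/nbhs_ballP; exists d => // y.
  by rewrite mx_norm_ball /ball_ /= distrC => /H.
have [C HC] := @compact_near_bound R _ K (fun x c => pn m (D s f x) <= c) cK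
   (fun x c c' cc H => le_trans H cc) ex.
by exists `|C|; split=> // x Kx; apply: (le_trans (HC x Kx)); exact: ler_norm.
Qed.

Lemma Cinf_snorm_le_CinfRn i f x : smooth_on setT f -> sval i.1.1 x ->
  Cinf_snorm i.1.2 (miter (@pderiv _ _ _ T) i.2 f x) <= CinfRn_snorm i f.
Proof.
case: i => [[[K cK] a] b] /= sf Kx; apply: ub_le_sup; last by exists x.
have [C [C0 HC]] := pn_bound_compact (mord_size a + 2 * n) (word b) cK sf.
exists (4 ^+ n * C) => _ [y Ky <-]; rewrite miterE.
by apply: (le_trans (Cinf_snorm_le_pn _ _)); rewrite ler_wpM2l ?exprn_ge0// HC.
Qed.

(** Eventual smoothness of f h - l is assumed because [sup] of an unbounded set is 0: a small
    semi-norm controls the values on K only when these are bounded. *)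
Lemma CinfRn_cvgP (X : Type) (F : set_system X) (FF : Filter F) (f : X -> 'rV[R]_n -> Cinf T) l :
  (\forall h \near F, smooth_on setT (fun x => f h x - l x)) ->
  sn_cvg (@CinfRn_snorm _ _ _ T) F f l <->
  forall K m s (e : R), compact K -> 0 < e ->
    \forall h \near F, forall x, K x -> pn m (D s (fun x => f h x - l x) x) <= e.
Proof.
move=> smf; split=> H.
  move=> K m s e cK e0; pose b j := count_mem j s.
  pose i (a : 'I_n -> nat) := (exist _ K cK : {K | compact K}, a, b).
  have Hi a : (fun h => CinfRn_snorm (i a) (fun x => f h x - l x)) @ F --> (0 : R) by exact: H.
  have K1 : (fun h => 2 ^+ m * (CinfRn_snorm (i (fun=> 0%N)) (fun x => f h x - l x) +
      \sum_(j < n) CinfRn_snorm (i (single_order m j)) (fun x => f h x - l x))) @ F --> (0 : R).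
    rewrite -[X in _ --> X](mulr0 (2 ^+ m)); apply: cvgM; first exact: cvg_cst.
    rewrite -[X in _ --> X]addr0; apply: cvgD; first exact: Hi.
    rewrite (_ : nbhs 0 = nbhs (\sum_(j < n) (0 : R))); last by rewrite big1.
    by apply: cvg_big => [|j _]; [exact: add_continuous|exact: Hi].
  move/cvgrPdist_le: K1 => /(_ e e0) K1.
  near=> h => x Kx.
  have sh : smooth_on setT (fun x => f h x - l x) by near: h; exact: smf.
  have K2 : `|0 - (2 ^+ m * (CinfRn_snorm (i (fun=> 0%N)) (fun x => f h x - l x) +
      \sum_(j < n) CinfRn_snorm (i (single_order m j)) (fun x => f h x - l x)))| <= e by near: h; exact: K1.
  apply: le_trans K2; rewrite sub0r normrN; apply: le_trans (ler_norm _).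
  rewrite (D_miter s (@isopenT R n) sh (I : setT x)) -/b.
  apply: (le_trans (pn_le_Cinf_snorm _ _)); rewrite ler_wpM2l ?exprn_ge0//.
  apply: lerD; first exact: (@Cinf_snorm_le_CinfRn (i _)).
  by apply: ler_sum => j _; exact: (@Cinf_snorm_le_CinfRn (i _)).
move=> [[[K cK] a] b]; apply/cvgrPdist_le => e e0.
have e1 : 0 < e / 4 ^+ n by rewrite divr_gt0 ?exprn_gt0.
have K1 := H K (mord_size a + 2 * n)%N (word b) _ cK e1.
near=> h.
have K2 : forall x, K x -> pn (mord_size a + 2 * n) (D (word b) (fun x => f h x - l x) x) <= e / 4 ^+ n.
  by near: h; exact: K1.
(* When there is no supremum the semi-norm is 0 by convention. *)
have S0 : 0 <= CinfRn_snorm (exist _ K cK : {K | compact K}, a, b) (f h - l).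
  rewrite /CinfRn_snorm; set E := [set _ | _ in _].
  have [[[t Et] ub]|/sup_out ->//] := pselect (has_sup E).
  by apply: le_trans (ub_le_sup ub Et); case: Et => y _ <-; exact: cnorm_ge0.
rewrite sub0r normrN ger0_norm//; apply: CinfRn_snorm_le => /=; first exact: ltW.
move=> x Kx; rewrite miterE; apply: (le_trans (Cinf_snorm_le_pn _ _)).
by rewrite mulrC -ler_pdivlMr ?exprn_gt0//; exact: K2.
Unshelve. all: by end_near.
Qed.

End UniformConvergence.

Section HolomorphicFamilies.
Variables (R : realType) (n : nat) (theta : 'M[R]_n) (T : nctorus theta).
Implicit Types (x y v : 'rV[R]_n) (s : seq 'I_n) (z h : R[i]) (f g l : 'rV[R]_n -> Cinf T).
Local Notation oT := (@isopenT R n).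

Lemma open_normc (Om : set R[i]) z : open Om -> Om z ->
  exists2 r : R, 0 < r & forall z', normc (z' - z) < r -> Om z'.
Proof. by move=> oO Oz; apply/nbhs_normcP; exact: open_nbhs_nbhs. Qed.

Lemma smooth_quotient (c : R[i]) f g l :
  smooth_on setT f -> smooth_on setT g -> smooth_on setT l ->
  smooth_on setT (fun x => c *: (f x - g x) - l x) /\
  forall s x, D s (fun x => c *: (f x - g x) - l x) x = c *: (D s f x - D s g x) - D s l x.
Proof.
move=> sf sg sl; have [s1 D1] := smooth_onB oT sf sg.
have [s2 D2] := smooth_onZ c oT s1; have [s3 D3] := smooth_onB oT s2 sl.
split; first exact: s3.
by move=> s x; rewrite (D3 s x I) (D2 s x I) (D1 s x I).
Qed.

Variables (Om : set R[i]) (oO : open Om) (rho : R[i] -> 'rV[R]_n -> Cinf T).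

Definition hderiv (drho : R[i] -> 'rV[R]_n -> Cinf T) := forall z, Om z ->
  smooth_on setT (drho z) /\ forall K m s (e : R), compact K -> 0 < e ->
  exists2 r : R, 0 < r & forall h, normc h < r -> h != 0 -> forall x, K x ->
    pn m (h^-1 *: (D s (rho (z + h)) x - D s (rho z) x) - D s (drho z) x) <= e.

Lemma sn_holomorphicP :
  sn_holomorphic (@CinfRn_snorm _ _ _ T) (smooth_on setT) Om rho <->
  (forall z, Om z -> smooth_on setT (rho z)) /\ exists drho, hderiv drho.
Proof.
have FF : Filter (0 : R[i])^' by exact: _.
have near_smooth z l : Om z -> (forall z, Om z -> smooth_on setT (rho z)) -> smooth_on setT l ->
    \forall h \near (0 : R[i])^', smooth_on setT (fun x => (h^-1 *: (rho (z + h) - rho z)) x - l x) /\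
    forall s x, D s (fun x => (h^-1 *: (rho (z + h) - rho z)) x - l x) x =
      h^-1 *: (D s (rho (z + h)) x - D s (rho z) x) - D s l x.
  move=> Oz sr sl; have [r r0 Hr] := open_normc oO Oz.
  apply/dnbhs0_normcP; exists r => // h hr _.
  have Oh : Om (z + h) by apply: Hr; rewrite addrC addKr.
  exact: smooth_quotient (sr _ Oh) (sr _ Oz) sl.
split.
  move=> H; have sr z : Om z -> smooth_on setT (rho z) by move=> /H[].
  split=> //.
  (* Outside [Om] any value will do; [rho z] is a placeholder. *)
  have ex z : exists l, Om z -> smooth_on setT l /\
      sn_cvg (@CinfRn_snorm _ _ _ T) (0 : R[i])^' (fun h => h^-1 *: (rho (z + h) - rho z)) l.
    have [Oz|nOz] := pselect (Om z); last by exists (rho z).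
    by have [_ [l sl cl]] := H z Oz; exists l.
  have [drho Hd] := choice ex; exists drho => z Oz; have [sd cd] := Hd z Oz.
  split=> // K m s e cK e0.
  have near1 := near_smooth z (drho z) Oz sr sd.
  have near2 := (CinfRn_cvgP FF (@filterS _ _ FF _ _ (fun h => @proj1 _ _) near1)).1 cd K m s e cK e0.
  have [r r0 Hr] := (dnbhs0_normcP _).1 (@filterI _ _ FF _ _ near1 near2).
  exists r => // h hr h0 x Kx; have [[_ <-] K2] := Hr h hr h0.
  exact: K2.
move=> [sr [drho Hd]] z Oz; split; first exact: sr.
have [sd cd] := Hd z Oz; exists (drho z) => //.
have near1 := near_smooth z (drho z) Oz sr sd.
apply/CinfRn_cvgP; first by apply: filterS near1 => h [].
move=> K m s e cK e0; apply: filterS2 near1 _; last first.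
  have [r r0 Hr] := cd K m s e cK e0; apply/dnbhs0_normcP; exists r; first exact: r0.
  exact: Hr.
by move=> h [_ E] H x Kx; rewrite E; exact: H.
Qed.

Hypothesis srho : forall z, Om z -> smooth_on setT (rho z).
Variable drho : R[i] -> 'rV[R]_n -> Cinf T.
Hypothesis Hd : hderiv drho.

(** The singleton {x} is compact and a coefficient is bounded by [pn 0], so each coefficient at x is
    a scalar holomorphic function. *)
Lemma hderiv_cdiff z x s k : Om z ->
  cdiff (fun z' => fourier (D s (rho z') x) k) z (fourier (D s (drho z) x) k).
Proof.
move=> Oz e e0; have [r r0 Hr] := (Hd Oz).2 [set x] 0%N s e (@compact_set1 _ x) e0.
exists r => // h hr; have [->|h0] := eqVneq h 0.
  by rewrite addr0 subrr mulr0 subr0 normc0 mulr0.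
have := le_trans (normc_fourier_le_pn0 _ k) (Hr h hr h0 x erefl).
rewrite fourierB fourierZ fourierB => H.
have hp : 0 <= normc h by exact: normc_ge0.
apply: le_trans (ler_wpM2r hp H); rewrite -normcM.
by rewrite mulrBl mulrAC mulVf// mul1r.
Qed.

(** Near z the difference quotient is within 1 of the derivative, so rho z' - rho z is at most r
    times 1 plus a bound of the derivative; compactness of K does the rest. *)
Lemma hderiv_local_bound (K : set R[i]) (B : set 'rV[R]_n) m s : compact K -> K `<=` Om -> compact B ->
  exists C, 0 <= C /\ forall z, K z -> forall x, B x -> pn m (D s (rho z) x) <= C.
Proof.
move=> cK KO cB.
have ex z : K z -> exists c, \forall z' \near z, forall x, B x -> pn m (D s (rho z') x) <= c.
  move=> /KO Oz; have [r r0 Hr] := (Hd Oz).2 B m s 1 cB ltr01.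
  have [C1 [C10 H1]] := pn_bound_compact m s cB (srho Oz).
  have [C2 [C20 H2]] := pn_bound_compact m s cB (Hd Oz).1.
  exists (C1 + r * (1 + C2)); apply/nbhs_normcP; exists r => // z' zr x Bx.
  have [->|zz] := eqVneq z' z.
    by apply: (le_trans (H1 x Bx)); rewrite lerDl mulr_ge0 ?(ltW r0)// addr_ge0.
  have h0 : z' - z != 0 by rewrite subr_eq0.
  have := Hr (z' - z) zr h0 x Bx; rewrite [z + _]addrC subrK; set h := z' - z in h0 zr *.
  set q := _ - D s (drho z) x => Hq.
  have -> : D s (rho z') x = D s (rho z) x + h *: (q + D s (drho z) x).
    rewrite /q subrK scalerA mulfV// scale1r; cinf_ring.
  apply: (le_trans (pnD _ _ _)); apply: lerD; first exact: H1.
  rewrite pnZ; apply: ler_pM; rewrite ?normc_ge0 ?pn_ge0 ?(ltW zr)//.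
  by apply: (le_trans (pnD _ _ _)); apply: lerD; [exact: Hq|exact: H2].
have [C HC] := @compact_near_bound R _ K (fun z c => forall x, B x -> pn m (D s (rho z) x) <= c) cK
   (fun z c c' cc H x Bx => le_trans (H x Bx) cc) ex.
by exists `|C|; split=> // z Kz x Bx; apply: (le_trans (HC z Kz x Bx)); exact: ler_norm.
Qed.

Section Quadratic.
Variables (z0 : R[i]) (r : R) (M : nat).
Hypotheses (r0 : 0 < r) (Od : forall z, normc (z - z0) < 3 * r -> Om z).
Hypothesis grho : gsymb setT [set z | normc (z - z0) < 3 * r] (fun=> M%:R) rho.

(** [holo_quadratic] is applied to each coefficient at each x, with C jap x^(M - |s|) / wt k^m as
    the bound on the disc: the constant [256 * C / r ^+ 2] depends neither on x nor on k. *)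
Lemma hderiv_quadratic m s : exists C, 0 <= C /\ forall h, normc h < r -> forall x,
  pn m (D s (rho (z0 + h)) x - D s (rho z0) x - h *: D s (drho z0) x) <=
    C * jap x `^ (M%:R - (size s)%:R) * normc h ^+ 2.
Proof.
have [C [C0 HC]] := grho m s; exists (256 * C / r ^+ 2); split.
  by apply: divr_ge0; [exact: mulr_ge0|apply: exprn_ge0; exact: ltW].
move=> h hr x; apply: pn_le => k; rewrite !fourierB fourierZ.
have W0 : 0 < wt R k ^+ m by rewrite exprn_gt0// wt_gt0.
rewrite -ler_pdivlMr//.
set a := jap x `^ _.
have -> : 256 * C / r ^+ 2 * a * normc h ^+ 2 / wt R k ^+ m =
    256 * (C * a / wt R k ^+ m) / r ^+ 2 * normc h ^+ 2 by ring.
rewrite [h * _]mulrC.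
apply: (@holo_quadratic R (fun z => fourier (D s (rho z) x) k) (fun z => fourier (D s (drho z) x) k)).
- exact: r0.
- by move=> z zr; apply: hderiv_cdiff; exact: Od.
- move=> z zr; rewrite ler_pdivlMr//; apply: le_trans (fourier_le_pn _ _ k) _.
  exact: HC.
- exact: hr.
Qed.

Definition punctured : set R[i] := [set h | normc h < r /\ h != 0].

(* Dividing the error of the difference quotient once more by |h| keeps it bounded. *)
Definition second_quotient h x : Cinf T :=
  ((normc h)^-1)%:C *: (h^-1 *: (rho (z0 + h) x - rho z0 x) - drho z0 x).

Lemma z0_in : normc (z0 - z0) < 3 * r. Proof. by rewrite subrr normc0 mulr_gt0. Qed.

Lemma disc_in h : normc h < r -> normc (z0 + h - z0) < 3 * r.
Proof.
move=> hr; rewrite addrC addKr; apply: (lt_le_trans hr).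
by rewrite ler_peMl ?(ltW r0)// ler1n.
Qed.

Lemma second_quotient_smooth h : punctured h -> smooth_on setT (second_quotient h).
Proof.
move=> [hr _]; apply: (smooth_onZ _ oT _).1; apply: (smooth_quotient _ _ _ _).1.
- by apply: srho; apply: Od; exact: disc_in.
- by apply: srho; apply: Od; exact: z0_in.
- by apply: (Hd _).1; apply: Od; exact: z0_in.
Qed.

Lemma second_quotient_gsymb : gsymb setT punctured (fun=> M%:R) second_quotient.
Proof.
move=> m s; have [C [C0 HC]] := hderiv_quadratic m s; exists C; split=> // h [hr h0] x _.
have s1 : smooth_on setT (rho (z0 + h)) by apply: srho; apply: Od; exact: disc_in.
have s2 : smooth_on setT (rho z0) by apply: srho; apply: Od; exact: z0_in.
have s3 : smooth_on setT (drho z0) by apply: (Hd _).1; apply: Od; exact: z0_in.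
have [s4 D4] := smooth_quotient h^-1 s1 s2 s3.
rewrite /second_quotient ((smooth_onZ _ oT s4).2 s x I) D4.
have -> : h^-1 *: (D s (rho (z0 + h)) x - D s (rho z0) x) - D s (drho z0) x =
   h^-1 *: (D s (rho (z0 + h)) x - D s (rho z0) x - h *: D s (drho z0) x).
  by rewrite [in RHS]scalerBr scalerA mulVf// scale1r.
have hp : 0 < normc h by rewrite lt_neqAle normc_ge0 andbT eq_sym; apply: contraNneq h0 => /eq0_normc ->.
rewrite pnZ pnZ normc_real ger0_norm ?invr_ge0 ?normc_ge0// normcV.
rewrite ler_pdivrMl// ler_pdivrMl//; apply: (le_trans (HC h hr x)).
by rewrite le_eqVlt; apply/orP; left; apply/eqP; ring.
Qed.

(** At the fixed increment h = r / 2, h times the derivative is an increment of rho minus its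
    quadratic error, and both have symbol bounds. *)
Lemma deriv_gsymb : gsymb setT setT (fun=> M%:R) (fun=> drho z0).
Proof.
move=> m s; have [C [C0 HC]] := hderiv_quadratic m s.
have [A [A0 HA]] := grho m s.
have h2 : 0 < r / 2 by rewrite divr_gt0.
have N2 : normc (r / 2)%:C = r / 2 by rewrite normc_real gtr0_norm.
exists ((2 * A + C * (r / 2) ^+ 2) / (r / 2)); split.
  apply: divr_ge0; last exact: ltW.
  by rewrite addr_ge0// mulr_ge0// ?exprn_ge0// ltW.
move=> _ _ x _; set h := (r / 2)%:C in N2.
have hr : normc h < r by rewrite N2; lra.
have -> : (2 * A + C * (r / 2) ^+ 2) / (r / 2) * jap x `^ (M%:R - (size s)%:R) =
  (2 * A + C * (r / 2) ^+ 2) * jap x `^ (M%:R - (size s)%:R) / (r / 2) by ring.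
rewrite ler_pdivlMr// -{1}N2 mulrC -pnZ.
have -> : h *: D s (drho z0) x = D s (rho (z0 + h)) x - D s (rho z0) x -
  (D s (rho (z0 + h)) x - D s (rho z0) x - h *: D s (drho z0) x) by cinf_ring.
apply: (le_trans (pnB _ _ _)); rewrite mulrDl; apply: lerD.
  apply: (le_trans (pnB _ _ _)); rewrite -mulrA mulr_natl mulr2n; apply: lerD.
    by apply: HA => //; exact: disc_in.
  by apply: HA => //; exact: z0_in.
by apply: (le_trans (HC h hr x)); rewrite N2 mulrAC.
Qed.

End Quadratic.
End HolomorphicFamilies.

(** * Holomorphy of the composed symbol *)

Section SharpHolomorphic.
Variables (R : realType) (n : nat) (theta : 'M[R]_n) (T : nctorus theta).
Implicit Types (x y v : 'rV[R]_n) (s : seq 'I_n) (z h : R[i]) (mu nu : R[i] -> R).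
Implicit Types (f g : R[i] -> 'rV[R]_n -> Cinf T).
Local Notation oT := (@isopenT R n).

Lemma bounded_cst (K : set R[i]) (M : nat) : bounded_on K (fun=> M%:R).
Proof. by exists M => z _; rewrite ger0_norm. Qed.

Lemma gsymbZ (K : set R[i]) mu f (c : R[i] -> R[i]) (B : R) : 0 <= B ->
  (forall z, K z -> normc (c z) <= B) -> (forall z, K z -> smooth_on setT (f z)) ->
  gsymb setT K mu f -> gsymb setT K mu (fun z x => c z *: f z x).
Proof.
move=> B0 HB sf gf m s; have [A [A0 HA]] := gf m s; exists (B * A); split; first exact: mulr_ge0.
move=> z Kz x _; rewrite ((smooth_onZ _ oT (sf z Kz)).2 s x I) pnZ -mulrA.
by apply: ler_pM; rewrite ?normc_ge0 ?pn_ge0 ?HB ?HA.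
Qed.

Lemma gsymb_sharp (K : set R[i]) mu nu f g : bounded_on K mu ->
  (forall z, K z -> smooth_on setT (f z)) -> (forall z, K z -> smooth_on setT (g z)) ->
  gsymb setT K mu f -> gsymb setT K nu g ->
  gsymb setT K (fun z => mu z + nu z) (fun z => sharp (f z) (g z)).
Proof.
move=> bm sf sg gf gg; apply: (gsymb_tcomp (fun _ => id) oT).
- by move=> z Kz k; exact: (shift_smooth (int_vec R k) (sf z Kz)).1.
- by move=> z Kz; exact: (sharp_loctame bm sf gf Kz).
- exact: sg.
- exact: shift_ksymb.
- exact: gg.
Qed.

Lemma shift_tempered (K : set R[i]) mu f z x : bounded_on K mu ->
  (forall z, K z -> smooth_on setT (f z)) -> gsymb setT K mu f -> K z ->
  tempered (fun k => f z (x + int_vec R k)).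
Proof.
by move=> bm sf gf Kz; exact: (loctame_tempered (sharp_loctame bm sf gf Kz) [::] (I : setT x)).
Qed.

Variables (Om : set R[i]) (oO : open Om) (rho sig drho dsig : R[i] -> 'rV[R]_n -> Cinf T).
Hypotheses (srho : forall z, Om z -> smooth_on setT (rho z)) (ssig : forall z, Om z -> smooth_on setT (sig z)).
Hypotheses (hrho : hderiv Om rho drho) (hsig : hderiv Om sig dsig).
Hypothesis grho : forall K, compact K -> K `<=` Om -> exists M : nat, gsymb setT K (fun=> M%:R) rho.
Hypothesis gsig : forall K, compact K -> K `<=` Om -> exists M : nat, gsymb setT K (fun=> M%:R) sig.

Lemma disc_compact z : Om z -> exists (r : R) K, [/\ 0 < r, compact K, K `<=` Om &
  [set z' | normc (z' - z) < 3 * r] `<=` K].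
Proof.
move=> Oz; have [d d0 Hd] := open_normc oO Oz.
have d7 : 0 < d / 7 by rewrite divr_gt0.
exists (d / 7), (csquare z (3 * (d / 7))); split.
- exact: d7.
- exact: compact_csquare.
- move=> z' [h1 h2]; apply: Hd; apply: (le_lt_trans (normc_le_ReIm _)).
  by apply: (le_lt_trans (lerD h1 h2)); lra.
- move=> z' /ltW hz; split; apply: le_trans hz; [exact: ler_normc_Re|exact: ler_normc_Im].
Qed.

(** The telescoped product rule, with a = |h|, c = 1 / |h| and b = 1 / h: X, Y, V are the products
    at (z + h, z + h), (z, z + h), (z, z), and Z, W, U those with one factor differentiated. *)
Lemma sharp_quotient (a b c : R[i]) (X Y Z U V W : Cinf T) : a * c = 1 ->
  a *: (c *: (b *: (X - Y) - Z) + (c *: (Z - W) + c *: (b *: (Y - V) - U))) = b *: (X - V) - (W + U).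
Proof. by move=> ac; rewrite -scalerDr -scalerDr scalerA ac scale1r; cinf_ring. Qed.

(** The error of the difference quotient of the product is |h| times a sum E of three compositions,
    whose factors are bounded in classes of constant order M or N uniformly in h. The error is thus
    O(|h|) in a symbol class of order M + N. *)
Lemma sharp_hderiv_at z0 : Om z0 -> exists l, smooth_on setT l /\
  exists (r : R) (M : nat), 0 < r /\ forall m s, exists C, 0 <= C /\ forall h, punctured r h -> forall x,
    Om (z0 + h) /\ pn m (D s (fun x => h^-1 *:
      (sharp (rho (z0 + h)) (sig (z0 + h)) x - sharp (rho z0) (sig z0) x) - l x) x) <=
    C * jap x ^+ M * normc h.
Proof.
move=> Oz; have [r [K [r0 cK KO dK]]] := disc_compact Oz.
have [M gr] := grho cK KO; have [N gs] := gsig cK KO.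
have {gr} gr : gsymb setT [set z | normc (z - z0) < 3 * r] (fun=> M%:R) rho.
  by move=> m s; have [C [C0 HC]] := gr m s; exists C; split=> // z /dK; exact: HC.
have {gs} gs : gsymb setT [set z | normc (z - z0) < 3 * r] (fun=> N%:R) sig.
  by move=> m s; have [C [C0 HC]] := gs m s; exists C; split=> // z /dK; exact: HC.
have Od z : normc (z - z0) < 3 * r -> Om z by move=> /dK/KO.
pose P := @punctured R r.
have Ph h : P h -> normc (z0 + h - z0) < 3 * r by move=> [hr _]; exact: disc_in.
pose zz := @z0_in R z0 r r0.
pose A := second_quotient rho drho z0; pose B := second_quotient sig dsig z0.
pose S h := sig (z0 + h); pose S0 (_ : R[i]) := sig z0; pose S' (_ : R[i]) := dsig z0.
pose Q h := rho (z0 + h); pose Q0 (_ : R[i]) := rho z0; pose Q' (_ : R[i]) := drho z0.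
(* The increment of sig is divided by |h| rather than h, to match the normalisation of
   [second_quotient]. *)
pose dS h x := ((normc h)^-1)%:C *: (S h x - S0 h x).
have sA h : P h -> smooth_on setT (A h) by exact: (second_quotient_smooth srho hrho r0 Od).
have sB h : P h -> smooth_on setT (B h) by exact: (second_quotient_smooth ssig hsig r0 Od).
have sS h : P h -> smooth_on setT (S h) by move=> Phh; apply: ssig; apply: Od; exact: Ph.
have sQ h : P h -> smooth_on setT (Q h) by move=> Phh; apply: srho; apply: Od; exact: Ph.
have sS0 h : P h -> smooth_on setT (S0 h) by move=> _; exact: ssig.
have sQ0 h : P h -> smooth_on setT (Q0 h) by move=> _; exact: srho.
have sS' h : P h -> smooth_on setT (S' h) by move=> _; exact: (hsig Oz).1.
have sQ' h : P h -> smooth_on setT (Q' h) by move=> _; exact: (hrho Oz).1.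
have gA : gsymb setT P (fun=> M%:R) A by exact: (second_quotient_gsymb srho hrho r0 Od gr).
have gB : gsymb setT P (fun=> N%:R) B by exact: (second_quotient_gsymb ssig hsig r0 Od gs).
have gS : gsymb setT P (fun=> N%:R) S.
  by move=> m s; have [C [C0 HC]] := gs m s; exists C; split=> // h /Ph; exact: HC.
have gQ : gsymb setT P (fun=> M%:R) Q.
  by move=> m s; have [C [C0 HC]] := gr m s; exists C; split=> // h /Ph; exact: HC.
have gQ0 : gsymb setT P (fun=> M%:R) Q0.
  by move=> m s; have [C [C0 HC]] := gr m s; exists C; split=> // h _; exact: HC zz.
have gQ' : gsymb setT P (fun=> M%:R) Q'.
  move=> m s; have [C [C0 HC]] := deriv_gsymb hrho r0 Od gr m s.
  by exists C; split=> // h _; exact: (HC h I).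
have gS' : gsymb setT P (fun=> N%:R) S'.
  move=> m s; have [C [C0 HC]] := deriv_gsymb hsig r0 Od gs m s.
  by exists C; split=> // h _; exact: (HC h I).
have hp h : P h -> 0 < normc h.
  by move=> [_ h0]; rewrite lt_neqAle normc_ge0 andbT eq_sym; apply: contraNneq h0 => /eq0_normc ->.
have sdS h : P h -> smooth_on setT (dS h).
  by move=> Phh; exact: (smooth_onZ _ oT (smooth_onB oT (sS h Phh) (sS0 h Phh)).1).1.
have nP h : P h -> normc ((normc h)^-1)%:C * normc h = 1.
  by move=> Phh; rewrite normc_real ger0_norm ?mulVf ?(gt_eqF (hp h Phh))// invr_ge0 ltW// hp.
(* Here dS = (h / |h|) S' + h B, where the first scalar has modulus 1 and the second is at most
   r. *)
have gdS : gsymb setT P (fun=> N%:R) dS.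
  have g1 : gsymb setT P (fun=> N%:R) (fun h x => (((normc h)^-1)%:C * h) *: S' h x).
    by apply: (@gsymbZ _ _ _ _ 1) => // h Phh; rewrite normcM nP.
  have g2 : gsymb setT P (fun=> N%:R) (fun h x => h *: B h x).
    by apply: (@gsymbZ _ _ _ _ r) => //; [exact: ltW|move=> h [/ltW]].
  have sm1 h : P h -> smooth_on setT (fun x => (((normc h)^-1)%:C * h) *: S' h x).
    by move=> Phh; exact: (smooth_onZ _ oT (sS' h Phh)).1.
  have sm2 h : P h -> smooth_on setT (fun x => h *: B h x).
    by move=> Phh; exact: (smooth_onZ _ oT (sB h Phh)).1.
  apply: (gsymb_ext (fun _ => id) oT _ (gsymbD (fun _ => id) oT sm1 sm2 g1 g2)) => h Phh x _.
  have h0 := Phh.2; rewrite /dS /B /second_quotient -/(S h) -/(S0 h) -/(S' h) -/(S' h x).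
  rewrite [h *: _]scalerA [h * _]mulrC -scalerA -scalerA -scalerDr; congr (_ *: _).
  by rewrite -scalerDr addrC subrK scalerA mulfV// scale1r.
have bM := @bounded_cst P M.
pose E h x := sharp (A h) (S h) x + (sharp (Q' h) (dS h) x + sharp (Q0 h) (B h) x).
have s1 h : P h -> smooth_on setT (sharp (A h) (S h)) by exact: (sharp_smooth bM sA sS gA).
have s2 h : P h -> smooth_on setT (sharp (Q' h) (dS h)) by exact: (sharp_smooth bM sQ' sdS gQ').
have s3 h : P h -> smooth_on setT (sharp (Q0 h) (B h)) by exact: (sharp_smooth bM sQ0 sB gQ0).
have s23 h : P h -> smooth_on setT (fun x => sharp (Q' h) (dS h) x + sharp (Q0 h) (B h) x).
  by move=> Phh; exact: (smooth_onD oT (s2 h Phh) (s3 h Phh)).1.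
have sE h : P h -> smooth_on setT (E h).
  by move=> Phh; exact: (smooth_onD oT (s1 h Phh) (s23 h Phh)).1.
have gE : gsymb setT P (fun=> M%:R + N%:R) E.
  apply: (gsymbD (fun _ => id) oT s1 s23); first exact: (gsymb_sharp bM sA sS gA gS).
  apply: (gsymbD (fun _ => id) oT s2 s3); first exact: (gsymb_sharp bM sQ' sdS gQ' gdS).
  exact: (gsymb_sharp bM sQ0 sB gQ0 gB).
pose l x := sharp (drho z0) (sig z0) x + sharp (rho z0) (dsig z0) x.
have EE h : P h -> forall x, h^-1 *: (sharp (Q h) (S h) x - sharp (rho z0) (sig z0) x) - l x =
    (normc h)%:C *: E h x.
  move=> Phh x.
  have tQ : tempered (fun k => rho (z0 + h) (x + int_vec R k)) by exact: (shift_tempered x bM sQ gQ Phh).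
  have tQ0 : tempered (fun k => rho z0 (x + int_vec R k)) by exact: (shift_tempered x bM sQ0 gQ0 Phh).
  have tQ' : tempered (fun k => drho z0 (x + int_vec R k)) by exact: (shift_tempered x bM sQ' gQ' Phh).
  have tD := temperedB tQ tQ0.
  have tD' := temperedZ h^-1 tD.
  have t1 := temperedB tD' tQ'.
  have -> : E h x = sharp (A h) (S h) x + (sharp (Q' h) (dS h) x + sharp (Q0 h) (B h) x) by [].
  have -> : sharp (A h) (S h) x = ((normc h)^-1)%:C *: (h^-1 *: (sharp (Q h) (S h) x
       - sharp (rho z0) (S h) x) - sharp (drho z0) (S h) x).
    rewrite /sharp; rewrite (tcompZl _ _ t1) (tcompBl _ tD' tQ') (tcompZl _ _ tD) (tcompBl _ tQ tQ0).
    reflexivity.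
  have -> : sharp (Q' h) (dS h) x = ((normc h)^-1)%:C *: (sharp (drho z0) (S h) x - sharp (drho z0) (sig z0) x).
    by rewrite /sharp (tcompZr _ _ tQ') (tcompBr _ _ tQ').
  have -> : sharp (Q0 h) (B h) x = ((normc h)^-1)%:C *: (h^-1 *: (sharp (rho z0) (S h) x
       - sharp (rho z0) (sig z0) x) - sharp (rho z0) (dsig z0) x).
    by rewrite /sharp (tcompZr _ _ tQ0) (tcompBr _ _ tQ0) (tcompZr _ _ tQ0) (tcompBr _ _ tQ0).
  rewrite sharp_quotient//.
  by rewrite -rmorphM /= mulfV ?(gt_eqF (hp h Phh)).
exists l; split.
  (* The smoothness lemma speaks of families over P; any point of P specialises the constant
     ones. *)
  have [h Phh] : exists h, P h.
    have r2 : 0 < r / 2 by rewrite divr_gt0.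
    exists (r / 2)%:C; split; first by rewrite normc_real gtr0_norm//; lra.
    by rewrite -[0]/(0%:C) (inj_eq (@complexI R)) gt_eqF.
  apply: (smooth_onD oT _ _).1.
    exact: (sharp_smooth bM sQ' sS0 gQ' Phh).
  exact: (sharp_smooth bM sQ0 sS' gQ0 Phh).
exists r, (M + N)%N; split=> // m s; have [C [C0 HC]] := gE m s.
exists C; split=> // h Phh x; split; first by apply: Od; exact: Ph.
have [sN DN] := smooth_onZ (normc h)%:C oT (sE h Phh).
rewrite (eq_D oT (fun x _ => EE h Phh x) s I) DN// pnZ normc_real ger0_norm ?normc_ge0// mulrC.
rewrite ler_wpM2r ?normc_ge0//; apply: (le_trans (HC h Phh x I)); rewrite ler_wpM2l//.
by apply: powR_le_expr (jap_ge1 x) _; rewrite natrD gerBl.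
Qed.

Lemma sharp_holomorphic :
  sn_holomorphic (@CinfRn_snorm _ _ _ T) (smooth_on setT) Om (fun z => sharp (rho z) (sig z)).
Proof.
have st z : Om z -> smooth_on setT (sharp (rho z) (sig z)).
  move=> Oz; have O1 : [set z] `<=` Om by move=> _ ->.
  have [M gr] := grho (@compact_set1 _ z) O1.
  apply: (sharp_smooth (@bounded_cst [set z] M) _ _ gr) => // _ ->; [exact: srho|exact: ssig].
move=> z Oz; split; first exact: st.
have [l [sl [r [M [r0 H]]]]] := sharp_hderiv_at Oz; exists l; first exact: sl.
have FF : Filter (0 : R[i])^' by exact: _.
have Pnear : \forall h \near (0 : R[i])^', punctured r h.
  by apply/dnbhs0_normcP; exists r.
have nears : \forall h \near (0 : R[i])^', smooth_on setT (fun x =>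
    (h^-1 *: (sharp (rho (z + h)) (sig (z + h)) - sharp (rho z) (sig z))) x - l x).
  have [C [_ HC]] := H 0%N [::]; apply: filterS Pnear => h Ph.
  have [Oh _] := HC h Ph 0.
  exact: (smooth_quotient _ (st _ Oh) (st _ Oz) sl).1.
apply/(CinfRn_cvgP FF nears) => K m s e cK e0; have [C [C0 HC]] := H m s.
(* On a compact set of xi the growth [jap x ^+ M] is bounded, which is why a larger constant order
   does no harm. *)
have [B HB] : exists B, forall x, K x -> jap x <= B.
  apply: (compact_near_bound cK) => [x c c' cc' H'|x _]; first exact: le_trans H' cc'.
  exists (jap x + 1); apply/nbhs_ballP; exists 1 => //= y.
  by rewrite mx_norm_ball /ball_ /= distrC => /jap_near.
have D0 : 0 < C * `|B| ^+ M + 1 by rewrite ltr_wpDl// mulr_ge0 ?exprn_ge0.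
apply/dnbhs0_normcP; exists (Num.min r (e / (C * `|B| ^+ M + 1))).
  by rewrite lt_min r0 divr_gt0.
move=> h; rewrite lt_min => /andP[hr he] h0 x Kx.
apply: (le_trans (HC h (conj hr h0) x).2).
have jB : jap x ^+ M <= `|B| ^+ M.
  by apply: lerXn2r; rewrite ?nnegrE ?jap_ge0// (le_trans (HB x Kx))// ler_norm.
apply: (@le_trans _ _ ((C * `|B| ^+ M + 1) * normc h)); last first.
  by rewrite mulrC -ler_pdivlMr// ltW.
rewrite ler_wpM2r ?normc_ge0//; apply: (@le_trans _ _ (C * `|B| ^+ M)); last by rewrite lerDl.
by rewrite ler_wpM2l.
Qed.

End SharpHolomorphic.

(** Differentiability bounds w near each point and compactness makes the bound uniform; it keeps the
    exponents of all symbol estimates under a common integer. *)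
Lemma holomorphic_Re_bounded (R : realType) (Om K : set R[i]) (w : R[i] -> R[i]) :
  open Om -> holomorphic Om w -> compact K -> K `<=` Om -> bounded_on K (fun z => complex.Re (w z)).
Proof.
move=> oO hw cK KO.
have ex z : K z -> exists c : R, \forall z' \near z, `|complex.Re (w z')| <= c.
  move=> /KO Oz; have /cvg_ex[/= l cl] := hw z Oz.
  have /cl/dnbhs0_normcP[r r0 Hr] : nbhs l [set y : R[i] | normc (y - l) < 1].
    by apply/nbhs_normcP; exists 1.
  exists (normc (w z) + r * (1 + normc l)); apply/nbhs_normcP; exists r => // z' zr.
  apply: (le_trans (ler_normc_Re _)).
  have [->|zz] := eqVneq z' z.
    by rewrite lerDl mulr_ge0 ?(ltW r0)// addr_ge0 ?normc_ge0.
  have h0 : z' - z != 0 by rewrite subr_eq0.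
  have := Hr (z' - z) zr h0.
  rewrite /= [(z' - z) *: 1]mulr1 subrK; set q := _ - l => Hq.
  have -> : w z' = w z + (z' - z) * (q + l).
    transitivity (w z + (w z' - w z)); first by rewrite addrC subrK.
    by congr (_ + _); rewrite /q subrK; exact/esym/mulVKf.
  apply: (le_trans (ler_normcD _ _)); rewrite lerD2l normcM.
  apply: ler_pM; rewrite ?normc_ge0 ?(ltW zr)//.
  by apply: (le_trans (ler_normcD _ _)); rewrite lerD2r ltW.
have [c Hc] := @compact_near_bound R _ K (fun z c => `|complex.Re (w z)| <= c) cK
  (fun z c c' cc H => le_trans H cc) ex.
exists (Num.bound c) => z Kz; apply: (le_trans (Hc z Kz)).
have c0 : 0 <= c by apply: (le_trans _ (Hc z Kz)).
by apply: ltW; exact: archi_boundP.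
Qed.

Lemma holomorphicD (R : realType) (Om : set R[i]) (w u : R[i] -> R[i]) :
  holomorphic Om w -> holomorphic Om u -> holomorphic Om (fun z => w z + u z).
Proof.
move=> hw hu z Oz; have := @derivableD _ _ _ _ _ _ _ (hw z Oz) (hu z Oz).
rewrite (_ : w + u = (fun z => w z + u z))//; exact/funext.
Qed.

(** * Composition of two holomorphic families *)

Section Assembly.
Variables (R : realType) (n : nat) (theta : 'M[R]_n) (T : nctorus theta).
Variables (Om : set R[i]) (oO : open Om).

Section Family.
Variables (w : R[i] -> R[i]) (hw : holomorphic Om w).
Variables (rho : R[i] -> 'rV[R]_n -> Cinf T) (rj : nat -> R[i] -> 'rV[R]_n -> Cinf T).
Hypothesis hrho : sn_holomorphic (@CinfRn_snorm _ _ _ T) (smooth_on setT) Om rho.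
Hypothesis hrj : forall j z, Om z -> homogeneous_symbol (w z - j%:R) (rj j z).
Hypothesis brj : forall N (K : set R[i]) a b, compact K -> K `<=` Om ->
  exists C, forall z, K z -> remainder_bound (w z) (rho z) (fun j => rj j z) N a b C.
Variables (K : set R[i]) (cK : compact K) (KO : K `<=` Om).

Lemma family_smooth z : K z -> smooth_on setT (rho z).
Proof. by move=> Kz; exact: (hrho (KO Kz)).1. Qed.

Lemma family_remainder_smooth N z : K z -> smooth_on (@V0 R n) (remainder (rho z) (rj^~ z) N).
Proof.
move=> Kz; apply: (remainder_smooth N (@oV0 R n) (smooth_onS (@V0T R n) (family_smooth Kz))) => j.
exact: (hrj j (KO Kz)).1.
Qed.

Lemma family_remainder N :
  gsymb (@X1 R n) K (fun z => complex.Re (w z) - N%:R) (fun z => remainder (rho z) (rj^~ z) N).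
Proof.
apply: remainder_gsymb; [exact: (holomorphic_Re_bounded oO hw cK KO)|exact: family_remainder_smooth|].
by move=> a b; exact: brj.
Qed.

(** The remainder with N = 0 is rho itself, which settles |xi| >= 1; on the unit ball the bound
    comes from holomorphy in C^oo and compactness of K. *)
Lemma family_gsymb : gsymb setT K (fun z => complex.Re (w z)) rho.
Proof.
apply: gsymb_global; [exact: (holomorphic_Re_bounded oO hw cK KO)|exact: family_smooth| |].
  have H := @family_remainder 0; apply: (gsymb_mono (mu := fun z => complex.Re (w z) - 0%:R)).
    by move=> z _; rewrite subr0.
  apply: (gsymb_ext (@X1_V0 R n) (@oV0 R n) _ H) => z Kz x _.
  by rewrite /remainder big_ord0 subr0.
have [srho [drho hd]] := (sn_holomorphicP oO rho).1 hrho.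
move=> m s; have [C [C0 HC]] := hderiv_local_bound srho hd m s cK KO (@compact_unit_box R n 1).
exists C; split=> // z Kz x x1; apply: HC => //=.
exact: le_trans (norm_le_enorm x) x1.
Qed.

End Family.

Lemma family_comp (w u : R[i] -> R[i]) (P Q : R[i] -> Cinf T -> Cinf T) :
  holomorphic_family Om w P -> holomorphic_family Om u Q ->
  holomorphic_family Om (fun z => w z + u z) (fun z => P z \o Q z).
Proof.
move=> [hw [rho [qrho _ hrho [rj [hrj brj]]]]] [hu [sig [qsig _ hsig [sj [hsj bsj]]]]].
have grho K cK KO := @family_gsymb w hw rho rj hrho hrj brj K cK KO.
have gsig K cK KO := @family_gsymb u hu sig sj hsig hsj bsj K cK KO.
have bw K := @holomorphic_Re_bounded R Om K w oO hw.
have bu K := @holomorphic_Re_bounded R Om K u oO hu.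
(* The variable order is replaced by a constant integer on K, as Cauchy's estimate compares
   different values of z. *)
have cst_bound K (v : R[i] -> R[i]) (f : R[i] -> 'rV[R]_n -> Cinf T) : bounded_on K (fun z => complex.Re (v z)) ->
    gsymb setT K (fun z => complex.Re (v z)) f -> exists M : nat, gsymb setT K (fun=> M%:R) f.
  move=> [M HM] gf; exists M; apply: gsymb_mono gf => z Kz.
  by apply: le_trans (HM z Kz); exact: ler_norm.
have [srho [drho hdr]] := (sn_holomorphicP oO rho).1 hrho.
have [ssig [dsig hds]] := (sn_holomorphicP oO sig).1 hsig.
(* Singletons are compact subsets of [Om]: the pointwise symbol property is the uniform estimate
   over {z}. *)
have one z : Om z -> compact [set z] /\ [set z] `<=` Om.
  by move=> Oz; split; [exact: compact_set1|move=> _ ->].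
have bounds N (K : set R[i]) a b : compact K -> K `<=` Om -> exists C, forall z, K z ->
    remainder_bound (w z + u z) (sharp (rho z) (sig z)) (fun j => sharp_term (rj^~ z) (sj^~ z) j) N a b C.
  move=> cK KO.
  have bK := bw K cK KO.
  have srj j z : K z -> smooth_on (@V0 R n) (rj j z) by move=> Kz; exact: (hrj j z (KO _ Kz)).1.
  have ssj j z : K z -> smooth_on (@V0 R n) (sj j z) by move=> Kz; exact: (hsj j z (KO _ Kz)).1.
  have sr z : K z -> smooth_on setT (rho z) by move=> /KO; exact: srho.
  have ss z : K z -> smooth_on setT (sig z) by move=> /KO; exact: ssig.
  have G := sharp_remainder bK sr ss (grho K cK KO) (gsig K cK KO) srj ssj
    (fun N => family_remainder hw hrho hrj brj cK KO N) (fun N => family_remainder hu hsig hsj bsj cK KO N) N.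
  apply: (@gsymb_remainder R n theta T K (fun z => w z + u z) N (fun z => sharp (rho z) (sig z))
     (fun j z => sharp_term (rj^~ z) (sj^~ z) j)).
    have [M HM] := bK; have [M' HM'] := bu K cK KO; exists (M + M')%N => z Kz.
    rewrite raddfD natrD; apply: (le_trans (ler_normD _ _)).
    by rewrite lerD ?HM ?HM'.
  apply: gsymb_mono G => z Kz; by rewrite raddfD.
have homs j z : Om z -> homogeneous_symbol (w z + u z - j%:R) (sharp_term (rj^~ z) (sj^~ z) j).
  by move=> Oz; apply: sharp_term_homogeneous => i; [exact: hrj|exact: hsj].
have hol : sn_holomorphic (@CinfRn_snorm _ _ _ T) (smooth_on setT) Om (fun z => sharp (rho z) (sig z)).
  apply: (sharp_holomorphic oO srho ssig hdr hds) => K cK KO.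
    exact: cst_bound (bw K cK KO) (grho K cK KO).
  exact: cst_bound (bu K cK KO) (gsig K cK KO).
split; first exact: holomorphicD.
exists (fun z => sharp (rho z) (sig z)); split.
- move=> z Oz; have [c1 O1] := one z Oz.
  have tr x : tempered (fun k => rho z (x + int_vec R k)).
    by apply: (shift_tempered x (bw _ c1 O1) _ (grho _ c1 O1)) => // _ ->; exact: srho.
  have ts x : tempered (fun k => sig z (x + int_vec R k)).
    by apply: (shift_tempered x (bu _ c1 O1) _ (gsig _ c1 O1)) => // _ ->; exact: ssig.
  have tr0 : tempered (fun k => rho z (int_vec R k)).
    by move: (tr 0); congr tempered; apply/funext => k; rewrite add0r.
  have ts0 : tempered (fun k => sig z (int_vec R k)).
    by move: (ts 0); congr tempered; apply/funext => k; rewrite add0r.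
  have b0 : bounded_on [set z] (fun z => complex.Re (w z) + complex.Re (u z)).
    have [M HM] := bw _ c1 O1; have [M' HM'] := bu _ c1 O1; exists (M + M')%N => y Ky.
    rewrite natrD; apply: (le_trans (ler_normD _ _)); by rewrite lerD ?HM ?HM'.
  have sr y : [set z] y -> smooth_on setT (rho y) by move=> ->; exact: srho.
  have ss y : [set z] y -> smooth_on setT (sig y) by move=> ->; exact: ssig.
  have gst := gsymb_sharp (bw _ c1 O1) sr ss (grho _ c1 O1) (gsig _ c1 O1).
  have sst y : [set z] y -> smooth_on setT (sharp (rho y) (sig y)).
    by move=> ->; exact: (hol z Oz).1.
  have tst := shift_tempered 0 b0 sst gst (erefl : [set z] z).
  have tst0 : tempered (fun k => sharp (rho z) (sig z) (int_vec R k)).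
    by move: tst; congr tempered; apply/funext => k; rewrite add0r.
  apply/(is_quantizationP _ tst0) => v /=.
  rewrite ((is_quantizationP (P z) tr0).1 (qrho z Oz)) ((is_quantizationP (Q z) ts0).1 (qsig z Oz)).
  (* At an integral point m, [sharp] sums the values of rho at m + k, which is the inner sum in
     [tcompA]. *)
  rewrite tcompA//; apply: eq_tcomp => k; rewrite /sharp; apply: eq_tcomp => j.
  by rewrite int_vecD.
- move=> z Oz; have [c1 O1] := one z Oz; split; first exact: (hol z Oz).1.
  exists (sharp_term (rj^~ z) (sj^~ z)); split; first by move=> j; exact: homs.
  move=> N a b; have [C HC] := bounds N [set z] a b c1 O1.
  by exists C; exact: HC.
- exact: hol.
- exists (fun j z => sharp_term (rj^~ z) (sj^~ z) j); split; first exact: homs.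
  exact: bounds.
Qed.

End Assembly.

Theorem corollary6p34 (R : realType) (n : nat) (hn : (2 <= n)%N)
  (theta : 'M[R]_n) (htheta : theta^T = - theta) (T : nctorus theta)
  (Om : set R[i]) (hOm : open Om) (w u : R[i] -> R[i])
  (P Q : R[i] -> Cinf T -> Cinf T) :
  holomorphic_family Om w P -> holomorphic_family Om u Q ->
  holomorphic_family Om (fun z => w z + u z) (fun z => P z \o Q z).
Proof. exact: family_comp. Qed.
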